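(* Suppose the data come from an MDP with Markov behavior policy $\pi^b$ (known), $0\le\eta_t\le C$, $0\le\mu_t\le C'$, $0\le r_t\le R_{\max}$ for all $t$, and the state spaces are finite, $|\mathcal S_t|<\infty$ for $0\le t\le T$. Let $$\hat w_t(s)=\frac{\sum_{i=1}^n\mathbb I[s^{(i)}_t=s]\,\lambda^{(i)}_{t-1}}{\sum_{i=1}^n\mathbb I[s^{(i)}_t=s]},\qquad\hat\rho^{\pi^e}_{\mathrm{MIS}}=\mathrm E_n\Big[\sum_{t=0}^T\hat w_t(s_t)\eta_tr_t\Big].$$ Then $\hat\rho^{\pi^e}_{\mathrm{MIS}}$ is consistent and asymptotically normal around $\rho^{\pi^e}$, and its asymptotic MSE (the variance of the normal limit of $\sqrt n(\hat\rho^{\pi^e}_{\mathrm{MIS}}-\rho^{\pi^e})$) is $$\mathrm{var}\Big[\sum_{t=0}^T\Big(\mu_tr_t+(\lambda_{t-1}-w_t(s_t))\,\mathrm E_{\pi^e}[r_t\mid s_t]\Big)\Big].$$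
   Context: Fix $T\ge0$. A trajectory is $\mathcal H=(s_0,a_0,r_0,\dots,s_T,a_T,r_T)$. A time-varying MDP (kernels $P_{s_0}$, $P_{s_t}(s_t\mid s_{t-1},a_{t-1})$, $P_{r_t}(r_t\mid s_t,a_t)$) and a Markov policy $(\pi_t(a_t\mid s_t))_t$ induce a trajectory law $P_\pi$ with expectation $\mathrm E_\pi$. Data $\mathcal H^{(1)},\dots,\mathcal H^{(n)}$ i.i.d. from $P_{\pi^b}$; $\mathrm E_n$ is the empirical mean; unsubscripted $\mathrm E,\mathrm{var}$ are under $P_{\pi^b}$; $\pi^e$ is a known target policy. $\rho^{\pi^e}=\mathrm E_{\pi^e}[\sum_tr_t]$. $\eta_t=\pi^e_t(a_t\mid s_t)/\pi^b_t(a_t\mid s_t)$, $\lambda_t=\prod_{k=0}^t\eta_k$, $\lambda_{-1}=1$; $w_t(s_t)=\mathrm E[\lambda_{t-1}\mid s_t]$; $\mu_t=p_{\pi^e_t}(s_t,a_t)/p_{\pi^b_t}(s_t,a_t)$ (marginal density ratio), which equals $\eta_tw_t(s_t)$. $\mathrm E_{\pi^e}[r_t\mid s_t]$ is the conditional mean of $r_t$ given $s_t$ when $a_t\sim\pi^e_t(\cdot\mid s_t)$. *)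

(* Defs.v *)
From HB Require Import structures.
From mathcomp Require Import all_boot all_order all_algebra.
From mathcomp Require Import all_classical all_reals all_analysis.
Set Implicit Arguments. Unset Strict Implicit. Unset Printing Implicit Defensive.
Import Order.TTheory GRing.Theory Num.Theory.
Import numFieldNormedType.Exports.
Local Open Scope classical_set_scope.
Local Open Scope ring_scope.

(* Time-varying MDP with (common) finite state type S, measurable action     *)
(* type A, real rewards.  Trajectories (s_t, a_t, r_t)_{t <= T} are encoded  *)
(* as three functions nat -> S, nat -> A, nat -> R (only t <= T matter).     *)
(*  P0 s            : initial pmf P_{s_0}(s)                                 *)
(*  Ps t s a s'     : P_{s_t}(s' | s_{t-1} = s, a_{t-1} = a)   (t >= 1)       *)
(*  Pr t s          : probability kernel  a |-> P_{r_t}(. | s_t = s, a_t = a) *)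
(*  pi t s a        : density of pi_t(. | s) w.r.t. a base measure nu on A   *)

Definition upd (X : Type) (f : nat -> X) (t : nat) (x : X) : nat -> X :=
  fun k => if k == t then x else f k.

Section MDP.
Context {R : realType} {dA : measure_display} {A : measurableType dA}
  {S : finType}.

Definition trajfun := (nat -> S) -> (nat -> A) -> (nat -> R) -> R.

Variables (nu : {measure set A -> \bar R}) (P0 : S -> R)
  (Ps : nat -> S -> A -> S -> R) (Pr : nat -> S -> R.-pker A ~> R).

Definition mdp_trans (t : nat) (hs : nat -> S) (ha : nat -> A) (s : S) : R :=
  if t is t'.+1 then Ps t (hs t') (ha t') s else P0 s.

Fixpoint evalE (pi : nat -> S -> A -> R) (m t : nat)
    (hs : nat -> S) (ha : nat -> A) (hr : nat -> R) (f : trajfun) : R :=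
  match m with
  | 0 => f hs ha hr
  | m'.+1 => \sum_(s : S) mdp_trans t hs ha s *
      Rintegral nu setT (fun a => pi t s a *
        Rintegral (Pr t s a) setT (fun r =>
          evalE pi m' t.+1 (upd hs t s) (upd ha t a) (upd hr t r) f))
  end.

Definition Expect (T : nat) (pi : nat -> S -> A -> R) (f : trajfun) : R :=
  match [pick x : S] with
  | Some sd => evalE pi T.+1 0 (fun _ => sd) (fun _ => point) (fun _ => 0) f
  | None => 0
  end.

Definition Var (T : nat) (pi : nat -> S -> A -> R) (f : trajfun) : R :=
  Expect T pi (fun hs ha hr => (f hs ha hr) ^+ 2) - (Expect T pi f) ^+ 2.

Variables (T : nat) (pib pie : nat -> S -> A -> R).

Definition eta_r (t : nat) (s : S) (a : A) : R := pie t s a / pib t s a.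

Definition lamprev (t : nat) (hs : nat -> S) (ha : nat -> A) : R :=
  \prod_(k < t) eta_r k (hs k) (ha k).

Definition stateProb (pi : nat -> S -> A -> R) (t : nat) (s : S) : R :=
  Expect T pi (fun hs _ _ => (hs t == s)%:R).

(* w_t(s) = E[lambda_{t-1} | s_t = s] under P_{pi^b} *)
Definition wt (t : nat) (s : S) : R :=
  Expect T pib (fun hs ha _ => (hs t == s)%:R * lamprev t hs ha)
  / stateProb pib t s.

(* mu_t = p_{pi^e_t}(s,a) / p_{pi^b_t}(s,a), marginal density ratio of (s_t,a_t) *)
Definition mu_r (t : nat) (s : S) (a : A) : R :=
  (stateProb pie t s * pie t s a) / (stateProb pib t s * pib t s a).

(* E_{pi^e}[r_t | s_t = s] *)
Definition qe (t : nat) (s : S) : R :=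
  Rintegral nu setT (fun a => pie t s a * Rintegral (Pr t s a) setT (fun r => r)).

Definition rho_e : R := Expect T pie (fun _ _ hr => \sum_(t < T.+1) hr t).

Definition asym_var : R :=
  Var T pib (fun hs ha hr => \sum_(t < T.+1)
    (mu_r t (hs t) (ha t) * hr t
     + (lamprev t hs ha - wt t (hs t)) * qe t (hs t))).

End MDP.

(* The estimator, computed from data sD i t, aD i t, rD i t (i-th trajectory)*)
Section Estimator.
Context {R : realType} {dA : measure_display} {A : measurableType dA}
  {S : finType} {Omega : Type}.
Variables (T : nat) (pib pie : nat -> S -> A -> R)
  (sD : nat -> nat -> Omega -> S) (aD : nat -> nat -> Omega -> A)
  (rD : nat -> nat -> Omega -> R).

Definition lamD (i t : nat) (w : Omega) : R :=
  \prod_(k < t) eta_r pib pie k (sD i k w) (aD i k w).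

Definition w_hat (n t : nat) (s : S) (w : Omega) : R :=
  (\sum_(i < n) (sD i t w == s)%:R * lamD i t w)
  / (\sum_(i < n) (sD i t w == s)%:R).

Definition rho_MIS (n : nat) (w : Omega) : R :=
  n%:R^-1 * \sum_(i < n) \sum_(t < T.+1)
     w_hat n t (sD i t w) w * eta_r pib pie t (sD i t w) (aD i t w) * rD i t w.

End Estimator.

(* E[g(Z)] for Z ~ N(0, V)  (point mass at 0 when V = 0) *)
Definition gaussE {R : realType} (V : R) (g : R -> R) : \bar R :=
  if V == 0 then (g 0)%:E
  else (\int[normal_prob 0 (Num.sqrt V)]_x (g x)%:E)%E.

Definition conv_prob {R : realType} {d : measure_display} {Omega : measurableType d}
  (P : probability Omega R) (X : nat -> Omega -> R) (c : R) : Prop :=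
  forall eps : R, 0 < eps ->
    (fun n => P [set w | eps < `|X n w - c|]) @ \oo --> 0%E.

Definition conv_dist_normal {R : realType} {d : measure_display}
  {Omega : measurableType d} (P : probability Omega R) (X : nat -> Omega -> R)
  (V : R) : Prop :=
  forall g : R -> R, continuous g -> (exists M : R, forall x, `|g x| <= M) ->
    (fun n => \int[P]_w (g (X n w))%:E)%E @ \oo --> gaussE V g.

(* Main.v *)
(** Write [L], [M], [N] for the empirical means of [1{s_t = s} lambda_{t-1}],
    [1{s_t = s} eta_t r_t] and [1{s_t = s}].  The estimator is the sum of
    [L M / N] over [t] and [s], and
      [L M / N - (q L + w M - w q N) = (L - w N) (M - q N) / N],
    where [q s = E_{pi^e}(r_t | s_t = s)] and [w = w_t(s)].  The sum of the terms
    [q L + w M - w q N] is the empirical mean of the variable whose variance is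
    claimed to be the asymptotic MSE.  By the Markov property [L - w N] and
    [M - q N] are empirical means of centred variables, so the right-hand side
    is of order [1 / n] in probability.
    The central limit theorem for bounded i.i.d. summands is obtained from a
    bounded solution of Stein's equation and a leave-one-out expansion.
    The transition probabilities need not be measurable in the action, but the
    rectangle law of the data forces them to be so almost everywhere at
    reachable states; there they are replaced by a measurable version. *)

Require Import Defs.
From HB Require Import structures.
From mathcomp Require Import all_boot all_order all_algebra.
From mathcomp Require Import all_classical all_reals all_analysis.
From mathcomp Require Import measurable_realfun ring lra.
Set Implicit Arguments.
Unset Strict Implicit.
Unset Printing Implicit Defensive.
Import Order.TTheory GRing.Theory Num.Theory.
Import numFieldNormedType.Exports.
Local Open Scope classical_set_scope.
Local Open Scope ring_scope.

(** The expectations are nested integrals of arbitrary functions, for which additivity and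
    positivity are not automatic, and the data are known only through probabilities of rectangles.
    Both are therefore compared on the class [comb] of finite sums of products of bounded
    one-coordinate factors: it is closed under sums and products, the nested integral is linear on
    it, and a bounded linear functional that vanishes on rectangles vanishes on all of it. Rewards
    are bounded only almost surely, so they are clipped to enter this class. The centring of
    [L - w N] and [M - q N] comes from changing the policy: the weight [lambda_{t-1}] replaces
    [pi^b] by [pi^e] before time [t], the weight [eta_t] does so at time [t] only. As [N] may be
    small or zero, no moment of the quotient is estimated; the remainder is controlled through
    [min 1 |.|], dominated by a quadratic expression of mean [O(1 / sqrt n)]. The test functions are
    merely continuous, so the solution of Stein's equation is damped at infinity to make its
    derivative uniformly continuous; the resulting error grows like [x^2] and is absorbed by the
    second moment. *)

Section BoundedMeasurable.
Context {R : realType} {d} {X : measurableType d}.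
Implicit Types f g : X -> R.

(** Such functions are integrable for every measure of mass one and form an algebra, so
    integrability side conditions reduce to this closed class. *)
Definition bmf f := measurable_fun setT f /\ exists M, forall x, `|f x| <= M.

Lemma bmf_measurable f : bmf f -> measurable_fun setT f.
Proof. by case. Qed.

Lemma bmf_cst (c : R) : bmf (fun=> c).
Proof. by split; [exact: measurable_cst|exists `|c|]. Qed.

Lemma bmfD f g : bmf f -> bmf g -> bmf (fun x => f x + g x).
Proof.
move=> [mf [M Mf]] [mg [N Ng]]; split; first exact: measurable_funD.
by exists (M + N) => x; rewrite (le_trans (ler_normD _ _))// lerD.
Qed.

Lemma bmfM f g : bmf f -> bmf g -> bmf (fun x => f x * g x).
Proof.
move=> [mf [M Mf]] [mg [N Ng]]; split; first exact: measurable_funM.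
by exists (M * N) => x; rewrite normrM ler_pM.
Qed.

Lemma bmfZ c f : bmf f -> bmf (fun x => c * f x).
Proof. by move=> bf; apply: bmfM => //; exact: bmf_cst. Qed.

Lemma bmfN f : bmf f -> bmf (fun x => - f x).
Proof.
by move=> /(bmfZ (-1)); rewrite (_ : (fun x => -1 * f x) = fun x => - f x)//;
  apply/funext => x; rewrite mulN1r.
Qed.

Lemma bmfB f g : bmf f -> bmf g -> bmf (fun x => f x - g x).
Proof. by move=> bf bg; apply: bmfD => //; exact: bmfN. Qed.

Lemma bmfX f n : bmf f -> bmf (fun x => f x ^+ n).
Proof.
move=> bf; elim: n => [|n ih]; first exact: bmf_cst.
by rewrite (_ : (fun x => _) = fun x => f x * f x ^+ n);
  [exact: bmfM|apply/funext => x; rewrite exprS].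
Qed.

Lemma bmf_sum (I : Type) (r : seq I) (F : I -> X -> R) :
  (forall i, bmf (F i)) -> bmf (fun x => \sum_(i <- r) F i x).
Proof.
move=> bF; elim: r => [|i r ih].
  by rewrite (_ : (fun x => _) = cst 0); [exact: bmf_cst|
    apply/funext => x; rewrite big_nil].
by rewrite (_ : (fun x => _) = fun x => F i x + \sum_(j <- r) F j x);
  [exact: bmfD|apply/funext => x; rewrite big_cons].
Qed.

Lemma bmf_prod (I : Type) (r : seq I) (F : I -> X -> R) :
  (forall i, bmf (F i)) -> bmf (fun x => \prod_(i <- r) F i x).
Proof.
move=> bF; elim: r => [|i r ih].
  by rewrite (_ : (fun x => _) = cst 1); [exact: bmf_cst|
    apply/funext => x; rewrite big_nil].
by rewrite (_ : (fun x => _) = fun x => F i x * \prod_(j <- r) F j x);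
  [exact: bmfM|apply/funext => x; rewrite big_cons].
Qed.

Lemma bmf_indic (B : set X) : measurable B -> bmf (\1_B : X -> R).
Proof.
move=> mB; split; first exact: measurable_indic.
by exists 1 => x; rewrite indicE; case: (_ \in _); rewrite ?normr1// normr0.
Qed.

Lemma bmf_norm f : bmf f -> bmf (fun x => `|f x|).
Proof.
move=> [mf [M Mf]]; split; first exact: measurableT_comp.
by exists M => x; rewrite normr_id.
Qed.

End BoundedMeasurable.

Lemma bmf_comp {R : realType} {d d'} {X : measurableType d}
    {Y : measurableType d'} (h : X -> Y) (f : Y -> R) :
  measurable_fun setT h -> bmf f -> bmf (fun x => f (h x)).
Proof.
move=> mh [mf [M Mf]]; split; last by exists M => x; exact: Mf.
exact: measurableT_comp.
Qed.

Lemma bmf_comp_cont {R : realType} {d} {X : measurableType d}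
    (f : X -> R) (g : R -> R) :
  measurable_fun setT f -> continuous g -> (exists M, forall x, `|g x| <= M) ->
  bmf (fun x => g (f x)).
Proof.
move=> mf cg [M Mg]; split; last by exists M => x; exact: Mg.
by apply: measurableT_comp => //; exact: continuous_measurable_fun.
Qed.

(** * Means under a measure of total mass one *)

Section MassOne.
Context {R : realType} {d} {X : measurableType d}.
Variable mu : {measure set X -> \bar R}.
Hypothesis mu1 : mu setT = 1%E.
Implicit Types f g : X -> R.

Lemma bmf_integrable f : bmf f -> mu.-integrable setT (EFin \o f).
Proof.
move=> [mf [M Mf]]; apply: measurable_bounded_integrable => //.
  by rewrite mu1 ltry.
exists `|M|; split; first exact: num_real.
by move=> x Mx y _ /=; rewrite (le_trans (Mf y))// (le_trans (ler_norm M))// ltW.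
Qed.

Lemma mean_cst c : \int[mu]_x c = c.
Proof. by rewrite Rintegral_cst// mu1 /= mulr1. Qed.

Lemma meanD f g : bmf f -> bmf g ->
  \int[mu]_x (f x + g x) = \int[mu]_x f x + \int[mu]_x g x.
Proof. by move=> bf bg; rewrite RintegralD//; exact: bmf_integrable. Qed.

Lemma meanB f g : bmf f -> bmf g ->
  \int[mu]_x (f x - g x) = \int[mu]_x f x - \int[mu]_x g x.
Proof. by move=> bf bg; rewrite RintegralB//; exact: bmf_integrable. Qed.

Lemma meanZ c f : bmf f -> \int[mu]_x (c * f x) = c * \int[mu]_x f x.
Proof. by move=> bf; rewrite RintegralZl//; exact: bmf_integrable. Qed.

Lemma mean_sum (I : Type) (r : seq I) (F : I -> X -> R) :
  (forall i, bmf (F i)) ->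
  \int[mu]_x (\sum_(i <- r) F i x) = \sum_(i <- r) \int[mu]_x F i x.
Proof.
move=> bF; elim: r => [|i r ih].
  rewrite big_nil -[RHS]mean_cst; apply: eq_Rintegral => x _.
  by rewrite big_nil.
rewrite big_cons -ih -meanD//; last exact: bmf_sum.
by apply: eq_Rintegral => x _; rewrite big_cons.
Qed.

Lemma mean_le f g : bmf f -> bmf g -> (forall x, f x <= g x) ->
  \int[mu]_x f x <= \int[mu]_x g x.
Proof. by move=> bf bg fg; apply: le_Rintegral => //; exact: bmf_integrable. Qed.

Lemma mean_ge0 f : (forall x, 0 <= f x) -> 0 <= \int[mu]_x f x.
Proof. by move=> f0; exact: Rintegral_ge0. Qed.

Lemma mean_norm_le f g : bmf f -> bmf g -> (forall x, `|f x| <= g x) ->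
  `|\int[mu]_x f x| <= \int[mu]_x g x.
Proof.
move=> bf bg fg; rewrite (le_trans (le_normr_Rintegral _ _))//.
  exact: bmf_integrable.
by apply: mean_le => //; exact: bmf_norm.
Qed.

Lemma mean_norm_bound f M : bmf f -> (forall x, `|f x| <= M) ->
  `|\int[mu]_x f x| <= M.
Proof.
by move=> bf fM; rewrite -[leRHS]mean_cst mean_norm_le//; exact: bmf_cst.
Qed.

Lemma mean_indic B : measurable B -> (\int[mu]_x (\1_B x : R))%:E = mu B.
Proof.
move=> mB; rewrite /Rintegral integral_indic// setIT fineK//.
rewrite ge0_fin_numE//; apply: (@le_lt_trans _ _ (mu setT)).
  by apply: le_measure; rewrite ?inE.
by rewrite mu1 ltry.
Qed.

End MassOne.

(* Subtracting [(b / 2) * sign g] halves the uniform bound [b] of [g] without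
   changing [L g]. *)
Lemma linear_bounded_vanish {R : realType} {d} {X : measurableType d}
    (L : (X -> R) -> R) (K : R) :
  (forall f g, bmf f -> bmf g -> L (fun x => f x + g x) = L f + L g) ->
  (forall c f, bmf f -> L (fun x => c * f x) = c * L f) ->
  (forall f b, bmf f -> (forall x, `|f x| <= b) -> `|L f| <= K * b) ->
  (forall B, measurable B -> L \1_B = 0) ->
  forall f, bmf f -> L f = 0.
Proof.
move=> LD LZ LB L0.
have half n : forall b f, bmf f -> (forall x, `|f x| <= b) ->
    `|L f| <= K * (b / 2 ^+ n).
  elim: n => [|n ih] b f bf fb; first by rewrite expr0 divr1; exact: LB.
  pose B := [set x | 0 <= f x].
  have mB : measurable B.
    rewrite [B](_ : _ = f @^-1` `[0, +oo[); last first.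
      by apply/seteqP; split=> x /=; rewrite in_itv/= andbT.
    by rewrite -[X in measurable X]setTI; apply: bf.1.
  pose f1 x := f x + (- b * \1_B x + b / 2 * \1_setT x).
  have mi : bmf (\1_B : X -> R) by exact: bmf_indic.
  have mT : bmf (\1_setT : X -> R) by exact: bmf_indic.
  have bf1 : bmf f1 by apply: bmfD => //; apply: bmfD; exact: bmfZ.
  have -> : L f = L f1.
    by rewrite /f1 LD//; [rewrite LD; [rewrite !LZ// !L0// !mulr0 !addr0
      |exact: bmfZ|exact: bmfZ]|apply: bmfD; exact: bmfZ].
  rewrite exprS invfM [b * _]mulrA; apply: ih => // x.
  have := fb x; rewrite /f1 !indicE in_setT/=.
  have [xB|xB] := boolP (x \in B).
    by move: xB; rewrite inE /B/= => f0; rewrite !ler_norml => /andP[? ?];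
      apply/andP; split; lra.
  move: xB; rewrite notin_setE /B/= => /negP; rewrite -ltNge => f0.
  by rewrite !ler_norml => /andP[? ?]; apply/andP; split; lra.
move=> f bf; have [M Mf] := bf.2.
apply/eqP; rewrite -normr_eq0 eq_le normr_ge0 andbT.
apply/ler_addgt0Pr => e e0; rewrite add0r.
have lim0 : (fun n => K * (M / 2 ^+ n)) @ \oo --> (0 : R).
  rewrite -[X in _ --> X](mulr0 K); apply: cvgMr.
  rewrite -[X in _ --> X](mulr0 M); apply: cvgMr.
  under eq_fun do rewrite -exprVn.
  by apply: cvg_expr; rewrite ger0_norm// invf_lt1// ltr1n.
have [n _ /(_ _ (leqnn n))] := cvgr_lt 0 lim0 e e0.
by move=> h; rewrite (le_trans (half n M f bf Mf))// ltW.
Qed.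

(* For a function that is not measurable, [integral] is the difference of the
   lower integrals of its positive and negative parts. *)
Section LowerIntegral.
Context {R : realType} {d} {X : measurableType d}.
Variable mu : {measure set X -> \bar R}.
Implicit Types f g : X -> R.

Import HBNNSimple.

(** A nonnegative integral is a supremum over simple minorants, so it is enough to match each of
    them. *)
Let lower_le (f g : X -> \bar R) :
  (forall x, (0 <= f x)%E) -> (forall x, (0 <= g x)%E) ->
  (forall h : {nnsfun X >-> R}, (forall x, ((h x)%:E <= f x)%E) ->
    exists2 h' : {nnsfun X >-> R}, (forall x, ((h' x)%:E <= g x)%E) &
      (sintegral mu h <= sintegral mu h')%E) ->
  (\int[mu]_x f x <= \int[mu]_x g x)%E.
Proof.
move=> f0 g0 fg; rewrite !ge0_integralTE//.
apply: ge_ereal_sup => _ [h /= hf <-]; have [h' h'g hh'] := fg h hf.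
by apply: le_ereal_sup_tmp; exists (sintegral mu h') => //; exists h'.
Qed.

Lemma lower_integral_le (f g : X -> \bar R) :
  (forall x, (0 <= f x)%E) -> (forall x, (f x <= g x)%E) ->
  (\int[mu]_x f x <= \int[mu]_x g x)%E.
Proof.
move=> f0 fg; apply: lower_le => //; first by move=> x; exact: le_trans (fg x).
by move=> h hf; exists h => // x; exact: le_trans (fg x).
Qed.

(** Scaling simple minorants gives one inequality; the other is the same inequality for the factor
    [c^-1] and the function [c f]. *)
Lemma lower_integralZl (c : R) (f : X -> \bar R) : 0 < c ->
  (forall x, (0 <= f x)%E) -> (\int[mu]_x (c%:E * f x) = c%:E * \int[mu]_x f x)%E.
Proof.
move=> c0 f0.
have scale (k : R) (g : X -> \bar R) : 0 < k -> (forall x, (0 <= g x)%E) ->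
    (k%:E * \int[mu]_x g x <= \int[mu]_x (k%:E * g x))%E.
  move=> k0 g0; rewrite muleC -lee_pdivlMr//.
  rewrite [X in (X <= _)%E]ge0_integralTE//; apply: ge_ereal_sup => _ [h /= hg <-].
  rewrite lee_pdivlMr// muleC -(sintegralrM mu k h).
  have kg0 x : (0 <= k%:E * g x)%E by rewrite mule_ge0// lee_fin ltW.
  rewrite [X in (_ <= X)%E]ge0_integralTE//; apply: ereal_sup_ubound.
  exists (scale_nnsfun h (ltW k0)) => //= x.
  by rewrite EFinM lee_pmul2l.
apply/eqP; rewrite eq_le scale// andbT.
have := scale c^-1 (fun x => c%:E * f x)%E.
rewrite invr_gt0 => /(_ c0) H.
rewrite -lee_pdivrMl//; apply: le_trans (H _) _ => [x|].
  by rewrite mule_ge0// lee_fin ltW.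
by under eq_integral do rewrite muleA -EFinM mulVf ?gt_eqF// mul1e.
Qed.

Let fineN (a b : \bar R) : (0 <= a)%E -> (0 <= b)%E ->
  fine (b - a)%E = - fine (a - b)%E.
Proof.
move: a b => [a| |] [b| |]//= _ _; rewrite ?oppr0//.
by rewrite opprB.
Qed.

Lemma RintegralN_any f : \int[mu]_x (- f x) = - \int[mu]_x f x.
Proof.
rewrite /Rintegral integralE [in RHS]integralE.
rewrite -fineN; [|by apply: integral_ge0|by apply: integral_ge0].
congr (fine (_ - _)%E); apply: eq_integral => x _.
  by rewrite funeposE funenegE.
by rewrite funeposE funenegE -EFinN opprK.
Qed.

(** Homogeneity survives without measurability, whereas additivity does not. If the positive or the
    negative part has infinite integral, [fine] returns 0 on both sides. *)
Lemma RintegralZl_any c f : \int[mu]_x (c * f x) = c * \int[mu]_x f x.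
Proof.
have pos k : 0 < k -> \int[mu]_x (k * f x) = k * \int[mu]_x f x.
  move=> k0; rewrite /Rintegral integralE [in RHS]integralE.
  pose fE := EFin \o f.
  have -> : (\int[mu]_x ((EFin \o (fun x => k * f x)%R) ^\+ x) =
             k%:E * \int[mu]_x (fE ^\+ x))%E.
    rewrite -lower_integralZl//; apply: eq_integral => x _.
    by rewrite !funeposE /fE/= -!EFin_max -EFinM maxr_pMr ?mulr0// ltW.
  have -> : (\int[mu]_x ((EFin \o (fun x => k * f x)%R) ^\- x) =
             k%:E * \int[mu]_x (fE ^\- x))%E.
    rewrite -lower_integralZl//; apply: eq_integral => x _.
    by rewrite !funenegE /fE/= -!EFin_max -EFinM maxr_pMr ?mulr0 ?mulrN// ltW.
  have : (0 <= \int[mu]_x (fE ^\+ x))%E by exact: integral_ge0.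
  have : (0 <= \int[mu]_x (fE ^\- x))%E by exact: integral_ge0.
  rewrite /fE; move: (integral _ _ _) (integral _ _ _).
  move=> [a| |] [b| |]//= _ _; rewrite ?gt0_muley//= ?mulr0//.
  by rewrite mulrBr.
have [c0|c0|<-] := ltgtP 0 c; first exact: pos.
  rewrite -[c]opprK mulNr -(pos (- c)) ?oppr_gt0// -RintegralN_any.
  by apply: eq_Rintegral => x _; rewrite mulNr.
rewrite mul0r (_ : (fun x => 0 * f x) = cst 0); last first.
  by apply/funext => x; rewrite mul0r.
by rewrite /Rintegral integral0.
Qed.

Lemma RintegralZr_any c f : \int[mu]_x (f x * c) = \int[mu]_x f x * c.
Proof.
by rewrite mulrC -RintegralZl_any; apply: eq_Rintegral => x _; rewrite mulrC.
Qed.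

Lemma integral_eq_off_null (N : set X) (f g : X -> \bar R) :
  measurable N -> mu N = 0%E -> (forall x, ~ N x -> f x = g x) ->
  (\int[mu]_x f x = \int[mu]_x g x)%E.
Proof.
move=> mN N0.
have le (u v : X -> \bar R) : (forall x, (0 <= u x)%E) -> (forall x, (0 <= v x)%E) ->
    (forall x, ~ N x -> u x = v x) -> (\int[mu]_x u x <= \int[mu]_x v x)%E.
  move=> u0 v0 uv; apply: lower_le => // h hu.
  (* Cutting a simple minorant of [u] off on [N] keeps its integral and makes it a minorant of
     [v]. *)
  exists (mul_nnsfun h (indic_nnsfun R (measurableC mN))) => [x|].
    rewrite /= mindicE; have [xN|xN] := boolP (x \in ~` N).
      by rewrite mulr1 -uv//; rewrite inE in xN.
    by rewrite mulr0.
  rewrite -!integralT_nnsfun le_eqVlt; apply/orP; left; apply/eqP.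
  apply: ge0_ae_eq_integral => //; [exact/measurable_EFinP|
    exact/measurable_EFinP|by move=> x _; rewrite lee_fin|
    by move=> x _; rewrite lee_fin|].
  exists N; split=> // x /= xN; apply: contrapT => nNx; apply: xN => _.
  by rewrite mindicE mem_set// mulr1.
have eq0 (u v : X -> \bar R) : (forall x, (0 <= u x)%E) -> (forall x, (0 <= v x)%E) ->
    (forall x, ~ N x -> u x = v x) -> (\int[mu]_x u x = \int[mu]_x v x)%E.
  move=> u0 v0 uv; apply/eqP; rewrite eq_le !le// => x /uv//.
move=> fg; rewrite integralE [RHS]integralE; congr (_ - _)%E; apply: eq0 => //.
- by move=> x /fg; rewrite !funeposE => ->.
- by move=> x /fg; rewrite !funenegE => ->.
Qed.

Lemma Rintegral_eq_off_null (N : set X) f g :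
  measurable N -> mu N = 0%E -> (forall x, ~ N x -> f x = g x) ->
  \int[mu]_x f x = \int[mu]_x g x.
Proof.
by move=> mN N0 fg; congr fine; apply: (integral_eq_off_null mN N0) => x /fg ->.
Qed.

(** The finite lower integral is approached within [1 / (n + 1)] by simple minorants; their
    pointwise supremum is measurable, still below [f], and hence attains it. *)
Lemma measurable_minorant f : (forall x, 0 <= f x) ->
  (\int[mu]_x (f x)%:E < +oo)%E ->
  exists G : X -> R, [/\ measurable_fun setT G, forall x, 0 <= G x <= f x &
    (\int[mu]_x (G x)%:E = \int[mu]_x (f x)%:E)%E].
Proof.
move=> f0 foo; set l := (\int[mu]_x _)%E in foo *.
have lfin : l \is a fin_num.
  by rewrite ge0_fin_numE// /l integral_ge0// => x _; rewrite lee_fin.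
have ex n : exists h : {nnsfun X >-> R}, (forall x, h x <= f x) /\
    (l - (n.+1%:R^-1)%:E < sintegral mu h)%E.
  have n0 : 0 < n.+1%:R^-1 :> R by rewrite invr_gt0.
  have := lfin; rewrite {1}/l ge0_integralTE// => lfin'.
  have [_ [h /= hf <-]] := ub_ereal_sup_adherent n0 lfin'.
  rewrite -(@ge0_integralTE _ _ _ mu (fun x => (f x)%:E)); last by move=> x; rewrite lee_fin.
  by move=> lh; exists h; split=> // x; rewrite -lee_fin.
have [h hP] := choice ex.
pose G x := sups (fun n => h n x) 0.
have ub x : has_ubound (range (fun n => h n x)).
  by exists (f x) => _ [n _ <-]; exact: (hP n).1.
have hG n x : h n x <= G x.
  apply: sup_upper_bound; last by exists n.
  split; first by exists (h n x); exists n.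
  by exists (f x) => _ [m _ <-]; exact: (hP m).1.
have Gf x : G x <= f x.
  apply: ge_sup; first by exists (h 0 x); exists 0.
  by move=> _ [m _ <-]; exact: (hP m).1.
have G0 x : 0 <= G x by apply: le_trans (hG 0 x).
have mG : measurable_fun setT G.
  by apply: measurable_fun_sups => // t _; exact: ub.
exists G; split => // [x|]; first by rewrite G0 Gf.
apply/eqP; rewrite eq_le lower_integral_le//=; [|by move=> x; rewrite lee_fin..].
apply/lee_addgt0Pr => e e0; rewrite -leeBlDr//.
have [n ne] : exists n, n.+1%:R^-1 < e :> R.
  have [n _ /(_ n (leqnn n))] := near_infty_natSinv_lt (PosNum e0).
  by exists n.
apply: (@le_trans _ _ (l - (n.+1%:R^-1)%:E)%E).
  by rewrite leeB// lee_fin ltW.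
apply: le_trans (ltW (hP n).2) _.
rewrite -integralT_nnsfun; apply: lower_integral_le => x; rewrite lee_fin//.
Qed.

(* If lower integrals happen to be additive on a finite family with measurable
   sum, every member agrees almost everywhere with a measurable function. *)
Lemma measurable_summands (I : finType) (p : X -> R) (f : I -> X -> R) :
  measurable_fun setT p -> (\int[mu]_x (p x)%:E = 1)%E ->
  (forall i x, 0 <= f i x) -> (forall x, \sum_i f i x = p x) ->
  \sum_i \int[mu]_x f i x = 1 ->
  exists G : I -> X -> R, [/\ forall i, measurable_fun setT (G i),
    forall i x, 0 <= G i x <= f i x &
    exists N, [/\ measurable N, mu N = 0%E & forall i x, ~ N x -> G i x = f i x]].
Proof.
move=> mp p1 f0 fp f1.
have fip i x : f i x <= p x.
  by rewrite -fp (bigD1 i)//= lerDl sumr_ge0.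
have foo i : (\int[mu]_x (f i x)%:E < +oo)%E.
  apply: (@le_lt_trans _ _ (\int[mu]_x (p x)%:E)%E); last by rewrite p1 ltry.
  by apply: lower_integral_le => x; rewrite lee_fin.
have [G GP] := choice (fun i => measurable_minorant (f0 i) (foo i)).
have mG i : measurable_fun setT (G i) by case: (GP i).
have G0 i x : 0 <= G i x by have [_ /(_ x)/andP[]] := GP i.
have Gf i x : G i x <= f i x by have [_ /(_ x)/andP[]] := GP i.
exists G; split=> // [i x|]; first by rewrite G0 Gf.
(* The gap [H] is nonnegative and measurable with integral [1 - 1], because the minorants keep the
   lower integrals. It vanishes off a null set, where each [G i <= f i] must then be an equality. *)
pose H x := p x - \sum_i G i x.
have H0 x : 0 <= H x by rewrite subr_ge0 -fp ler_sum.
have mS : measurable_fun setT (fun x => \sum_i G i x) by exact: measurable_sum.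
have mH : measurable_fun setT H by exact: measurable_funB.
have iG : (\int[mu]_x (\sum_i G i x)%:E = 1)%E.
  under eq_integral do rewrite -sumEFin.
  rewrite ge0_integral_sum//; last 2 first.
  - by move=> i; exact/measurable_EFinP.
  - by move=> i x _; rewrite lee_fin.
  rewrite -[in RHS]f1 -sumEFin; apply: eq_bigr => i _.
  have [_ _ ->] := GP i; rewrite fineK// ge0_fin_numE// integral_ge0//.
  by move=> x _; rewrite lee_fin.
have iH : (\int[mu]_x `|(H x)%:E| = 0)%E.
  have : (\int[mu]_x (p x)%:E = \int[mu]_x ((H x)%:E + (\sum_i G i x)%:E))%E.
    by apply: eq_integral => x _; rewrite -EFinD subrK.
  rewrite ge0_integralD//; last 4 first.
  - by move=> x _; rewrite lee_fin.
  - exact/measurable_EFinP.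
  - by move=> x _; rewrite lee_fin sumr_ge0.
  - exact/measurable_EFinP.
  rewrite p1 iG => e1; under eq_integral do rewrite gee0_abs ?lee_fin//.
  have : (0 <= \int[mu]_x (H x)%:E)%E by apply: integral_ge0 => x _; rewrite lee_fin.
  move: e1; case: (integral _ _ _) => [r| |] //= [] e1 _.
  by congr EFin; lra.
have mHE : measurable_fun setT (EFin \o H) by exact/measurable_EFinP.
have [N [mN N0 HN]] := (ae_eq_integral_abs mu measurableT mHE).1 iH.
exists N; split => // i x nNx.
have Hx : H x = 0.
  have [//|ne] := pselect (H x = 0); exfalso; apply: nNx; apply: HN => /= h.
  by apply: ne; have [] := h Logic.I.
move: Hx; rewrite /H -fp => /eqP; rewrite subr_eq0 => /eqP Hx.
apply/eqP; rewrite eq_le Gf/= leNgt; apply/negP => lt.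
have : \sum_j G j x < \sum_j f j x.
  by rewrite (bigD1 i)//= [ltRHS](bigD1 i)//= ltr_leD// ler_sum.
by rewrite Hx ltxx.
Qed.

End LowerIntegral.

Lemma updE (X : Type) (f : nat -> X) t x : upd f t x t = x.
Proof. by rewrite /upd eqxx. Qed.

Lemma upd_neq (X : Type) (f : nat -> X) t x k : k != t -> upd f t x k = f k.
Proof. by rewrite /upd => /negbTE ->. Qed.

(** * Nested expectations: conditioning on a state and change of policy *)

Section Evaluation.
Context {R : realType} {dA : measure_display} {A : measurableType dA}
  {S : finType}.
Variables (nu : {measure set A -> \bar R}) (P0 : S -> R)
  (Pr : nat -> S -> R.-pker A ~> R) (T : nat).
Implicit Types (Ps : nat -> S -> A -> S -> R) (pi : nat -> S -> A -> R)
  (f : @trajfun R dA A S).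

Definition agree_upto (t : nat) (hs hs' : nat -> S) (ha ha' : nat -> A)
    (hr hr' : nat -> R) :=
  forall k, (k < t)%N -> [/\ hs' k = hs k, ha' k = ha k & hr' k = hr k].

Definition kernel_sum1 Ps :=
  forall t, (1 <= t <= T)%N -> forall s a, \sum_(s' : S) Ps t s a s' = 1.

Definition policy_sum1 pi :=
  forall t, (t <= T)%N -> forall s, (\int[nu]_a (pi t s a)%:E = 1)%E.

Lemma Pr1 t s a : Pr t s a setT = 1%E.
Proof. exact: prob_kernel. Qed.

Lemma sum_trans Ps t hs ha : \sum_(s : S) P0 s = 1 -> kernel_sum1 Ps ->
  (t <= T)%N -> \sum_(s : S) mdp_trans P0 Ps t hs ha s = 1.
Proof. by move=> P01 Ps1; case: t => [|t] tT //=; exact: Ps1. Qed.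

Lemma policy_step pi t s (c : R) : policy_sum1 pi -> (t <= T)%N ->
  \int[nu]_a (pi t s a * \int[Pr t s a]_r c) = c.
Proof.
move=> pi1 tT.
under eq_Rintegral do rewrite (mean_cst (Pr1 _ _ _)).
by rewrite RintegralZr_any /Rintegral pi1// mul1r.
Qed.

#[local] Opaque Rintegral.

(** Once the coordinates that [f] reads are fixed, each remaining level averages a constant against
    laws of total mass one. *)
Lemma evalE_const Ps pi m t hs ha hr f c :
  \sum_(s : S) P0 s = 1 -> kernel_sum1 Ps -> policy_sum1 pi ->
  (t + m = T.+1)%N ->
  (forall hs' ha' hr', agree_upto t hs hs' ha ha' hr hr' -> f hs' ha' hr' = c) ->
  evalE nu P0 Ps Pr pi m t hs ha hr f = c.
Proof.
move=> P01 Ps1 pi1; elim: m t hs ha hr => [|m ih] t hs ha hr tm fc /=.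
  by apply: fc.
have tT : (t <= T)%N by move: tm; rewrite addnS => -[<-]; exact: leq_addr.
rewrite -[RHS]mul1r -(sum_trans hs ha P01 Ps1 tT) mulr_suml.
apply: eq_bigr => s _; congr (_ * _).
rewrite -[RHS](policy_step s _ pi1 tT); apply: eq_Rintegral => a _.
congr (_ * _); apply: eq_Rintegral => r _.
apply: ih; first by rewrite addSnnS.
move=> hs' ha' hr' ag; apply: fc => k kt.
have [-> -> ->] := ag k (ltnW kt).
by rewrite !upd_neq// neq_ltn kt.
Qed.

(** The Markov property at time [t]: the conditional mean given [s] is a constant, which homogeneity
    carries out of all earlier integrals. Homogeneity is the only tool here, as [phi] may be
    nonmeasurable. *)
Lemma evalE_cond Ps pi t s f (phi : A -> R -> R) m k hs ha hr :
  \sum_(s : S) P0 s = 1 -> kernel_sum1 Ps -> policy_sum1 pi -> (t <= T)%N ->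
  (forall hs ha hr a r u, evalE nu P0 Ps Pr pi (T - t) t.+1
      (upd hs t u) (upd ha t a) (upd hr t r) f = (u == s)%:R * phi a r) ->
  (k <= t)%N -> (k + m = T.+1)%N ->
  evalE nu P0 Ps Pr pi m k hs ha hr f =
  \int[nu]_a (pi t s a * \int[Pr t s a]_r phi a r) *
  evalE nu P0 Ps Pr pi m k hs ha hr (fun hs _ _ => (hs t == s)%:R).
Proof.
move=> P01 Ps1 pi1 tT fphi; set c := (X in X * _).
elim: m k hs ha hr => [|m ih] k hs ha hr kt km /=.
  by move: km; rewrite addn0 => km; move: (leq_trans kt tT); rewrite km ltnn.
rewrite [RHS]mulr_sumr; apply: eq_bigr => u _; rewrite [RHS]mulrCA; congr (_ * _).
rewrite -RintegralZl_any.
have [kt' | kt'] := eqVneq k t.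
  subst k; have mE : m = (T - t)%N by move: km; rewrite addnS => -[<-]; rewrite addKn.
  rewrite mE.
  under eq_Rintegral.
    move=> a _; under eq_Rintegral do rewrite fphi.
    over.
  under [RHS]eq_Rintegral.
    move=> a _; under eq_Rintegral.
      move=> r _; rewrite (@evalE_const _ _ _ _ _ _ _ _ (u == s)%:R)//; last 2 first.
      - by rewrite -mE addSnnS.
      - by move=> hs' ha' hr' /(_ t (ltnSn t))[-> _ _]; rewrite updE.
      over.
    over.
  rewrite RintegralZl_any policy_step//.
  have [->|us] := eqVneq u s.
    rewrite mulr1 /c; apply: eq_Rintegral => a _; congr (_ * _).
    by apply: eq_Rintegral => r _; rewrite mul1r.
  rewrite mulr0 -[RHS](policy_step u 0 pi1 tT); apply: eq_Rintegral => a _.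
  by congr (_ * _); apply: eq_Rintegral => r _; rewrite mul0r.
have {kt kt'} kt : (k < t)%N by rewrite ltn_neqAle kt' kt.
apply: eq_Rintegral => a _; rewrite [RHS]mulrCA; congr (_ * _).
rewrite -RintegralZl_any; apply: eq_Rintegral => r _.
by apply: ih => //; rewrite addSnnS.
Qed.

Lemma Expect_cond Ps pi t s f (phi : A -> R -> R) :
  \sum_(s : S) P0 s = 1 -> kernel_sum1 Ps -> policy_sum1 pi -> (t <= T)%N ->
  (forall hs ha hr a r u, evalE nu P0 Ps Pr pi (T - t) t.+1
      (upd hs t u) (upd ha t a) (upd hr t r) f = (u == s)%:R * phi a r) ->
  Expect nu P0 Ps Pr T pi f =
  \int[nu]_a (pi t s a * \int[Pr t s a]_r phi a r) *
  stateProb nu P0 Ps Pr T pi t s.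
Proof.
move=> P01 Ps1 pi1 tT fphi; rewrite /stateProb /Expect.
case: pickP => [sd _|_]; last by rewrite mulr0.
exact: evalE_cond.
Qed.

Lemma Expect_reward Ps pi t s (g : R -> R) :
  \sum_(s : S) P0 s = 1 -> kernel_sum1 Ps -> policy_sum1 pi -> (t <= T)%N ->
  Expect nu P0 Ps Pr T pi (fun hs _ hr => (hs t == s)%:R * g (hr t)) =
  \int[nu]_a (pi t s a * \int[Pr t s a]_r g r) *
  stateProb nu P0 Ps Pr T pi t s.
Proof.
move=> P01 Ps1 pi1 tT; apply: Expect_cond => // hs ha hr a r u.
apply: evalE_const => //; first by rewrite addSn subnKC.
by move=> hs' ha' hr' /(_ t (ltnSn t))[-> _ ->]; rewrite !updE.
Qed.

(** Ties the observable law of two successive states to the integral of [pi t s * Ps t.+1 s _ s'];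
    through it the data constrain the measurability of [Ps]. *)
Lemma Expect_transition Ps pi t s s' :
  \sum_(s : S) P0 s = 1 -> kernel_sum1 Ps -> policy_sum1 pi -> (t < T)%N ->
  Expect nu P0 Ps Pr T pi
    (fun hs _ _ => (hs t == s)%:R * (hs t.+1 == s')%:R) =
  \int[nu]_a (pi t s a * Ps t.+1 s a s') * stateProb nu P0 Ps Pr T pi t s.
Proof.
move=> P01 Ps1 pi1 tT.
rewrite (@Expect_cond Ps pi t s _ (fun a r => Ps t.+1 s a s'))//; last 2 first.
- exact: ltnW.
- move=> hs ha hr a r u; have -> : (T - t = (T - t.+1).+1)%N by rewrite subnSK.
  rewrite /= !updE; transitivity (\sum_v Ps t.+1 u a v * ((u == s)%:R * (v == s')%:R)).
    apply: eq_bigr => v _; congr (_ * _).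
    rewrite -[RHS](policy_step v _ pi1 tT); apply: eq_Rintegral => b _.
    congr (_ * _); apply: eq_Rintegral => q _.
    apply: evalE_const => //; first by rewrite addSn subnKC.
    move=> hs' ha' hr' ag.
    have [-> _ _] := ag t (ltnW (ltnSn t.+1)); have [-> _ _] := ag t.+1 (ltnSn t.+1).
    by rewrite updE upd_neq ?updE// neq_ltn ltnSn.
  rewrite (bigD1 s')//= eqxx mulr1 big1 ?addr0; last first.
    by move=> v /negbTE ->; rewrite !mulr0.
  by have [->|_] := eqVneq u s; rewrite ?mulr1 ?mul1r ?mulr0 ?mul0r.
congr (_ * _); apply: eq_Rintegral => a _.
by rewrite (mean_cst (Pr1 _ _ _)).
Qed.

Lemma stateProb0 Ps pi s :
  \sum_(s : S) P0 s = 1 -> kernel_sum1 Ps -> policy_sum1 pi ->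
  stateProb nu P0 Ps Pr T pi 0 s = P0 s.
Proof.
move=> P01 Ps1 pi1; rewrite /stateProb /Expect.
case: pickP => [sd _|/(_ s)//] /=.
transitivity (\sum_u P0 u * (u == s)%:R).
  apply: eq_bigr => u _; congr (_ * _).
  rewrite -[RHS](policy_step u _ pi1 (leq0n T)); apply: eq_Rintegral => a _.
  congr (_ * _); apply: eq_Rintegral => r _.
  apply: evalE_const => // hs' ha' hr' /(_ 0 isT)[-> _ _].
  by rewrite updE.
rewrite (bigD1 s)//= eqxx mulr1 big1 ?addr0//.
by move=> v /negbTE ->; rewrite mulr0.
Qed.

(** The state at time [t] is drawn before the action at time [t], so only the policy strictly before
    [t] matters. *)
Lemma evalE_policy_eq Ps pi pi' t f m k hs ha hr :
  \sum_(s : S) P0 s = 1 -> kernel_sum1 Ps -> policy_sum1 pi ->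
  policy_sum1 pi' -> (t <= T)%N ->
  (forall j, (j < t)%N -> forall s a, pi j s a = pi' j s a) ->
  (forall hs hs' ha ha' hr hr', agree_upto t hs hs' ha ha' hr hr' ->
     hs' t = hs t -> f hs' ha' hr' = f hs ha hr) ->
  (k <= t)%N -> (k + m = T.+1)%N ->
  evalE nu P0 Ps Pr pi m k hs ha hr f = evalE nu P0 Ps Pr pi' m k hs ha hr f.
Proof.
move=> P01 Ps1 pi1 pi'1 tT pipi' fdep.
elim: m k hs ha hr => [//|m ih] k hs ha hr kt km /=.
apply: eq_bigr => u _; congr (_ * _).
have [kt' | kt'] := eqVneq k t.
  subst k; transitivity (f (upd hs t u) ha hr).
    rewrite -[RHS](policy_step u _ pi1 tT); apply: eq_Rintegral => a _.
    congr (_ * _); apply: eq_Rintegral => r _.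
    apply: evalE_const => //; first by rewrite addSnnS.
    move=> hs' ha' hr' ag; apply: fdep; last by have [] := ag t (ltnSn t).
    move=> j jt; have [-> -> ->] := ag j (ltnW jt).
    by rewrite !upd_neq// neq_ltn jt.
  rewrite -[LHS](policy_step u _ pi'1 tT); apply: eq_Rintegral => a _.
  congr (_ * _); apply: eq_Rintegral => r _; apply/esym.
  apply: evalE_const => //; first by rewrite addSnnS.
  move=> hs' ha' hr' ag; apply: fdep; last by have [] := ag t (ltnSn t).
  move=> j jt; have [-> -> ->] := ag j (ltnW jt).
  by rewrite !upd_neq// neq_ltn jt.
have {kt kt'} kt : (k < t)%N by rewrite ltn_neqAle kt' kt.
apply: eq_Rintegral => a _; rewrite pipi'//; congr (_ * _).
apply: eq_Rintegral => r _; apply: ih => //; by rewrite addSnnS.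
Qed.

Lemma stateProb_policy_eq Ps pi pi' t s :
  \sum_(s : S) P0 s = 1 -> kernel_sum1 Ps -> policy_sum1 pi ->
  policy_sum1 pi' -> (t <= T)%N ->
  (forall j, (j < t)%N -> forall s a, pi j s a = pi' j s a) ->
  stateProb nu P0 Ps Pr T pi t s = stateProb nu P0 Ps Pr T pi' t s.
Proof.
move=> P01 Ps1 pi1 pi'1 tT pipi'; rewrite /stateProb /Expect.
case: pickP => [sd _|//]; apply: (@evalE_policy_eq Ps pi pi' t) => //.
by move=> ? ? ? ? ? ? _ ->.
Qed.

(** At each level the ratios of past steps are constants and the current ratio merges with the
    density, so homogeneity suffices. *)
Lemma evalE_change Ps pi pi' (ratio : nat -> S -> A -> R) m t hs ha hr f :
  (forall j, (j <= T)%N -> forall s a, pi' j s a = pi j s a * ratio j s a) ->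
  (t + m = T.+1)%N ->
  evalE nu P0 Ps Pr pi m t hs ha hr (fun hs ha hr =>
    (\prod_(k < T.+1) ratio k (hs k) (ha k)) * f hs ha hr) =
  (\prod_(k < t) ratio k (hs k) (ha k)) *
    evalE nu P0 Ps Pr pi' m t hs ha hr f.
Proof.
move=> pipi'; elim: m t hs ha hr => [|m ih] t hs ha hr tm /=.
  by move: tm; rewrite addn0 => ->.
have tT : (t <= T)%N by move: tm; rewrite addnS => -[<-]; exact: leq_addr.
rewrite [RHS]mulr_sumr; apply: eq_bigr => u _; rewrite [RHS]mulrCA; congr (_ * _).
rewrite -RintegralZl_any; apply: eq_Rintegral => a _.
rewrite pipi'// mulrCA -mulrA; congr (_ * _).
rewrite mulrCA mulrA -RintegralZl_any; apply: eq_Rintegral => r _.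
rewrite ih ?addSnnS//; congr (_ * _).
rewrite big_ord_recr/= !updE; congr (_ * _).
by apply: eq_bigr => k _; rewrite !upd_neq// neq_ltn ltn_ord.
Qed.

Lemma Expect_change Ps pi pi' (ratio : nat -> S -> A -> R) f :
  (forall j, (j <= T)%N -> forall s a, pi' j s a = pi j s a * ratio j s a) ->
  Expect nu P0 Ps Pr T pi' f = Expect nu P0 Ps Pr T pi (fun hs ha hr =>
    (\prod_(k < T.+1) ratio k (hs k) (ha k)) * f hs ha hr).
Proof.
move=> pipi'; rewrite /Expect; case: pickP => [sd _|//].
by rewrite (@evalE_change _ _ pi')// big_ord0 mul1r.
Qed.

End Evaluation.

Lemma null_setC {R : realType} {d} {X : measurableType d}
    (mu : {measure set X -> \bar R}) (B : set X) :
  mu setT = 1%E -> measurable B -> mu B = 1%E -> mu (~` B) = 0%E.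
Proof.
move=> mu1 mB B1; have mC := measurableC mB.
have e : (mu setT = mu (~` B) + mu B)%E.
  by have := measureU mu mC mB (setICl B); rewrite setvU.
move: e; rewrite mu1 B1; have := measure_ge0 mu (~` B).
by case: (mu (~` B)) => [r| |]//= _ [] r1; congr EFin; lra.
Qed.

Lemma measurable_inv_ge0 {R : realType} {d} {X : measurableType d} (f : X -> R) :
  measurable_fun setT f -> (forall x, 0 <= f x) ->
  measurable_fun setT (fun x => (f x)^-1).
Proof.
move=> mf f0; rewrite (_ : (fun x => _) = (fun y : R => y `^ (-1)) \o f).
  by apply: measurableT_comp => //; exact: measurable_powR.
by apply/funext => x /=; rewrite powR_inv1.
Qed.

(** * Measurable versions of the transition probabilities *)

Section MeasurableTransitions.
Context {R : realType} {dA : measure_display} {A : measurableType dA}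
  {S : finType}.
Variables (nu : {measure set A -> \bar R}) (P0 : S -> R)
  (Ps : nat -> S -> A -> S -> R) (Pr : nat -> S -> R.-pker A ~> R) (T : nat)
  (pib : nat -> S -> A -> R) (Rmax : R).
Hypothesis P01 : \sum_(s : S) P0 s = 1.
Hypothesis Ps0 : forall t, (1 <= t <= T)%N -> forall s a s', 0 <= Ps t s a s'.
Hypothesis Ps1 : kernel_sum1 T Ps.
Hypothesis Pr_supp : forall t, (t <= T)%N -> forall s a,
  Pr t s a `[0, Rmax]%classic = 1%E.
Hypothesis mpib : forall t, (t <= T)%N -> forall s, measurable_fun setT (pib t s).
Hypothesis pib0 : forall t, (t <= T)%N -> forall s a, 0 <= pib t s a.
Hypothesis pib1 : policy_sum1 nu T pib.

Let sP := stateProb nu P0 Ps Pr T pib.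
Let pair t s s' := Expect nu P0 Ps Pr T pib
  (fun hs _ _ => (hs t == s)%:R * (hs t.+1 == s')%:R).

Hypothesis sP0 : forall t, (t <= T)%N -> forall s, 0 <= sP t s.
Hypothesis pair_sum : forall t, (t < T)%N -> forall s,
  \sum_(s' : S) pair t s s' = sP t s.
Hypothesis pair_null : forall t, (t < T)%N -> forall s s',
  sP t.+1 s' = 0 -> pair t s s' = 0.

(* The rectangle law makes the lower integrals of [pib t s * Ps t.+1 s _ s']
   additive in [s'] as soon as [s] is reachable at time [t]; hence [Ps] is
   almost everywhere measurable there, although this is not assumed. *)
Lemma transition_version t s : exists GN : (S -> A -> R) * set A,
  [/\ forall s', measurable_fun setT (GN.1 s'),
      forall s' a, (t < T)%N -> 0 <= GN.1 s' a <= pib t s a,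
      measurable GN.2, nu GN.2 = 0%E &
      (t < T)%N -> 0 < sP t s -> forall s' a, ~ GN.2 a ->
        GN.1 s' a = pib t s a * Ps t.+1 s a s' /\
        (sP t.+1 s' = 0 -> pib t s a * Ps t.+1 s a s' = 0)].
Proof.
have [[tT sP_gt0]|nts] := pselect ((t < T)%N /\ 0 < sP t s); last first.
  exists (fun _ _ => 0, set0); split=> //=.
  - by move=> s' a tT; rewrite lexx pib0// ltnW.
  - by move=> tT sPts; exfalso; apply: nts.
have tT' : (t <= T)%N := ltnW tT.
pose f s' a := pib t s a * Ps t.+1 s a s'.
have f0 s' a : 0 <= f s' a by rewrite mulr_ge0// ?pib0// Ps0.
have fsum a : \sum_s' f s' a = pib t s a.
  by rewrite -mulr_sumr Ps1// mulr1.
have pairE s' : pair t s s' = (\int[nu]_a f s' a) * sP t s.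
  by rewrite /pair Expect_transition.
(* The observed pair probabilities add up over [s'], which lower integrals need not do by
   themselves; dividing by the positive probability of [s] leaves total 1. *)
have f1 : \sum_s' \int[nu]_a f s' a = 1.
  have := pair_sum tT s; under eq_bigr do rewrite pairE.
  rewrite -mulr_suml => /(canRL (mulfK _)) ->; first by rewrite divff// gt_eqF.
  by rewrite gt_eqF.
have [G [mG G0f [N [mN N0 GN]]]] :=
  measurable_summands (mpib tT' s) (pib1 tT' s) f0 fsum f1.
(* A successor of probability zero receives mass only from a null set of actions. Removing that set
   as well keeps the evaluation out of states where nothing is known about [Ps]. *)
have nullN s' : exists N', [/\ measurable N', nu N' = 0%E &
    sP t.+1 s' = 0 -> forall a, ~ N' a -> G s' a = 0].
  have [s'0|ns'0] := pselect (sP t.+1 s' = 0); last by exists set0; split.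
  have G0 : (\int[nu]_a `|(G s' a)%:E| = 0)%E.
    under eq_integral do rewrite gee0_abs ?lee_fin ?(andP (G0f _ _)).1//.
    have -> : (\int[nu]_a (G s' a)%:E = \int[nu]_a (f s' a)%:E)%E.
      by apply: (integral_eq_off_null mN N0) => a /(GN s') ->.
    have : \int[nu]_a f s' a = 0.
      apply/eqP; have := pairE s'; rewrite (pair_null tT s s'0) => /esym/eqP.
      by rewrite mulf_eq0 (gt_eqF sP_gt0) orbF.
    have ffin : (\int[nu]_a (f s' a)%:E < +oo)%E.
      apply: (@le_lt_trans _ _ (\int[nu]_a (pib t s a)%:E)%E).
        apply: lower_integral_le => a; rewrite lee_fin//.
        by rewrite -fsum (bigD1 s')//= lerDl sumr_ge0.
      by rewrite pib1// ltry.
    rewrite /Rintegral => fine0; rewrite -[LHS]fineK ?fine0//.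
    by rewrite ge0_fin_numE// integral_ge0// => a _; rewrite lee_fin.
  have mGE : measurable_fun setT (EFin \o G s') by exact/measurable_EFinP.
  have [N' [mN' N'0 HN']] := (ae_eq_integral_abs nu measurableT mGE).1 G0.
  exists N'; split => // _ a nN'a; apply: contrapT => ne; apply: nN'a.
  by apply: HN' => /= h; apply: ne; have [] := h Logic.I.
have [N' HN'] := choice nullN.
pose U := \big[setU/set0]_(s' : S) N' s'.
have [mU U0] : measurable U /\ (nu U <= 0)%E.
  apply: (big_ind (fun B => measurable B /\ (nu B <= 0)%E)).
  - by split=> //; rewrite measure0.
  - move=> B B' [mB nB] [mB' nB']; split; first exact: measurableU.
    by rewrite (le_trans (measureU2 _ _ _))// -[leRHS]adde0 leeD.
  - by move=> s' _; have [? -> _] := HN' s'.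
exists (G, N `|` U); split => /=.
- exact: mG.
- move=> s' a _; have /andP[-> /le_trans->//] := G0f s' a.
  by rewrite -fsum (bigD1 s')//= lerDl sumr_ge0.
- exact: measurableU.
- by rewrite measureU0//; apply/eqP; rewrite -measure_le0.
- move=> _ _ s' a nNa; rewrite GN; last by move=> Na; apply: nNa; left.
  split=> // s'0; rewrite -/(f s' a) -GN; last by move=> Na; apply: nNa; left.
  have [_ _ ->//] := HN' s'; move=> N'a; apply: nNa; right.
  by rewrite /U -bigcup_seq; exists s'; rewrite /= ?mem_index_enum.
Qed.

(** The version is the measurable minorant divided by [pib], hence at most 1, and zero outside the
    relevant times. For a policy dominated by [pib] no expectation changes: at each level the
    actions where the two kernels differ are null or have density zero, and rewards out of range are
    null. *)
Lemma measurable_version : exists Ps' : nat -> S -> A -> S -> R,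
  [/\ forall t s s', measurable_fun setT (fun a => Ps' t s a s'),
      forall t s a s', 0 <= Ps' t s a s' <= 1 &
      forall pi, (forall t, (t <= T)%N -> forall s a, pib t s a = 0 -> pi t s a = 0) ->
      forall f f' : @trajfun R dA A S,
        (forall hs ha hr, (forall k, (k <= T)%N -> 0 <= hr k <= Rmax) ->
          f hs ha hr = f' hs ha hr) ->
        Expect nu P0 Ps Pr T pi f = Expect nu P0 Ps' Pr T pi f'].
Proof.
have [GN GNP] := choice (fun ts : nat * S => transition_version ts.1 ts.2).
pose Ps' t s a s' := if t is t'.+1 then
  if (t' < T)%N then (GN (t', s)).1 s' a / pib t' s a else 0 else 0.
exists Ps'; split.
- move=> [|t] s s'; first exact: measurable_cst.
  rewrite /Ps' /=; have [tT|_] := boolP (t < T)%N; last exact: measurable_cst.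
  apply: measurable_funM; first by have [] := GNP (t, s).
  apply: measurable_inv_ge0; first exact: mpib (ltnW tT) s.
  exact: pib0 (ltnW tT) s.
- move=> [|t] s a s'; rewrite /Ps' /= ?lexx ?ler01//.
  case: ifPn => [tT|_]; last by rewrite lexx ler01.
  have [_ /(_ s' a tT)/andP[g0 gp] _ _ _] := GNP (t, s).
  rewrite divr_ge0 ?pib0 1?ltnW//=.
  have [p0|p0] := eqVneq (pib t s a) 0; first by rewrite p0 invr0 mulr0 ler01.
  by rewrite ler_pdivrMr ?mul1r// lt_def p0 pib0 1?ltnW.
move=> pi pi0 f f' ff'.
(* Invariant along the nested integral: past rewards are in range, and the last state was reachable,
   with an action of nonzero density off its exceptional null set. Both transition rules then agree
   at the next step. *)
pose good t (hs : nat -> S) (ha : nat -> A) (hr : nat -> R) :=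
  (forall k, (k < t)%N -> 0 <= hr k <= Rmax) /\
  (forall t', t = t'.+1 -> (t' < T)%N -> [/\ 0 < sP t' (hs t'),
     pib t' (hs t') (ha t') != 0 & ~ (GN (t', hs t')).2 (ha t')]).
have transE t hs ha hr s : (t <= T)%N -> good t hs ha hr ->
    mdp_trans P0 Ps t hs ha s = mdp_trans P0 Ps' t hs ha s /\
    (sP t s = 0 -> mdp_trans P0 Ps' t hs ha s = 0).
  case: t => [|t] tT [_ gd] /=.
    by split=> // <-; rewrite /sP stateProb0.
  have [s0 p0 nN] := gd t erefl tT.
  have [_ _ _ _ /(_ tT s0 s (ha t) nN) /= [GE G0]] := GNP (t, hs t).
  rewrite tT GE mulrAC divff// mul1r; split=> // /G0 /eqP.
  by rewrite mulf_eq0 (negbTE p0) => /eqP.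
have main m t hs ha hr : (t + m = T.+1)%N -> good t hs ha hr ->
    evalE nu P0 Ps Pr pi m t hs ha hr f = evalE nu P0 Ps' Pr pi m t hs ha hr f'.
  elim: m t hs ha hr => [|m ih] t hs ha hr tm gd.
    rewrite /=; apply: ff' => k kT; apply: gd.1.
    by move: tm; rewrite addn0 => ->.
  have tT : (t <= T)%N by move: tm; rewrite addnS => -[<-]; exact: leq_addr.
  rewrite /=; apply: eq_bigr => s _.
  have [trE tr0] := transE t hs ha hr s tT gd; rewrite trE.
  have [s0|s0] := eqVneq (sP t s) 0; first by rewrite (tr0 s0) [LHS]mul0r [RHS]mul0r.
  have {}s0 : 0 < sP t s by rewrite lt_def s0 sP0.
  congr (_ * _); have [_ _ mN N0 _] := GNP (t, s).
  apply: (Rintegral_eq_off_null mN N0) => a nNa.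
  have [p0|p0] := eqVneq (pib t s a) 0; first by rewrite pi0// !mul0r.
  congr (_ * _).
  have mB : measurable (~` `[0, Rmax]%classic : set R).
    by apply: measurableC; exact: measurable_itv.
  apply: (Rintegral_eq_off_null mB).
    by apply: null_setC; [exact: Pr1|exact: measurable_itv|exact: Pr_supp].
  move=> r /contrapT; rewrite /= in_itv/= => r0.
  apply: ih; first by rewrite addSnnS.
  split=> [k|t' [<-] tT'].
    rewrite ltnS leq_eqVlt => /orP[/eqP ->|kt]; first by rewrite updE.
    by rewrite upd_neq; [exact: gd.1|rewrite neq_ltn kt].
  by rewrite !updE.
rewrite /Expect; case: pickP => [sd _|//]; exact: main.
Qed.

End MeasurableTransitions.

(** * Finite sums of products over the coordinates of a trajectory *)

Section ProductTrajectoryFunctions.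
Context {R : realType} {dA : measure_display} {A : measurableType dA}
  {S : finType}.
Variable T : nat.
Implicit Types (al : nat -> S -> A -> R) (be : nat -> R -> R)
  (f g : @trajfun R dA A S).

Definition prodf al be : @trajfun R dA A S := fun hs ha hr =>
  \prod_(t < T.+1) (al t (hs t) (ha t) * be t (hr t)).

Definition good_factors al be := forall t, (t <= T)%N ->
  (forall s, bmf (al t s)) /\ bmf (be t).

(** The nested integral splits along a product with one bounded factor per time, and rectangles are
    products of indicators. Scalars have no constructor of their own: they are absorbed by the
    factor at time 0, which always exists. *)
Inductive comb : @trajfun R dA A S -> Prop :=
| comb_prodf al be : good_factors al be -> comb (prodf al be)
| combD f g : comb f -> comb g ->
    comb (fun hs ha hr => f hs ha hr + g hs ha hr).

Lemma comb_ext f g : (forall hs ha hr, f hs ha hr = g hs ha hr) ->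
  comb f -> comb g.
Proof.
by move=> fg; rewrite (_ : f = g)//; apply/funext => hs; apply/funext => ha;
  apply/funext => hr.
Qed.

Lemma combZ c f : comb f -> comb (fun hs ha hr => c * f hs ha hr).
Proof.
elim=> [al be ab|u v _ cu _ cv]; last first.
  apply: comb_ext (combD cu cv) => hs ha hr; by rewrite mulrDr.
pose al' t s a := if t == 0 then c * al t s a else al t s a.
apply: (@comb_ext (prodf al' be)) => [hs ha hr|]; last first.
  apply: comb_prodf => t tT; have [a1 b1] := ab t tT; split=> // s.
  by rewrite /al'; case: (t == 0) => //; exact: bmfZ.
by rewrite /prodf !big_ord_recl /= !mulrA.
Qed.

Lemma comb_sum (I : Type) (r : seq I) (F : I -> @trajfun R dA A S) :
  (forall i, comb (F i)) -> comb (fun hs ha hr => \sum_(i <- r) F i hs ha hr).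
Proof.
move=> cF; elim: r => [|i r ih].
  apply: (@comb_ext (fun hs ha hr => 0 * prodf (fun _ _ _ => 1) (fun _ _ => 1) hs ha hr)).
    by move=> hs ha hr; rewrite big_nil mul0r.
  by apply: combZ; apply: comb_prodf => t _; split=> [s|]; exact: bmf_cst.
by apply: comb_ext (combD (cF i) ih) => hs ha hr; rewrite big_cons.
Qed.

Lemma combB f g : comb f -> comb g ->
  comb (fun hs ha hr => f hs ha hr - g hs ha hr).
Proof.
move=> cf cg; apply: comb_ext (combD cf (combZ (-1) cg)) => hs ha hr.
by rewrite mulN1r.
Qed.

Lemma combM f g : comb f -> comb g ->
  comb (fun hs ha hr => f hs ha hr * g hs ha hr).
Proof.
move=> cf cg; elim: cf => [al be ab|u v _ cu _ cv]; last first.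
  by apply: comb_ext (combD cu cv) => hs ha hr; rewrite mulrDl.
elim: cg => [al' be' ab'|u v _ cu _ cv]; last first.
  by apply: comb_ext (combD cu cv) => hs ha hr; rewrite mulrDr.
apply: (@comb_ext (prodf (fun t s a => al t s a * al' t s a)
    (fun t r => be t r * be' t r))).
  by move=> hs ha hr; rewrite /prodf -big_split/=; apply: eq_bigr => t _;
    rewrite mulrACA.
apply: comb_prodf => t tT; have [a1 b1] := ab t tT; have [a2 b2] := ab' t tT.
by split=> [s|]; exact: bmfM.
Qed.

Lemma comb_factor t (x : S -> A -> R) (y : R -> R) : (t <= T)%N ->
  (forall s, bmf (x s)) -> bmf y ->
  comb (fun hs ha hr => x (hs t) (ha t) * y (hr t)).
Proof.
move=> tT bx by_.
apply: (@comb_ext (prodf (upd (fun _ _ _ => 1) t x) (upd (fun _ _ => 1) t y))).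
  move=> hs ha hr; rewrite /prodf (bigD1 (Ordinal (tT : (t < T.+1)%N)))//= !updE.
  rewrite big1 ?mulr1// => i; rewrite -val_eqE/= => it.
  by rewrite !upd_neq// mulr1.
apply: comb_prodf => k kT; have [->|kt] := eqVneq k t; first by rewrite !updE.
by rewrite !upd_neq//; split=> [s|]; exact: bmf_cst.
Qed.

Lemma comb_sa t (x : S -> A -> R) : (t <= T)%N ->
  (forall s, bmf (x s)) -> comb (fun hs ha hr => x (hs t) (ha t)).
Proof.
move=> tT bx; apply: comb_ext (comb_factor tT bx (bmf_cst 1)) => hs ha hr.
by rewrite mulr1.
Qed.

Lemma comb_s t (x : S -> R) : (t <= T)%N -> comb (fun hs ha hr => x (hs t)).
Proof. by move=> tT; apply: (@comb_sa t (fun s _ => x s)) => // s; exact: bmf_cst. Qed.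

Lemma comb_cst c : comb (fun _ _ _ => c).
Proof. exact: (@comb_s 0 (fun=> c)). Qed.

Lemma comb_prod (n : nat) (F : nat -> @trajfun R dA A S) :
  (forall i, (i < n)%N -> comb (F i)) ->
  comb (fun hs ha hr => \prod_(i < n) F i hs ha hr).
Proof.
elim: n => [|n ih] cF.
  by apply: comb_ext (comb_cst 1) => hs ha hr; rewrite big_ord0.
have cih := ih (fun i im => cF i (ltnW im)).
by apply: comb_ext (combM cih (cF n (ltnSn n))) => hs ha hr; rewrite big_ord_recr.
Qed.

Lemma bounded_factor al : (forall t, (t <= T)%N -> forall s, bmf (al t s)) ->
  forall t, (t <= T)%N -> exists M, forall s a, `|al t s a| <= M.
Proof.
move=> bal t tT.
have [M HM] := choice (fun s => (bal t tT s).2).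
exists (\sum_s `|M s|) => s a; rewrite (le_trans (HM s a))//.
by rewrite (le_trans (ler_norm _))// (bigD1 s)//= lerDl sumr_ge0.
Qed.

Lemma prodf_factors_bounded al be : good_factors al be ->
  exists2 M : nat -> R, (forall t, 0 <= M t) & forall t, (t <= T)%N ->
    forall s a r, `|al t s a * be t r| <= M t.
Proof.
move=> ab.
have ex t : exists M, 0 <= M /\ ((t <= T)%N -> forall s a r, `|al t s a * be t r| <= M).
  have [tT|tT] := boolP (t <= T)%N; last by exists 0.
  have [Ma HMa] := bounded_factor (fun t tT => (ab t tT).1) tT.
  have [Mb HMb] := (ab t tT).2.2.
  exists (`|Ma| * `|Mb|); split=> [|_ s a r]; first exact: mulr_ge0.
  by rewrite normrM ler_pM// (le_trans _ (ler_norm _)).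
by have [M HM] := choice ex; exists M => t; have [] := HM t.
Qed.

Lemma comb_bounded f : comb f -> exists M, forall hs ha hr, `|f hs ha hr| <= M.
Proof.
elim=> [al be ab|u v _ [M Mu] _ [N Nv]]; last first.
  by exists (M + N) => hs ha hr; rewrite (le_trans (ler_normD _ _))// lerD.
have [M M0 HM] := prodf_factors_bounded ab.
exists (\prod_(t < T.+1) M t) => hs ha hr; rewrite normr_prod ler_prod// => t _.
by rewrite normr_ge0/= HM// -ltnS ltn_ord.
Qed.

(** The state type carries no sigma-algebra, so the dependence on the state is expanded over its
    level sets. *)
Lemma comb_bmf {d} {Z : measurableType d} (zs : nat -> Z -> S) (za : nat -> Z -> A)
    (zr : nat -> Z -> R) f :
  (forall t, (t <= T)%N -> forall s, measurable [set z | zs t z = s]) ->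
  (forall t, (t <= T)%N -> measurable_fun setT (za t)) ->
  (forall t, (t <= T)%N -> measurable_fun setT (zr t)) ->
  comb f -> bmf (fun z => f (zs^~ z) (za^~ z) (zr^~ z)).
Proof.
move=> ms ma mr; elim=> [al be ab|u v _ cu _ cv]; last exact: bmfD.
rewrite (_ : (fun z => _) = fun z => \prod_(t <- map val (enum 'I_T.+1) )
  (if (t <= T)%N then al t (zs t z) (za t z) * be t (zr t z) else 1)); last first.
  apply/funext => z; rewrite big_map big_enum/=; apply: eq_bigr => t _.
  by rewrite -ltnS ltn_ord.
apply: bmf_prod => t; have [tT|_] := boolP (t <= T)%N; last exact: bmf_cst.
have [at_ bt] := ab t tT.
apply: bmfM; last by apply: bmf_comp => //; exact: mr.
rewrite (_ : (fun z => _) = fun z => \sum_(s : S) \1_[set z | zs t z = s] z * al t s (za t z)).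
  apply: bmf_sum => s; apply: bmfM; first exact: bmf_indic (ms t tT s).
  by apply: bmf_comp (at_ s); exact: ma.
apply/funext => z; rewrite (bigD1 (zs t z))//= big1 ?addr0.
  by rewrite indicE mem_set// mul1r.
by move=> s /negP ne; rewrite indicE memNset ?mul0r//= => e; apply: ne; rewrite e.
Qed.

Definition rect (BS : nat -> set S) (BA : nat -> set A) (BR : nat -> set R) :
    @trajfun R dA A S :=
  fun hs ha hr => \prod_(t < T.+1)
    (\1_(BS t) (hs t) * \1_(BA t) (ha t) * \1_(BR t) (hr t)).

Lemma prodf_upd al be k x y hs ha hr (kT : (k < T.+1)%N) :
  prodf (upd al k x) (upd be k y) hs ha hr =
  \prod_(t < T.+1 | t != Ordinal kT) (al t (hs t) (ha t) * be t (hr t)) *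
  (x (hs k) (ha k) * y (hr k)).
Proof.
rewrite /prodf (bigD1 (Ordinal kT))//= !updE mulrC; congr (_ * _).
by apply: eq_bigr => t; rewrite -val_eqE/= => tk; rewrite !upd_neq.
Qed.

(* The factors of a product are generalised from indicators to bounded
   measurable functions one coordinate at a time. *)
Lemma comb_vanish (L : @trajfun R dA A S -> R) (K : R) :
  (forall f g, comb f -> comb g ->
    L (fun hs ha hr => f hs ha hr + g hs ha hr) = L f + L g) ->
  (forall c f, comb f -> L (fun hs ha hr => c * f hs ha hr) = c * L f) ->
  (forall f (b : R), comb f -> (forall hs ha hr, `|f hs ha hr| <= b) -> `|L f| <= K * b) ->
  (forall BS BA BR, (forall t, measurable (BA t)) -> (forall t, measurable (BR t)) ->
    L (rect BS BA BR) = 0) ->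
  forall f, comb f -> L f = 0.
Proof.
move=> LD LZ LB L0.
have eqL f g : (forall hs ha hr, f hs ha hr = g hs ha hr) -> L f = L g.
  by move=> fg; congr L; apply/funext => hs; apply/funext => ha; apply/funext => hr.
pose simple al be t := exists BS BA BR, [/\ measurable BA, measurable BR,
  forall s a, al t s a = \1_BS s * \1_BA a & forall r, be t r = \1_BR r].
(* Coordinates below [k] carry arbitrary factors, those from [k] on indicators; the induction step
   frees coordinate [k]. *)
have main k : (k <= T.+1)%N -> forall al be, good_factors al be ->
    (forall t, (k <= t)%N -> (t <= T)%N -> simple al be t) -> L (prodf al be) = 0.
  elim: k => [_ al be ab sab|k ih kT al be ab sab].
    have ex t : exists B : set S * set A * set R, [/\ measurable B.1.2, measurable B.2 &
        (t <= T)%N -> (forall s a, al t s a = \1_B.1.1 s * \1_B.1.2 a) /\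
          (forall r, be t r = \1_B.2 r)].
      have [tT|tT] := boolP (t <= T)%N; last first.
        by exists (set0, set0, set0); split=> //= tT'; rewrite tT' in tT.
      by have [BS [BA [BR [mA mR h1 h2]]]] := sab t (leq0n t) tT;
        exists (BS, BA, BR); split.
    have [B HB] := choice ex.
    rewrite -(L0 (fun t => (B t).1.1) (fun t => (B t).1.2) (fun t => (B t).2)).
    - apply: eqL => hs ha hr; apply: eq_bigr => t _.
      have [_ _ H] := HB t; have [h1 h2] := H (ltn_ord t).
      by rewrite h1 h2.
    - by move=> t; have [] := HB t.
    - by move=> t; have [] := HB t.
  have good_upd x y : (forall s, bmf (x s)) -> bmf y ->
      good_factors (upd al k x) (upd be k y).
    move=> bx by_ t tT; have [->|tk] := eqVneq t k; first by rewrite !updE.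
    by rewrite !upd_neq//; exact: ab.
  have [M M0 HM] := prodf_factors_bounded ab.
  pose C := \prod_(t < T.+1 | t != Ordinal kT) M t.
  have C0 : 0 <= C by apply: prodr_ge0.
  have bound (x : S -> A -> R) (y : R -> R) (b : R) : (forall s a r, `|x s a * y r| <= b) ->
      forall hs ha hr, `|prodf (upd al k x) (upd be k y) hs ha hr| <= C * b.
    move=> xyb hs ha hr; rewrite (prodf_upd _ _ _ _ _ _ _ kT) normrM ler_pM//.
    rewrite normr_prod; apply: ler_prod => t _.
    by rewrite normr_ge0/= HM// -ltnS ltn_ord.
  (* Splitting over the value [s0] of the state leaves a function of the action times one of the
     reward. Indicators are removed by [linear_bounded_vanish], from the reward in [step1] and from
     the action in [step2]. *)
  pose ds (s0 : S) (h : A -> R) (s : S) (a : A) : R := (s == s0)%:R * h a.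
  have bds (s0 : S) (h : A -> R) : bmf h -> forall s, bmf (ds s0 h s) by move=> bh s; exact: bmfZ.
  have le01 (b : bool) (x : R) : `|b%:R * x| <= `|x|.
    by case: b; rewrite ?mul1r// mul0r normr0.
  have step1 s0 BA y : measurable BA -> bmf y ->
      L (prodf (upd al k (ds s0 (\1_BA : A -> R))) (upd be k y)) = 0.
    move=> mBA; have bA : bmf (\1_BA : A -> R) := bmf_indic mBA.
    have bd := bds s0 _ bA.
    apply: (linear_bounded_vanish
      (L := fun y => L (prodf (upd al k (ds s0 (\1_BA : A -> R))) (upd be k y))) (K := K * C)).
    - move=> u v bu bv; rewrite -LD; [|by apply/comb_prodf/good_upd..].
      apply: eqL => hs ha hr; rewrite !(prodf_upd _ _ _ _ _ _ _ kT).
      by rewrite !mulrDr.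
    - move=> c u bu; rewrite -LZ; last by apply/comb_prodf/good_upd.
      apply: eqL => hs ha hr; rewrite !(prodf_upd _ _ _ _ _ _ _ kT).
      by ring.
    - move=> u b bu ub; rewrite -mulrA; apply: LB; first by apply/comb_prodf/good_upd.
      apply: bound => s a r; rewrite /ds -mulrA (le_trans (le01 _ _))// indicE.
      by rewrite (le_trans (le01 _ _)).
    - move=> B mB; apply: ih; [exact: ltnW|by apply: good_upd => //; exact: bmf_indic|].
      move=> t kt tT; have [tk|tk] := eqVneq t k.
        subst t; exists [set s0], BA, B; split=> // [s a|r]; last by rewrite updE.
        rewrite updE /ds indicE; congr ((nat_of_bool _)%:R * _).
        by apply/eqP/idP => [->|/set_mem]; [exact: mem_set|].
      have {kt}kt : (k < t)%N by rewrite ltn_neqAle eq_sym tk.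
      have [BS' [BA' [BR' [? ? h1 h2]]]] := sab t kt tT.
      exists BS', BA', BR'; split=> // [s a|r]; rewrite upd_neq//.
  have step2 s0 h y : bmf h -> bmf y ->
      L (prodf (upd al k (ds s0 h)) (upd be k y)) = 0.
    move=> bh by_; have [My HMy] := by_.2.
    apply: (linear_bounded_vanish
      (L := fun h => L (prodf (upd al k (ds s0 h)) (upd be k y)))
      (K := K * C * My) _ _ _ _ bh) => //.
    - move=> u v bu bv; rewrite -LD; [|by apply/comb_prodf/good_upd => //; exact: bds..].
      apply: eqL => hs ha hr; rewrite !(prodf_upd _ _ _ _ _ _ _ kT) /ds.
      by ring.
    - move=> c u bu; rewrite -LZ; last by apply/comb_prodf/good_upd => //; exact: bds.
      apply: eqL => hs ha hr; rewrite !(prodf_upd _ _ _ _ _ _ _ kT) /ds.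
      by ring.
    - move=> u b bu ub; rewrite -2!mulrA; apply: LB.
        by apply/comb_prodf/good_upd => //; exact: bds.
      apply: bound => s a r; rewrite /ds -mulrA (le_trans (le01 _ _))//.
      by rewrite normrM mulrC ler_pM.
    - by move=> B mB; exact: step1.
  have kT' : (k <= T)%N by [].
  have [bak bbk] := ab k kT'.
  have sumL (r : seq S) : L (fun hs ha hr => \sum_(s0 <- r)
      prodf (upd al k (ds s0 (al k s0))) (upd be k (be k)) hs ha hr) = 0.
    elim: r => [|s0 r ihr].
      rewrite (@eqL _ (fun _ _ _ => 0 * 1)); last first.
        by move=> hs ha hr; rewrite big_nil mul0r.
      by rewrite (LZ 0 (fun _ _ _ => 1)) ?mul0r//; exact: comb_cst.
    rewrite (@eqL _ (fun hs ha hr =>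
      prodf (upd al k (ds s0 (al k s0))) (upd be k (be k)) hs ha hr +
      \sum_(s0 <- r) prodf (upd al k (ds s0 (al k s0))) (upd be k (be k)) hs ha hr)).
      rewrite LD ?ihr ?addr0 ?step2//.
        by apply/comb_prodf/good_upd => //; exact: bds.
      by apply: comb_sum => s1; apply/comb_prodf/good_upd => //; exact: bds.
    by move=> hs ha hr; rewrite big_cons.
  rewrite -(sumL (index_enum S)); apply: eqL => hs ha hr.
  under [RHS]eq_bigr do rewrite (prodf_upd _ _ _ _ _ _ _ kT).
  rewrite -mulr_sumr /prodf (bigD1 (Ordinal kT))//= mulrC; congr (_ * _).
  rewrite (bigD1 (hs k))//= big1 ?addr0; first by rewrite /ds eqxx mul1r.
  by move=> s /negbTE; rewrite /ds eq_sym => ->; rewrite !mul0r.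
move=> f; elim=> [al be ab|u v cu Lu cv Lv]; last by rewrite LD// Lu Lv addr0.
apply: (main T.+1) => // t tT tT'; by move: (leq_trans tT tT'); rewrite ltnn.
Qed.

End ProductTrajectoryFunctions.

(** * Linearity against a density and measurability through a kernel *)

Section Density.
Context {R : realType} {d} {X : measurableType d}.
Variables (nu : {measure set X -> \bar R}) (p : X -> R).
Hypothesis mp : measurable_fun setT p.
Hypothesis p0 : forall x, 0 <= p x.
Hypothesis p1 : (\int[nu]_x (p x)%:E = 1)%E.

Lemma density_integrable (f : X -> R) : bmf f ->
  nu.-integrable setT (EFin \o (fun x => p x * f x)).
Proof.
move=> [mf [M Mf]].
have ip : nu.-integrable setT (EFin \o p).
  apply/integrableP; split; first exact/measurable_EFinP.
  under eq_integral do rewrite /= ger0_norm//.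
  by rewrite p1 ltry.
apply: (@le_integrable _ _ _ nu setT measurableT _ (EFin \o (fun x => `|M| * p x))).
- by apply/measurable_EFinP; exact: measurable_funM.
- move=> x _ /=; rewrite lee_fin !normrM normr_id mulrC ler_pM//.
  by rewrite (le_trans (Mf x))// ler_norm.
- have := integrableZl measurableT `|M| ip.
  by apply: eq_integrable => // x _; rewrite /= EFinM.
Qed.

Lemma density_meanD (f g : X -> R) : bmf f -> bmf g ->
  \int[nu]_x (p x * (f x + g x)) =
  \int[nu]_x (p x * f x) + \int[nu]_x (p x * g x).
Proof.
move=> bf bg; rewrite -RintegralD//; [|exact: density_integrable..].
by apply: eq_Rintegral => x _; rewrite mulrDr.
Qed.

Lemma density_mean_bound (f : X -> R) (b : R) : bmf f -> (forall x, `|f x| <= b) ->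
  `|\int[nu]_x (p x * f x)| <= b.
Proof.
move=> bf fb.
have bE : \int[nu]_x (p x * b) = b by rewrite RintegralZr_any /Rintegral p1 mul1r.
have bb : bmf (fun _ : X => b) by exact: bmf_cst.
have bNb : bmf (fun _ : X => - b) by exact: bmf_cst.
rewrite ler_norml -{2}bE -[X in - X]bE -RintegralN_any; apply/andP; split.
  rewrite (@eq_Rintegral _ _ _ _ _ (fun x => p x * - b)); last first.
    by move=> x _; rewrite mulrN.
  apply: le_Rintegral => //; [exact: density_integrable..|].
  by move=> x _; rewrite ler_wpM2l//; have := fb x; rewrite ler_norml => /andP[].
apply: le_Rintegral => //; [exact: density_integrable..|].
by move=> x _; rewrite ler_wpM2l//; have := fb x; rewrite ler_norml => /andP[].
Qed.

End Density.

Lemma bmf_kernel_mean {R : realType} {d d'} {X : measurableType d}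
    {Y : measurableType d'} (k : R.-pker X ~> Y) (f : Y -> R) : bmf f ->
  bmf (fun x => \int[k x]_y f y).
Proof.
move=> bf; have [M HM] := bf.2.
have k1 x : k x setT = 1%E by exact: prob_kernel.
split; last by exists M => x; exact: mean_norm_bound.
(* The shift makes the integrand nonnegative, as the measurability theorem for kernel integrals
   requires. *)
pose g y := f y + M.
have bg : bmf g by apply: bmfD => //; exact: bmf_cst.
have g0 y : 0 <= g y.
  by rewrite /g -lerBlDr sub0r; have := HM y; rewrite ler_norml => /andP[].
rewrite (_ : (fun x => _) = fun x => \int[k x]_y g y - M); last first.
  by apply/funext => x; rewrite meanD ?mean_cst ?addrK//; exact: bmf_cst.
apply: measurable_funB => //.
apply: measurableT_comp => //.
apply: (@measurable_fun_integral_kernel _ _ _ _ _ k _ (EFin \o g)).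
- by move=> U mU; exact: measurable_kernel.
- by move=> y; rewrite /= lee_fin.
- by apply/measurable_EFinP; exact: bg.1.
Qed.

(** * Linearity and boundedness of the nested expectation *)

Section MeasurableEvaluation.
Context {R : realType} {dA : measure_display} {A : measurableType dA}
  {S : finType}.
Variables (nu : {measure set A -> \bar R}) (P0 : S -> R)
  (Ps : nat -> S -> A -> S -> R) (Pr : nat -> S -> R.-pker A ~> R) (T : nat)
  (pi : nat -> S -> A -> R).
Hypothesis P0_01 : forall s, 0 <= P0 s <= 1.
Hypothesis mPs : forall t s s', measurable_fun setT (fun a => Ps t s a s').
Hypothesis Ps_01 : forall t s a s', 0 <= Ps t s a s' <= 1.
Hypothesis mpi : forall t, (t <= T)%N -> forall s, measurable_fun setT (pi t s).
Hypothesis pi0 : forall t, (t <= T)%N -> forall s a, 0 <= pi t s a.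
Hypothesis pi1 : policy_sum1 nu T pi.
Implicit Types f g : @trajfun R dA A S.

Let ev := evalE nu P0 Ps Pr pi.

(** Additivity has to be applied at every level with the history frozen; this records what it needs
    for the inner integral over rewards and the outer one over actions. *)
Definition regular f := forall m t hs ha hr s, (t + m.+1 = T.+1)%N ->
  (forall a, bmf (fun r => ev m t.+1 (upd hs t s) (upd ha t a) (upd hr t r) f)) /\
  bmf (fun a => \int[Pr t s a]_r ev m t.+1 (upd hs t s) (upd ha t a) (upd hr t r) f).

Lemma trans_01 t hs ha s : 0 <= mdp_trans P0 Ps t hs ha s <= 1.
Proof. by case: t => [|t] /=. Qed.

Let leqT t m : (t + m.+1 = T.+1)%N -> (t <= T)%N.
Proof. by rewrite addnS => -[<-]; exact: leq_addr. Qed.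

Lemma evalE_regularD f g m t hs ha hr : regular f -> regular g ->
  (t + m = T.+1)%N ->
  ev m t hs ha hr (fun hs ha hr => f hs ha hr + g hs ha hr) =
  ev m t hs ha hr f + ev m t hs ha hr g.
Proof.
move=> rf rg; elim: m t hs ha hr => [//|m ih] t hs ha hr tm.
have tT := leqT tm.
rewrite /ev /= -big_split /=; apply: eq_bigr => s _; rewrite -mulrDr; congr (_ * _).
have [rf1 rf2] := rf m t hs ha hr s tm; have [rg1 rg2] := rg m t hs ha hr s tm.
rewrite -(density_meanD (mpi tT s) (pi0 tT s) (pi1 tT s) rf2 rg2).
apply: eq_Rintegral => a _; congr (_ * _).
rewrite -(meanD (Pr1 Pr t s a) (rf1 a) (rg1 a)).
by apply: eq_Rintegral => r _; apply: ih; rewrite addSnnS.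
Qed.

Lemma regularD f g : regular f -> regular g ->
  regular (fun hs ha hr => f hs ha hr + g hs ha hr).
Proof.
move=> rf rg m t hs ha hr s tm.
have [rf1 rf2] := rf m t hs ha hr s tm; have [rg1 rg2] := rg m t hs ha hr s tm.
have tm' : (t.+1 + m = T.+1)%N by rewrite addSnnS.
split=> [a|].
  under eq_fun do rewrite evalE_regularD//.
  exact: bmfD.
rewrite (_ : (fun a => _) = fun a =>
  \int[Pr t s a]_r ev m t.+1 (upd hs t s) (upd ha t a) (upd hr t r) f +
  \int[Pr t s a]_r ev m t.+1 (upd hs t s) (upd ha t a) (upd hr t r) g).
  exact: bmfD.
apply/funext => a; rewrite -(meanD (Pr1 Pr t s a) (rf1 a) (rg1 a)).
by apply: eq_Rintegral => r _; rewrite evalE_regularD.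
Qed.

(** By the Markov property the future of a product sees the past only through the last state and
    action, which enter the next transition; hence [K]. At [t = 0] the initial law takes the place
    of the transition, so the arguments of [K] do not matter. *)
Lemma evalE_prodf al be : good_factors T al be ->
  forall m t, (t + m = T.+1)%N -> exists K : S -> A -> R, (forall s, bmf (K s)) /\
    forall hs ha hr, ev m t hs ha hr (prodf T al be) =
      \prod_(k < t) (al k (hs k) (ha k) * be k (hr k)) * K (hs t.-1) (ha t.-1).
Proof.
move=> ab; elim=> [t|m ih t] tm.
  exists (fun _ _ => 1); split=> [s|hs ha hr]; first exact: bmf_cst.
  by move: tm; rewrite addn0 => ->; rewrite mulr1.
have tT := leqT tm; have [bal bbe] := ab t tT.
have [|K [bK KE]] := ih t.+1; first by rewrite addSnnS.
pose D u := \int[nu]_a (pi t u a * (al t u a * K u a * \int[Pr t u a]_r be t r)).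
pose tr s a u := if t is _.+1 then Ps t s a u else P0 u.
exists (fun s a => \sum_u tr s a u * D u); split=> [s|hs ha hr].
  apply: bmf_sum => u; apply: bmfM; last exact: bmf_cst.
  rewrite /tr; case: (t) => [|t']; first exact: bmf_cst.
  split; first exact: mPs.
  by exists 1 => a; have /andP[? ?] := Ps_01 t'.+1 s a u; rewrite ger0_norm.
rewrite /ev /= mulr_sumr; apply: eq_bigr => u _.
rewrite mulrCA; congr (_ * _); first by rewrite /tr; case: (t).
rewrite -RintegralZl_any; apply: eq_Rintegral => a _; rewrite [RHS]mulrCA.
congr (_ * _); rewrite mulrA -RintegralZl_any; apply: eq_Rintegral => r _.
have := KE (upd hs t u) (upd ha t a) (upd hr t r); rewrite /ev => ->.
rewrite big_ord_recr /= !updE.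
rewrite (eq_bigr (fun k : 'I_t => al k (hs k) (ha k) * be k (hr k))).
  by ring.
by move=> k _; rewrite !upd_neq// neq_ltn ltn_ord.
Qed.

Lemma regular_prodf al be : good_factors T al be -> regular (prodf T al be).
Proof.
move=> ab m t hs ha hr s tm; have tT := leqT tm; have [bal bbe] := ab t tT.
have tm' : (t.+1 + m = T.+1)%N by rewrite addSnnS.
have [K [bK KE]] := evalE_prodf ab tm'.
pose c := \prod_(k < t) (al k (hs k) (ha k) * be k (hr k)).
have E a r : ev m t.+1 (upd hs t s) (upd ha t a) (upd hr t r) (prodf T al be) =
    (c * al t s a * K s a) * be t r.
  rewrite KE big_ord_recr /= !updE.
  rewrite (eq_bigr (fun k : 'I_t => al k (hs k) (ha k) * be k (hr k))).
    by rewrite /c; ring.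
  by move=> k _; rewrite !upd_neq// neq_ltn ltn_ord.
split=> [a|].
  under eq_fun do rewrite E.
  exact: bmfZ.
rewrite (_ : (fun a => _) = fun a => (c * al t s a * K s a) * \int[Pr t s a]_r be t r).
  by apply: bmfM; [apply: bmfM => //; exact: bmfZ|exact: bmf_kernel_mean].
apply/funext => a; rewrite -RintegralZl_any.
by apply: eq_Rintegral => r _; rewrite E.
Qed.

Lemma regular_comb f : comb T f -> regular f.
Proof. by elim=> [al be|u v _ ru _ rv]; [exact: regular_prodf|exact: regularD]. Qed.

Lemma evalEZ c f m t hs ha hr :
  ev m t hs ha hr (fun hs ha hr => c * f hs ha hr) = c * ev m t hs ha hr f.
Proof.
elim: m t hs ha hr => [//|m ih] t hs ha hr.
rewrite /ev /= mulr_sumr; apply: eq_bigr => s _; rewrite [RHS]mulrCA; congr (_ * _).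
rewrite -RintegralZl_any; apply: eq_Rintegral => a _; rewrite [RHS]mulrCA; congr (_ * _).
by rewrite -RintegralZl_any; apply: eq_Rintegral => r _; exact: ih.
Qed.

(** Transition weights are only bounded by 1, since the measurable version need not sum to 1 at
    unreachable states. This costs a factor [#|S|] per level; any finite constant serves. *)
Lemma evalE_bound f (b : R) m t hs ha hr : regular f ->
  (forall hs ha hr, `|f hs ha hr| <= b) -> (t + m = T.+1)%N ->
  `|ev m t hs ha hr f| <= #|S|%:R ^+ m * b.
Proof.
move=> rf fb; have b0 : 0 <= b by exact: le_trans (fb hs ha hr).
elim: m t hs ha hr => [|m ih] t hs ha hr tm; first by rewrite expr0 mul1r fb.
have tT := leqT tm.
rewrite /ev /= (le_trans (ler_norm_sum _ _ _))//.
rewrite exprS -mulrA mulr_natl -sumr_const; apply: ler_sum => s _.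
rewrite normrM -[leRHS]mul1r; apply: ler_pM => //.
  by have /andP[? ?] := trans_01 t hs ha s; rewrite ger0_norm.
have [rf1 rf2] := rf m t hs ha hr s tm.
apply: (density_mean_bound (mpi tT s) (pi0 tT s) (pi1 tT s) rf2) => a.
apply: mean_norm_bound; [exact: Pr1|exact: rf1|] => r.
by apply: ih; rewrite addSnnS.
Qed.

Let Ex := Expect nu P0 Ps Pr T pi.

Lemma ExpectD f g : comb T f -> comb T g ->
  Ex (fun hs ha hr => f hs ha hr + g hs ha hr) = Ex f + Ex g.
Proof.
move=> cf cg; rewrite /Ex /Expect; case: pickP => [sd _|_]; last by rewrite addr0.
exact: (@evalE_regularD f g T.+1 0 _ _ _ (regular_comb cf) (regular_comb cg)).
Qed.

Lemma ExpectZ c f : Ex (fun hs ha hr => c * f hs ha hr) = c * Ex f.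
Proof.
rewrite /Ex /Expect; case: pickP => [sd _|_]; last by rewrite mulr0.
exact: (@evalEZ c f T.+1 0).
Qed.

Lemma Expect_bound (s0 : S) f (b : R) : comb T f -> (forall hs ha hr, `|f hs ha hr| <= b) ->
  `|Ex f| <= #|S|%:R ^+ T.+1 * b.
Proof.
move=> cf fb; rewrite /Ex /Expect; case: pickP => [sd _|nS].
  exact: (@evalE_bound f b T.+1 0 _ _ _ (regular_comb cf) fb).
by have := nS s0.
Qed.

End MeasurableEvaluation.

(** * Uniform continuity on compact sets and for functions vanishing at infinity *)

Lemma heine {R : realType} (g : R -> R) (K e : R) : continuous g -> 0 < e ->
  exists2 dl, 0 < dl & forall x y, `|x| <= K -> `|x - y| < dl -> `|g x - g y| <= e.
Proof.
move=> cg e0.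
have cK : compact `[-K, K]%classic by exact: segment_compact.
move/compact_near_coveringP : cK.
(* The near-covering form of compactness, with the filter of small positive radii, yields one radius
   for all [x] in the interval while [y] ranges over the whole line. *)
move=> /(_ R (0^'+) (fun dl x => forall y, `|x - y| < dl -> `|g x - g y| <= e) _).
case=> [x _|dl /= dl0 H].
  have e20 : 0 < e / 2 by rewrite divr_gt0.
  have /cvgrPdist_lt/(_ _ e20)/nbhs_ballP[d /= d0 Hd] := cg x.
  have d20 : 0 < d / 2 by rewrite divr_gt0.
  exists (ball x (d / 2), [set dl | dl < d / 2]) => /=.
    split; first by apply/nbhs_ballP; exists (d / 2).
    exact: nbhs_right_lt.
  move=> [x' dl] /= [xx' dld] y x'y.
  have gx' : `|g x - g x'| < e / 2.
    by apply: Hd; apply: le_ball xx'; rewrite ler_pdivrMr// ler_peMr ?ler1n// ltW.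
  have gy : `|g x - g y| < e / 2.
    apply: Hd; rewrite /ball/= -(subrKA x') (le_lt_trans (ler_normD _ _))//.
    by rewrite [ltRHS]splitr ltrD// (lt_trans x'y).
  rewrite -(subrKA (g x)) (le_trans (ler_normD _ _))// [leRHS]splitr lerD//.
    by rewrite distrC ltW.
  exact: ltW.
have dl2 : 0 < dl / 2 by rewrite divr_gt0.
exists (dl / 2) => // x y xK xy; apply: (H (dl / 2)) => //=.
- by rewrite sub0r normrN gtr0_norm// ltr_pdivrMr// ltr_pMr// ltr1n.
- by rewrite in_itv/= -ler_norml.
Qed.

(** Near the origin compactness applies; far out both values are small. The minimum with 1 keeps
    [|y|] above [K] once [|x|] exceeds [K + 1]. *)
Lemma vanishing_uniform_continuous {R : realType} (D : R -> R) : continuous D ->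
  (forall e, 0 < e -> exists K, forall x, K <= `|x| -> `|D x| <= e) ->
  forall e, 0 < e ->
  exists2 dl, 0 < dl & forall x y, `|x - y| < dl -> `|D x - D y| <= e.
Proof.
move=> cD D0 e e0; have e20 : 0 < e / 2 by rewrite divr_gt0.
have [K HK] := D0 _ e20; have [dl dl0 Hdl] := heine (K + 1) cD e0.
exists (Num.min dl 1) => [|x y]; first by rewrite lt_min dl0 ltr01.
rewrite lt_min => /andP[xydl xy1].
have [xK|xK] := leP `|x| (K + 1); first exact: Hdl.
have yK : K <= `|y|.
  have : `|x| <= `|x - y| + `|y| by rewrite -{1}(subrK y x) ler_normD.
  by move: xK xy1; lra.
have h1 := HK y yK; have h2 : `|D x| <= e / 2 by apply: HK; lra.
by rewrite (le_trans (ler_normB _ _))//; lra.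
Qed.

(** * The normal law: density and tails *)

Section Gaussian.
Context {R : realType}.
Variable V : R.
Hypothesis V0 : 0 < V.
Let sg := Num.sqrt V.
Let N := @normal_prob R 0 sg.
Let p := normal_pdf 0 sg.
Let k := normal_peak sg.

Let sg0 : sg != 0. Proof. by rewrite gt_eqF// sqrtr_gt0. Qed.
Let k0 : 0 < k. Proof. exact: normal_peak_gt0. Qed.
Let sgE : sg ^+ 2 = V. Proof. by rewrite sqr_sqrtr// ltW. Qed.

Lemma gauss_pdfE x : p x = k * expR (- (x ^+ 2 / (V + V))).
Proof.
by rewrite /p normal_pdfE// /normal_fun sgE subr0 mulr2n mulNr.
Qed.

Let N1 : N setT = 1%E. Proof. exact: probability_setT. Qed.

(** Both sides are bounded linear functionals that agree on indicators, where the normal law is by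
    definition the integral of its density. *)
Lemma gauss_mean (f : R -> R) : bmf f ->
  \int[N]_x f x = \int[lebesgue_measure]_x (p x * f x).
Proof.
move=> bf; apply/eqP; rewrite -subr_eq0; apply/eqP.
have mp : measurable_fun (setT : set (measurableTypeR R)) p.
  exact: measurable_normal_pdf.
have p0 x : 0 <= p x by exact: normal_pdf_ge0.
have p1 : (\int[lebesgue_measure]_x (p x)%:E = 1)%E by exact: integral_normal_pdf.
apply: (linear_bounded_vanish (L := fun f => \int[N]_x f x -
  \int[lebesgue_measure]_x (p x * f x)) (K := 2) _ _ _ _ bf).
- move=> u v bu bv; rewrite (meanD N1)// (density_meanD mp p0 p1)//; ring.
- move=> c u bu; rewrite (meanZ N1)//.
  under [X in _ - X = _]eq_Rintegral do rewrite mulrCA.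
  by rewrite RintegralZl_any; ring.
- move=> u b bu ub; rewrite (le_trans (ler_normB _ _))// mulr_natl mulr2n lerD//.
    exact: mean_norm_bound.
  exact: (density_mean_bound mp p0 p1).
- move=> B mB; apply/eqP; rewrite subr_eq0; apply/eqP.
  apply: EFin_inj; rewrite (mean_indic N1 mB).
  rewrite (_ : \int[lebesgue_measure]_x _ = \int[lebesgue_measure]_(x in B) p x).
    rewrite /N /normal_prob /Rintegral fineK// ge0_fin_numE; last first.
      by apply: integral_ge0 => x _; rewrite lee_fin.
    apply: (@le_lt_trans _ _ (N setT)); last by rewrite N1 ltry.
    by rewrite -[X in (X <= _)%E]/(N B); apply: le_measure; rewrite ?inE.
  rewrite [RHS]Rintegral_mkcond; apply: eq_Rintegral => x _.
  by rewrite patchE indicE; case: ifPn => _; rewrite ?mulr1// mulr0.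
Qed.

(** The half-line beyond [x], on the side away from the origin, misses [[-n, n]], whose mass tends
    to 1. *)
Lemma gauss_tail (e : R) : 0 < e -> exists2 K, 0 <= K &
  forall x, K <= `|x| -> fine (N (if 0 <= x then `]x, +oo[ else `]-oo, x])%classic) <= e.
Proof.
move=> e0.
have : N (`[- n%:R, n%:R]%classic) @[n --> \oo] --> N (\bigcup_n `[- n%:R, n%:R]%classic).
  apply: nondecreasing_cvg_mu.
  - by move=> n; exact: measurable_itv.
  - by apply: bigcup_measurable => n _; exact: measurable_itv.
  - move=> m n mn; apply/subsetPset => x /=; rewrite !in_itv/= => /andP[h1 h2].
    have mnR : m%:R <= n%:R :> R by rewrite ler_nat.
    by apply/andP; split; lra.
have -> : \bigcup_n `[- n%:R, n%:R]%classic = [set: R].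
  apply/seteqP; split => // x _; have [n xn] : exists n, `|x| < n%:R.
    by exists (Num.trunc `|x|).+1; rewrite truncnS_gt || exact: truncnS_gt.
  by exists n => //=; rewrite in_itv/= -ler_norml ltW.
rewrite N1 => /fine_cvg /= /cvgrPdist_lt/(_ e e0)[n _ /(_ n (leqnn n))] Hn.
exists n.+1%:R => // x nx.
pose I := `[- n%:R, n%:R]%classic : set R.
have mI : measurable (I : set (measurableTypeR R)) by exact: measurable_itv.
set B := (X in N X).
have mB : measurable (B : set (measurableTypeR R)).
  by rewrite /B; case: ifP => _; exact: measurable_itv.
have fin (C : set (measurableTypeR R)) : measurable C -> N C \is a fin_num.
  by move=> mC; exact: fin_num_measure.
have dis : I `&` B = set0.
  apply/seteqP; split => y //=; rewrite /I /B /=.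
  case: ifPn => x0 []; rewrite /= !in_itv/= => /andP[h1 h2].
    by rewrite ?andbT => h3; move: nx; rewrite ger0_norm// -natr1; lra.
  move: x0 nx; rewrite -ltNge => x0; rewrite ltr0_norm// -natr1; lra.
have : (N (I `|` B) <= 1)%E.
  by rewrite -N1; apply: le_measure; rewrite ?inE//; exact: measurableU.
have UE : (N (I `|` B) = N I + N B)%E := measureU (normal_prob 0 sg) mI mB dis.
rewrite UE -[N I]fineK ?fin// -[N B]fineK ?fin// -EFinD lee_fin.
move: Hn; rewrite -/I ltr_norml => /andP[_].
rewrite -[(fine \o _) n]/(fine (N I)) /=.
by move: (fine (N I)) (fine (N B)) => a b; lra.
Qed.

End Gaussian.

Lemma is_derive_homo_le {R : realType} (u du : R -> R) (a b : R) : a <= b ->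
  (forall x : R, is_derive x 1 u (du x)) -> (forall x, a <= x <= b -> 0 <= du x) ->
  u a <= u b.
Proof.
move=> ab Du du0.
have [|c cab uE] := @MVT_segment R u du a b ab (fun x _ => Du x).
- apply: continuous_subspaceT => x; apply: differentiable_continuous.
  by apply/derivable1_diffP; have [] := Du x.
- rewrite -subr_ge0 uE mulr_ge0 ?subr_ge0// du0//.
Qed.

(** * Stein's equation with a bounded continuous right-hand side *)

Section SteinEquation.
Context {R : realType}.
Variables (V : R) (h : R -> R) (B : R).
Hypothesis V0 : 0 < V.
Let N := @normal_prob R 0 (Num.sqrt V).
Let p := normal_pdf 0 (Num.sqrt V).
Let k := normal_peak (Num.sqrt V).
Hypothesis ch : continuous h.
Hypothesis hB : forall x, `|h x| <= B.
Hypothesis h0 : \int[N]_x h x = 0.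

Let k0 : 0 < k. Proof. by apply: normal_peak_gt0; rewrite gt_eqF// sqrtr_gt0. Qed.
Let N1 : N setT = 1%E. Proof. exact: probability_setT. Qed.
Let B0 : 0 <= B. Proof. exact: le_trans (hB 0). Qed.
Let p0 x : 0 < p x. Proof. by rewrite /p gauss_pdfE// mulr_gt0// expR_gt0. Qed.
Let cp : continuous p.
Proof. by apply: continuous_normal_pdf; rewrite gt_eqF// sqrtr_gt0. Qed.

Let bh : bmf (h : measurableTypeR R -> R).
Proof. by split; [exact: continuous_measurable_fun|exists B]. Qed.

Let mle x : measurable (`]-oo, x]%classic : set (measurableTypeR R)).
Proof. exact: measurable_itv. Qed.

Let mgt x : measurable (`]x, +oo[%classic : set (measurableTypeR R)).
Proof. exact: measurable_itv. Qed.

(** The numerator of the solution of [V f' - x f = h]. As [h] has mean zero, it is also minus the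
    integral over the other half-line, which makes it small at both ends. *)
Definition stein_num x := \int[N]_y (\1_`]-oo, x] y * h y).
Let F := stein_num.

Let F_le_low x : `|F x| <= B * fine (N `]-oo, x]).
Proof.
have bi := bmf_indic (mle x).
have -> : fine (N `]-oo, x]) = \int[N]_y (\1_`]-oo, x] y : R).
  by apply: EFin_inj; rewrite (mean_indic N1 (mle x)) fineK// fin_num_measure.
rewrite -(meanZ N1)//; apply: mean_norm_le => //; [exact: bmfM|exact: bmfZ|].
move=> y; rewrite normrM mulrC ler_pM//.
by rewrite ger0_norm// indicE ler0n.
Qed.

Let F_le_high x : `|F x| <= B * fine (N `]x, +oo[).
Proof.
have bi := bmf_indic (mgt x); have bi' := bmf_indic (mle x).
have -> : fine (N `]x, +oo[) = \int[N]_y (\1_`]x, +oo[ y : R).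
  by apply: EFin_inj; rewrite (mean_indic N1 (mgt x)) fineK// fin_num_measure.
have -> : F x = - \int[N]_y (\1_`]x, +oo[ y * h y).
  apply/eqP; rewrite eq_sym eqr_oppLR -addr_eq0 /F /stein_num.
  rewrite -(meanD N1); [|exact: bmfM..].
  rewrite -[X in _ == X]h0; apply/eqP; apply: eq_Rintegral => y _.
  rewrite -mulrDl -[RHS]mul1r; congr (_ * _); rewrite !indicE.
  have -> : (y \in `]-oo, x]%classic) = (y <= x).
    by apply/idP/idP => [/set_mem|yx]; [|apply: mem_set]; rewrite /= in_itv.
  have -> : (y \in `]x, +oo[%classic) = (x < y).
    by apply/idP/idP => [/set_mem|yx]; [|apply: mem_set]; rewrite /= in_itv/= andbT.
  by case: leP; rewrite ?addr0 ?add0r.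
rewrite normrN -(meanZ N1)//; apply: mean_norm_le => //; [exact: bmfM|exact: bmfZ|].
move=> y; rewrite normrM mulrC ler_pM//.
by rewrite ger0_norm// indicE ler0n.
Qed.

Let F_vanish (e : R) : 0 < e -> exists2 K, 0 <= K & forall x, K <= `|x| -> `|F x| <= e.
Proof.
move=> e0; have B10 : 0 < B + 1 by rewrite ltr_wpDl.
have e1 : 0 < e / (B + 1) by rewrite divr_gt0.
have [K K0 HK] := @gauss_tail R V _ e1; exists K => // x Kx.
have := HK x Kx; rewrite ler_pdivlMr// => le.
set m := fine _ in le.
have m0 : 0 <= m by rewrite fine_ge0.
have Fm : `|F x| <= B * m.
  by rewrite /m; case: ifP => _; [exact: F_le_high|exact: F_le_low].
rewrite (le_trans Fm)// (le_trans _ le)// mulrDr mulr1 mulrC lerDl.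
exact: m0.
Qed.

Lemma is_derive_stein_num (x : R) : is_derive x 1 F (h x * p x).
Proof.
have FE y : F y = \int[lebesgue_measure]_(t in `]-oo, y]) (p t * h t).
  rewrite /F /stein_num gauss_mean//; last first.
    by apply: bmfM => //; exact: bmf_indic (mle y).
  rewrite [RHS]Rintegral_mkcond; apply: eq_Rintegral => t _.
  rewrite patchE indicE; case: ifPn => _; rewrite ?mul1r// mul0r mulr0//.
have ip : lebesgue_measure.-integrable setT (EFin \o (fun t => p t * h t)).
  have mp : measurable_fun (setT : set (measurableTypeR R)) p.
    exact: measurable_normal_pdf.
  apply: (density_integrable mp) bh.
  - by move=> t; exact: ltW.
  - exact: integral_normal_pdf.
have [] := @continuous_FTC1 R (fun t => p t * h t) (BInfty _ true) x (x + 1).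
- by rewrite ltrDl.
- by apply: integrableS ip => //; exact: measurable_itv.
- by rewrite ltNyr.
- by apply: continuousM; [exact: cp|exact: ch].
move=> dF F'.
have -> : F = (fun y => \int[lebesgue_measure]_(t in [set` `]-oo, y]]) (p t * h t)).
  by apply/funext.
apply: DeriveDef; first exact: dF.
by rewrite -derive1E F' mulrC.
Qed.

Lemma is_derive_gauss_pdf (x : R) : is_derive x 1 p (- (x / V) * p x).
Proof.
have -> : p = (fun x => k * expR (- (x ^+ 2 / (V + V)))).
  by apply/funext => y; rewrite /p gauss_pdfE.
apply: is_derive_eq.
have V2 : V + V != 0 by rewrite gt_eqF// addr_gt0.
have sE (a b : R) : a *: b = a * b by [].
by rewrite !sE; field; rewrite -mulr2n mulrn_eq0 negb_or /= gt_eqF.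
Qed.

(* Beyond [1] the functions [F - B V p] and [F + B V p] are monotone, since
   [p' = - x p / V], and they vanish at infinity. *)
Let F_bound x : 1 <= `|x| -> `|F x| <= B * V * p x.
Proof.
move=> x1.
have Vneq : V != 0 by rewrite gt_eqF.
have pw c (y : R) : is_derive y 1 (fun z => c * F z - B * V * p z)
    (c * (h y * p y) + B * (y * p y)).
  have DF := is_derive_stein_num y; have Dp := is_derive_gauss_pdf y.
  have D1 : is_derive y 1 (fun z => c * F z) (c * (h y * p y)).
    exact: (@is_deriveZ R R^o R^o F c).
  have D2 : is_derive y 1 (fun z => B * V * p z) (B * V * (- (y / V) * p y)).
    exact: (@is_deriveZ R R^o R^o p (B * V)).
  apply: (is_derive_eq (is_deriveB D1 D2)).
  by field.
have half c : `|c| = 1 -> c * F x <= B * V * p x.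
  move=> c1; rewrite -subr_le0; apply/ler_addgt0Pr => e e0; rewrite add0r.
  have chB y : - B <= c * h y <= B.
    by rewrite -ler_norml normrM c1 mul1r hB.
  have [K K0 HK] := F_vanish e0.
  have small y : K <= `|y| -> c * F y - B * V * p y <= e.
    move=> Ky; rewrite lerBlDr (le_trans (ler_norm _))// normrM c1 mul1r.
    by rewrite (le_trans (HK y Ky))// lerDl !mulr_ge0// ltW.
  have [x0|x0] := leP 0 x.
    move: x1; rewrite ger0_norm// => x1.
    have xm : x <= Num.max x K by rewrite le_max lexx.
    apply: le_trans (small (Num.max x K) _); last first.
      by rewrite ger0_norm ?le_max ?lexx ?orbT// (le_trans x0).
    apply: (is_derive_homo_le xm (pw c)) => y /andP[xy _].
    rewrite mulrA mulrA -mulrDl mulr_ge0 ?(ltW (p0 y))//.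
    have /andP[h1 _] := chB y; have : B <= B * y by rewrite ler_peMr// (le_trans x1).
    lra.
  move: x1; rewrite ltr0_norm// => x1.
  have xm : Num.min x (- K) <= x by rewrite ge_min lexx.
  apply: le_trans (small (Num.min x (- K)) _); last first.
    have m0 : Num.min x (- K) <= 0 by rewrite ge_min ltW.
    by rewrite ler0_norm// lerNr ge_min lexx orbT.
  have := is_derive_homo_le xm (fun y => is_deriveN (pw c y)).
  rewrite lerN2; apply => y /andP[_ xy].
  rewrite -oppr_le0 opprK mulrA mulrA -mulrDl mulr_le0_ge0 ?(ltW (p0 y))//.
  have /andP[_ h1] := chB y; have : B * y <= B * -1 by rewrite ler_wpM2l//; lra.
  lra.
rewrite ler_norml lerNl; apply/andP; split.
  by rewrite -mulN1r half// normrN1.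
by rewrite -[F x]mul1r half// normr1.
Qed.

(** This is [F / (V p)] with the density written out, the solution of [V f' - x f = h]. *)
Let f x := F x * ((V * k)^-1 * expR (x ^+ 2 / (V + V))).

Let f_pE x : F x = V * p x * f x.
Proof.
rewrite /f /p gauss_pdfE// expRN -/k; field.
by rewrite !gt_eqF ?expR_gt0.
Qed.

Let is_derive_f (x : R) : is_derive x 1 f ((h x + x * f x) / V).
Proof.
have V2 : V + V != 0 by rewrite gt_eqF// addr_gt0.
have DF := is_derive_stein_num x.
have DE : is_derive x 1 (fun y => (V * k)^-1 * expR (y ^+ 2 / (V + V)))
   (x / V * ((V * k)^-1 * expR (x ^+ 2 / (V + V)))).
  apply: is_derive_eq.
  have sE (a b : R) : a *: b = a * b by [].
  by rewrite !sE; field; rewrite !gt_eqF// -mulr2n mulrn_wgt0.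
apply: (is_derive_eq (is_deriveM DF DE)).
have sE (a b : R) : a *: b = a * b by [].
rewrite !sE /f /p gauss_pdfE// expRN -/k; field.
by rewrite !gt_eqF ?expR_gt0.
Qed.

Let f_cont : continuous f.
Proof.
move=> x; apply: differentiable_continuous.
by apply/derivable1_diffP; have [] := is_derive_f x.
Qed.

(** Continuity bounds [f] on [[-1, 1]]; beyond, the bound [B V p] on [F] gives [|f| <= B]. *)
Let f_bounded : exists2 C, 0 <= C & forall x, `|f x| <= C.
Proof.
have cf : {within `[-1, 1], continuous (fun x => `|f x|)}.
  apply: continuous_subspaceT => x.
  by apply: continuous_comp; [exact: f_cont|exact: norm_continuous].
have [c _ Hc] : exists2 c, c \in `[(-1)%R, 1%R]%R &
    forall t, t \in `[(-1)%R, 1%R]%R -> `|f t| <= `|f c|.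
  by apply: EVT_max cf; lra.
exists (`|f c| + B) => [|x]; first by rewrite addr_ge0.
have [x1|x1] := leP `|x| 1.
  by rewrite ler_wpDr// Hc// in_itv/= -ler_norml.
rewrite ler_wpDl//; have := F_bound (ltW x1); rewrite f_pE normrM.
have Vp0 : 0 < V * p x by exact: mulr_gt0.
by rewrite (gtr0_norm Vp0) -[B * V * _]mulrA [B * _]mulrC ler_pM2l.
Qed.

(** The exact solution [f] has derivative [(h + x f) / V], which need not vanish at infinity.
    Dividing [f] by [1 + (x / M)^2] forces this and leaves a small multiple of [1 + x^2] as error in
    the equation. *)
Lemma stein_solution (e : R) : 0 < e -> exists G D : R -> R,
  [/\ forall x : R, is_derive x 1 G (D x), continuous D,
      exists C, forall x, `|G x| <= C,
      forall e', 0 < e' -> exists K, forall x, K <= `|x| -> `|D x| <= e' &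
      forall x, `|h x - (V * D x - x * G x)| <= e * (1 + x ^+ 2)].
Proof.
move=> e0; have [C C0 fC] := f_bounded.
pose b := B + V * C + 1.
have VC0 : 0 <= V * C := mulr_ge0 (ltW V0) C0.
have b0 : 0 < b by rewrite /b; move: VC0 B0; lra.
(* From [b <= e M] and [1 <= M], both error coefficients, [V C / M] and [B / M^2], are at most
   [e]. *)
pose M := 1 + b / e.
have be0 : 0 < b / e by rewrite divr_gt0.
have M0 : 0 < M by rewrite addr_gt0.
have Mb : b <= e * M by rewrite mulrDr mulr1 mulrCA divff ?gt_eqF// mulr1 lerDr ltW.
have M1 : 1 <= M by rewrite lerDl ltW.
pose q (x : R) := 1 + (x / M) ^+ 2.
have q1 x : 1 <= q x by rewrite lerDl sqr_ge0.
have q0 x : 0 < q x by exact: lt_le_trans (q1 x).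
have Dq (x : R) : is_derive x 1 (fun y => (q y)^-1) (- (q x) ^- 2 * (2 * x / M ^+ 2)).
  have Dq1 : is_derive x 1 q (2 * x / M ^+ 2).
    apply: is_derive_eq.
    have sE (a c : R) : a *: c = a * c by [].
    by rewrite !sE; field; rewrite gt_eqF.
  by apply: is_deriveV; rewrite gt_eqF.
pose G x := f x * (q x)^-1.
pose D x := (h x + x * f x) / V * (q x)^-1 + f x * (- (q x) ^- 2 * (2 * x / M ^+ 2)).
exists G, D; split.
- move=> x; apply: (is_derive_eq (is_deriveM (is_derive_f x) (Dq x))).
  have sE (a c : R) : a *: c = a * c by [].
  by rewrite !sE /D; ring.
- have cq : continuous q.
    move=> x; apply: differentiable_continuous; apply/derivable1_diffP.
    by rewrite /q.
  have cqV : continuous (fun x => (q x)^-1).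
    by move=> x; apply: continuousV; [rewrite gt_eqF|exact: cq].
  move=> x; rewrite /D.
  apply: cvgD.
    apply: cvgM; last exact: cqV.
    apply: cvgM; last exact: cvg_cst.
    by apply: cvgD; [exact: ch|apply: cvgM; [exact: cvg_id|exact: f_cont]].
  apply: cvgM; first exact: f_cont.
  apply: cvgM.
    apply: cvgN; under eq_fun do rewrite expr2 invfM.
    by rewrite expr2 invfM; apply: cvgM; exact: cqV.
  apply: cvgM; last exact: cvg_cst.
  by apply: cvgM; [exact: cvg_cst|exact: cvg_id].
- exists C => x; rewrite /G normrM -[leRHS]mulr1 ler_pM//.
  by rewrite normfV gtr0_norm// invf_le1.
- move=> e' e'0.
  (* For [|x| >= 1] both [1 / q] and [1 / q^2] are at most [M^2 / x^2], so [m / |x|] bounds the two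
     summands of [D] together. *)
  pose m := (B + C) * M ^+ 2 / V + 2 * C.
  have m0 : 0 <= m.
    apply: addr_ge0; last exact: mulr_ge0.
    apply: mulr_ge0; last by rewrite invr_ge0 ltW.
    by apply: mulr_ge0; [exact: addr_ge0|exact: sqr_ge0].
  exists (1 + m / e') => x Kx.
  have x1 : 1 <= `|x| by rewrite (le_trans _ Kx)// lerDl divr_ge0// ltW.
  have x0 : 0 < `|x| by exact: lt_le_trans x1.
  have qx : (q x)^-1 <= M ^+ 2 / `|x| ^+ 2.
    rewrite -[leRHS]invrK lef_pV2 ?posrE ?invr_gt0 ?divr_gt0 ?exprn_gt0//.
    by rewrite invf_div -normrX ger0_norm ?sqr_ge0// /q expr_div_n lerDr.
  have qq : (q x) ^- 2 <= M ^+ 2 / `|x| ^+ 2.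
    by apply: le_trans qx; rewrite lef_pV2 ?posrE ?exprn_gt0// expr2 ler_peMr// ltW.
  apply: (@le_trans _ _ (m / `|x|)); last first.
    rewrite ler_pdivrMr// mulrC -ler_pdivrMr// (le_trans _ Kx)// lerDr//.
  have -> : m / `|x| = (B + C) * `|x| / V * (M ^+ 2 / `|x| ^+ 2) +
      C * (M ^+ 2 / `|x| ^+ 2 * (2 * `|x| / M ^+ 2)).
    by rewrite /m; field; rewrite !gt_eqF.
  rewrite /D (le_trans (ler_normD _ _))//; apply: lerD.
    rewrite normrM; apply: ler_pM => //; last first.
      by rewrite ger0_norm// invr_ge0 ltW.
    rewrite normrM [ `|V^-1|]gtr0_norm ?invr_gt0// ler_wpM2r ?invr_ge0 ?(ltW V0)//.
    rewrite (le_trans (ler_normD _ _))// mulrDl lerD//.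
      by rewrite (le_trans (hB x))// ler_peMr.
    by rewrite normrM mulrC ler_wpM2r.
  rewrite normrM; apply: ler_pM => //.
  rewrite normrM normrN; apply: ler_pM => //.
    by rewrite ger0_norm// invr_ge0 exprn_ge0// ltW.
  rewrite normrM normrM [ `|2|]ger0_norm// [ `|(M ^+ 2)^-1|]gtr0_norm//.
  by rewrite invr_gt0 exprn_gt0.
- move=> x.
  have -> : h x - (V * D x - x * G x) =
      h x * (1 - (q x)^-1) + V * f x * ((q x) ^- 2 * (2 * x / M ^+ 2)).
    rewrite /D /G; field; rewrite !gt_eqF//=; exact: lt_le_trans M1.
  have T1 : `|1 - (q x)^-1| <= (x / M) ^+ 2.
    have qi : (q x)^-1 <= 1 by rewrite invf_le1.
    rewrite ger0_norm ?subr_ge0//.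
    have -> : 1 - (q x)^-1 = (q x - 1) * (q x)^-1.
      by rewrite mulrBl mul1r divff// gt_eqF.
    by rewrite {1}/q addrC addKr ler_piMr// sqr_ge0.
  have T2 : `|(q x) ^- 2 * (2 * x / M ^+ 2)| <= M^-1.
    rewrite normrM gtr0_norm ?invr_gt0 ?exprn_gt0// ler_pdivrMl ?exprn_gt0//.
    have -> : `|2 * x / M ^+ 2| = 2 * `|x / M| * M^-1.
      rewrite !normrM [ `|2|]ger0_norm// [ `|(M ^+ 2)^-1|]gtr0_norm ?invr_gt0 ?exprn_gt0//.
      rewrite [ `|M^-1|]gtr0_norm ?invr_gt0//; field.
      by rewrite gt_eqF.
    rewrite ler_wpM2r ?invr_ge0 ?(ltW M0)//; apply: (@le_trans _ _ (q x)).
      rewrite /q -(real_normK (num_real (x / M))).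
      have := sqr_ge0 (1 - `|x / M|); rewrite sqrrB expr1n mul1r; lra.
    by rewrite expr2 ler_peMr// ltW.
  rewrite (le_trans (ler_normD _ _))// [leRHS]mulrDr mulr1 addrC; apply: lerD.
    rewrite normrM (@le_trans _ _ (V * C * M^-1))//.
      rewrite ler_pM// normrM gtr0_norm// ler_pM2l//.
    rewrite ler_pdivrMr// (le_trans _ Mb)// /b.
    by move: B0; lra.
  rewrite normrM; apply: (@le_trans _ _ (B * (x / M) ^+ 2)); first by rewrite ler_pM.
  rewrite expr_div_n mulrCA mulrC ler_wpM2r ?sqr_ge0//.
  rewrite ler_pdivrMr ?exprn_gt0// (@le_trans _ _ (e * M))//.
    by rewrite (le_trans _ Mb)// /b; move: VC0; lra.
  by rewrite ler_pM2l// expr2 ler_peMr// ltW.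
Qed.

End SteinEquation.

(** * Normal approximation of sums, and a Slutsky argument *)

Lemma vanishing_bounded {R : realType} (D : R -> R) : continuous D ->
  (forall e, 0 < e -> exists K, forall x, K <= `|x| -> `|D x| <= e) ->
  exists C, forall x, `|D x| <= C.
Proof.
move=> cD D0; have [K HK] := D0 1 ltr01.
have cf : {within `[- `|K|, `|K|], continuous (fun x => `|D x|)}.
  apply: continuous_subspaceT => x.
  by apply: continuous_comp; [exact: cD|exact: norm_continuous].
have [c _ Hc] : exists2 c, c \in `[(- `|K|)%R, `|K|%R]%R &
    forall t, t \in `[(- `|K|)%R, `|K|%R]%R -> `|D t| <= `|D c|.
  by apply: EVT_max cf; rewrite lerNl (le_trans _ (normr_ge0 K))// oppr_le0.
exists (`|D c| + 1) => x; have [xK|xK] := leP `|x| `|K|.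
  by rewrite ler_wpDr// Hc// in_itv/= -ler_norml.
by rewrite ler_wpDl// HK// (le_trans (ler_norm K))// ltW.
Qed.

(** A first-order expansion with a modulus of continuity instead of a second derivative, because [D]
    is only known to be uniformly continuous. *)
Lemma is_derive_increment {R : realType} (G D : R -> R) (x y e dl : R) :
  (forall x : R, is_derive x 1 G (D x)) ->
  (forall x y, `|x - y| < dl -> `|D x - D y| <= e) -> `|y - x| < dl ->
  `|G y - G x - D x * (y - x)| <= e * `|y - x|.
Proof.
move=> DG Dunif yx.
have cG : continuous G.
  move=> z; apply: differentiable_continuous.
  by apply/derivable1_diffP; have [] := DG z.
suff [z zx ->] : exists2 z, `|z - x| <= `|y - x| & G y - G x = D z * (y - x).
  rewrite -mulrBl normrM ler_wpM2r// Dunif//; exact: le_lt_trans yx.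
have [xy|xy] := leP x y.
  have [|z] := @MVT_segment R G D x y xy (fun z _ => DG z).
    exact: continuous_subspaceT.
  rewrite in_itv/= => /andP[xz zy] GE; exists z => //.
  by rewrite !ger0_norm ?subr_ge0// lerD2r.
have [|z] := @MVT_segment R G D y x (ltW xy) (fun z _ => DG z).
  exact: continuous_subspaceT.
rewrite in_itv/= => /andP[yz zx] GE; exists z.
  by rewrite !ler0_norm ?subr_le0 ?(ltW xy)// lerN2 lerD2r.
by rewrite -opprB GE -mulrN opprB.
Qed.

(** Independence enters through the last two hypotheses alone: against functions of the sum without
    it, each [X i] is centred with variance [v]. As [eta] is chosen before [n] and the summands,
    rescaled bounded variables satisfy the smallness condition for large [n]. *)
Lemma normal_approximation {R : realType} (V e : R) (g : R -> R) :
  0 < V -> continuous g -> (exists M, forall x, `|g x| <= M) -> 0 < e ->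
  exists2 eta, 0 < eta & forall (d : measure_display) (Omega : measurableType d)
    (P : probability Omega R) (n : nat) (X : 'I_n -> Omega -> R) (v : R),
  let W w := \sum_(i < n) X i w in
  (forall i, bmf (X i)) -> (forall i w, `|X i w| <= eta) ->
  n%:R * v = V -> \int[P]_w (W w ^+ 2) <= V ->
  (forall i psi, continuous psi -> (exists M, forall x, `|psi x| <= M) ->
    \int[P]_w (X i w * psi (W w - X i w)) = 0) ->
  (forall i psi, continuous psi -> (exists M, forall x, `|psi x| <= M) ->
    \int[P]_w (X i w ^+ 2 * psi (W w - X i w)) = v * \int[P]_w psi (W w - X i w)) ->
  `|\int[P]_w g (W w) - \int[normal_prob 0 (Num.sqrt V)]_x g x| <= e.
Proof.
move=> V0 cg [Mg HMg] e0.
set N := normal_prob 0 (Num.sqrt V); set c := \int[N]_x g x.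
have N1 : N setT = 1%E by exact: probability_setT.
have bg : bmf (g : measurableTypeR R -> R).
  by split; [exact: continuous_measurable_fun|exists Mg].
have bcst : bmf (fun _ : measurableTypeR R => c) by exact: bmf_cst.
pose h x := g x - c.
have ch : continuous h by move=> x; apply: cvgB; [exact: cg|exact: cvg_cst].
have hB x : `|h x| <= Mg + `|c|.
  by rewrite (le_trans (ler_normB _ _))// lerD2r.
have h0 : \int[N]_x h x = 0.
  by rewrite /h (meanB N1)// (mean_cst N1) subrr.
(* One half of [e] pays for the error in Stein's equation, whose mean is at most this constant times
   [1 + V]. The other half covers two errors per summand of size [e / (4 V) * v], with [n v = V]. *)
have e1 : 0 < e / (2 * (1 + V)) by rewrite divr_gt0// mulr_gt0// addr_gt0.
have [G [D [DG cD [CG HCG] D0 GD]]] := stein_solution V0 ch hB h0 e1.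
have e2 : 0 < e / (4 * V) by rewrite divr_gt0// mulr_gt0.
have [dl dl0 Dunif] := vanishing_uniform_continuous cD D0 e2.
have [CD HCD] := vanishing_bounded cD D0.
have cG : continuous G.
  move=> z; apply: differentiable_continuous.
  by apply/derivable1_diffP; have [] := DG z.
exists (dl / 2) => [|d Omega P n X v W bX Xeta nv W2 EX EX2]; first by rewrite divr_gt0.
have P1 : P setT = 1%E by exact: probability_setT.
have bW : bmf W by exact: bmf_sum.
have bWi i : bmf (fun w => W w - X i w) by exact: bmfB.
have bc (psi : R -> R) (Y : Omega -> R) : continuous psi -> (exists M, forall x, `|psi x| <= M) ->
    bmf Y -> bmf (fun w : Omega => psi (Y w)).
  by move=> cpsi bpsi bY; exact: (bmf_comp_cont bY.1 cpsi bpsi).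
have bGW : bmf (fun w => G (W w)) by apply: bc => //; exists CG.
have bDW : bmf (fun w => D (W w)) by apply: bc => //; exists CD.
have bhW : bmf (fun w => h (W w)) by apply: bc => //; exists (Mg + `|c|).
have bgW : bmf (fun w => g (W w)) by apply: bc => //; exists Mg.
have bGWi i : bmf (fun w => G (W w - X i w)) by apply: bc => //; exists CG.
have bDWi i : bmf (fun w => D (W w - X i w)) by apply: bc => //; exists CD.
have Xdl i w : `|X i w| < dl.
  by rewrite (le_lt_trans (Xeta i w))// ltr_pdivrMr// ltr_pMr// ltr1n.
have n0 : (0 < n)%N.
  by rewrite lt0n; apply/eqP => n0; move: nv V0; rewrite n0 mul0r => <-; rewrite ltxx.
have v0 : 0 <= v by rewrite -(@pmulr_rge0 _ n%:R) ?ltr0n// nv ltW.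
have EX2v i : \int[P]_w (X i w ^+ 2) = v.
  have c1 : continuous (fun _ : R => 1 : R) by move=> x; exact: cvg_cst.
  have b1 : exists M, forall x : R, `|1 : R| <= M by exists 1 => _; rewrite normr1.
  have := EX2 i (fun=> 1) c1 b1.
  rewrite mean_cst// mulr1 => <-.
  by apply: eq_Rintegral => w _; rewrite mulr1.
have term i : `|\int[P]_w (X i w * G (W w)) - v * \int[P]_w D (W w)| <=
    2 * (e / (4 * V)) * v.
  (* Expansion around the sum without [X i]: the term of order zero has mean zero, and the linear
     one has mean [v] times that of [D]. *)
  have -> : \int[P]_w (X i w * G (W w)) = v * \int[P]_w D (W w - X i w) +
      \int[P]_w (X i w * (G (W w) - G (W w - X i w) - D (W w - X i w) * X i w)).
    rewrite -EX2//; last by exists CD.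
    rewrite -(meanD P1); [|by apply: bmfM => //; exact: bmfX|].
      rewrite -[LHS]subr0 -[X in _ - X](EX i G cG); last by exists CG.
      rewrite -(meanB P1); [|exact: bmfM..].
      by apply: eq_Rintegral => w _; ring.
    by apply: bmfM => //; apply: bmfB; [exact: bmfB|exact: bmfM].
  have R1 : `|\int[P]_w (X i w * (G (W w) - G (W w - X i w) - D (W w - X i w) * X i w))|
      <= e / (4 * V) * v.
    rewrite -(EX2v i) -(meanZ P1); last exact: bmfX.
    apply: (mean_norm_le P1).
    - by apply: bmfM => //; apply: bmfB; [exact: bmfB|exact: bmfM].
    - by apply: bmfZ; exact: bmfX.
    move=> w; have := @is_derive_increment R G D (W w - X i w) (W w) _ dl DG Dunif.
    rewrite opprB addrC subrK normrM => /(_ (Xdl i w)) H.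
    rewrite -(real_normK (num_real (X i w))) expr2 mulrCA ler_wpM2l//.
  have R2 : `|\int[P]_w D (W w - X i w) - \int[P]_w D (W w)| <= e / (4 * V).
    rewrite -(meanB P1)//; apply: (mean_norm_bound P1); first exact: bmfB.
    move=> w; apply: Dunif.
    by rewrite addrAC subrr sub0r normrN.
  have -> : forall a b c' r : R, a * b + r - a * c' = a * (b - c') + r by move=> *; ring.
  rewrite (le_trans (ler_normD _ _))// -mulrA mulr2n mulrDl mul1r lerD//.
  by rewrite normrM ger0_norm// mulrC ler_wpM2r.
have total : `|\int[P]_w (W w * G (W w)) - V * \int[P]_w D (W w)| <= e / 2.
  have -> : \int[P]_w (W w * G (W w)) = \sum_(i < n) \int[P]_w (X i w * G (W w)).
    rewrite -(mean_sum P1) => [|i]; last exact: bmfM.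
    by apply: eq_Rintegral => w _; rewrite mulr_suml.
  have -> : V * \int[P]_w D (W w) = \sum_(i < n) v * \int[P]_w D (W w).
    by rewrite sumr_const card_ord -mulr_natl mulrA nv.
  rewrite -sumrB (le_trans (ler_norm_sum _ _ _))//.
  apply: (@le_trans _ _ (\sum_(i < n) 2 * (e / (4 * V)) * v)); first exact: ler_sum.
  rewrite sumr_const card_ord -[leLHS]mulr_natl.
  have -> : n%:R * (2 * (e / (4 * V)) * v) = 2 * (e / (4 * V)) * (n%:R * v) by ring.
  rewrite nv; have -> : 2 * (e / (4 * V)) * V = e / 2 by field; rewrite gt_eqF.
  exact: lexx.
have -> : \int[P]_w g (W w) - c = \int[P]_w h (W w).
  by rewrite /h (meanB P1) ?mean_cst//; exact: bmf_cst.
have bR : bmf (fun w => h (W w) - (V * D (W w) - W w * G (W w))).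
  by apply: bmfB => //; apply: bmfB; [exact: bmfZ|exact: bmfM].
have -> : \int[P]_w h (W w) =
    \int[P]_w (h (W w) - (V * D (W w) - W w * G (W w))) -
    (\int[P]_w (W w * G (W w)) - V * \int[P]_w D (W w)).
  rewrite -(meanZ P1)// -(meanB P1); [|exact: bmfM|exact: bmfZ].
  rewrite -(meanB P1)//; last by apply: bmfB; [exact: bmfM|exact: bmfZ].
  by apply: eq_Rintegral => w _; ring.
rewrite (le_trans (ler_normB _ _))// [leRHS]splitr lerD//.
have b1W : bmf (fun w => 1 + W w ^+ 2) by apply: bmfD; [exact: bmf_cst|exact: bmfX].
apply: (@le_trans _ _ (\int[P]_w (e / (2 * (1 + V)) * (1 + W w ^+ 2)))).
  by apply: (mean_norm_le P1) => // ; exact: bmfZ.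
rewrite (meanZ P1)// (meanD P1); [|exact: bmf_cst|exact: bmfX].
rewrite mean_cst//; apply: (@le_trans _ _ (e / (2 * (1 + V)) * (1 + V))).
  by rewrite ler_pM2l// lerD2l.
have -> : e / (2 * (1 + V)) * (1 + V) = e / 2 by field; rewrite gt_eqF// addr_gt0.
exact: lexx.
Qed.

(** The truncation [min 1 |.|] is subadditive, so that bounds for the separate remainder terms can
    be added. *)
Lemma truncated_sum {R : realType} (I : Type) (r : seq I) (F G : I -> R) :
  (forall i, Num.min 1 `|F i| <= G i) ->
  Num.min 1 `|\sum_(i <- r) F i| <= \sum_(i <- r) G i.
Proof.
move=> FG; apply: (big_ind2 (fun x y : R => Num.min 1 `|x| <= y)) => //.
  by rewrite normr0 ge_min lexx orbT.
move=> x1 y1 x2 y2; have := ler_normD x1 x2.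
have := normr_ge0 x1; have := normr_ge0 x2.
have := normr_ge0 (x1 + x2).
by rewrite !minEle; case: ifP; case: ifP; case: ifP; lra.
Qed.

(** Uniform continuity makes [|g Z - g W|] small unless [|W| > K] or [|Z - W| >= d2]. These cases
    are charged to [W^2 / K^2] and, as [d2 <= 1], to [U / d2]; thus [Z - W] may lack moments. *)
Lemma slutsky {R : realType} {d} {Omega : measurableType d}
    (P : probability Omega R) (g : R -> R) (V2 e : R) :
  continuous g -> (exists M, forall x, `|g x| <= M) -> 0 <= V2 -> 0 < e ->
  exists2 dl, 0 < dl & forall Z W U : Omega -> R,
    measurable_fun setT Z -> bmf W -> bmf U -> (forall w, 0 <= U w) ->
    \int[P]_w (W w ^+ 2) <= V2 -> \int[P]_w U w <= dl ->
    P.-negligible [set w | ~ (Num.min 1 `|Z w - W w| <= U w)] ->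
    `|\int[P]_w g (Z w) - \int[P]_w g (W w)| <= e.
Proof.
move=> cg [M' HM'] V20 e0.
have P1 : P setT = 1%E by exact: probability_setT.
pose M := `|M'| + 1.
have M0 : 0 < M by rewrite ltr_wpDl.
have HM x : `|g x| <= M by rewrite (le_trans (HM' x))// ler_wpDr// ler_norm.
have e3 : 0 < e / 3 by rewrite divr_gt0.
(* Since [K <= K^2], this makes the contribution [2 M V2 / K^2] of large [W] at most [e / 3]. *)
pose K := 1 + 6 * M * V2 / e.
have KE : 0 <= 6 * M * V2 / e by rewrite divr_ge0 ?mulr_ge0 ?(ltW e0)// ltW.
have K1 : 1 <= K by rewrite lerDl.
have K0 : 0 < K by exact: lt_le_trans K1.
have KV : 2 * M * V2 / K ^+ 2 <= e / 3.
  rewrite ler_pdivrMr ?exprn_gt0//; apply: (@le_trans _ _ (e / 3 * K)).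
    have -> : e / 3 * K = e / 3 + 2 * M * V2 by rewrite /K; field; rewrite gt_eqF.
    by rewrite lerDr ltW.
  by rewrite ler_pM2l// expr2 ler_peMr// ltW.
have [d1 d10 Hd1] := heine K cg e3.
pose d2 := Num.min d1 1.
have d20 : 0 < d2 by rewrite lt_min d10 ltr01.
exists (e / 3 * d2 / (2 * M)) => [|Z W U mZ bW bU U0 W2 EU negl].
  by rewrite divr_gt0 ?mulr_gt0.
have [N [mN N0 subN]] := negl.
(* On the exceptional null set [Z] is replaced by [W], so that the pointwise estimate holds
   everywhere. *)
pose Z' w := if w \in N then W w else Z w.
have bgZ' : bmf (fun w => g (Z' w)).
  have mZ' : measurable_fun setT Z'.
    apply: measurable_fun_ifT => //; last exact: bW.1.
    apply: (measurable_fun_bool true) => /=.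
    rewrite setTI (_ : _ @^-1` _ = N)//.
    by apply/seteqP; split => w /= wN; [exact: set_mem|exact: mem_set].
  by apply: (bmf_comp_cont mZ' cg); exists M.
have bgW : bmf (fun w => g (W w)) by apply: (bmf_comp_cont bW.1 cg); exists M.
have -> : \int[P]_w g (Z w) = \int[P]_w g (Z' w).
  apply: (Rintegral_eq_off_null mN N0) => w nNw.
  by rewrite /Z' memNset.
rewrite -(meanB P1)//.
have bc c : bmf (fun _ : Omega => c : R) by exact: bmf_cst.
have b1 : bmf (fun w => 2 * M / K ^+ 2 * W w ^+ 2) by apply: bmfZ; exact: bmfX.
have b2 : bmf (fun w => 2 * M / d2 * U w) by exact: bmfZ.
apply: (@le_trans _ _ (\int[P]_w (e / 3 + (2 * M / K ^+ 2 * W w ^+ 2 + 2 * M / d2 * U w)))).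
  apply: (mean_norm_le P1); [exact: bmfB|by apply: bmfD => //; exact: bmfD|].
  move=> w.
  have t1 : 0 <= 2 * M / K ^+ 2 * W w ^+ 2.
    by rewrite mulr_ge0 ?sqr_ge0// divr_ge0 ?sqr_ge0// mulr_ge0// ltW.
  have t2 : 0 <= 2 * M / d2 * U w.
    by rewrite mulr_ge0// divr_ge0 ?(ltW d20)// mulr_ge0// ltW.
  have big2M : `|g (Z' w) - g (W w)| <= 2 * M.
    by rewrite (le_trans (ler_normB _ _))// mulr_natl mulr2n lerD.
  rewrite /Z' in big2M *; have [wN|wN] := boolP (w \in N).
    by rewrite subrr normr0 !addr_ge0// ltW.
  rewrite (negbTE wN) in big2M; rewrite distrC in big2M *.
  have UZ : Num.min 1 `|Z w - W w| <= U w.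
    by apply: contrapT => nU; move: wN; rewrite notin_setE; apply; exact: subN.
  have [WK|WK] := leP `|W w| K; last first.
    rewrite (le_trans big2M)//.
    have : 2 * M <= 2 * M / K ^+ 2 * W w ^+ 2.
      rewrite -mulrA ler_peMr ?mulr_ge0 ?(ltW M0)// mulrC ler_pdivlMr ?exprn_gt0//.
      rewrite mul1r -(real_normK (num_real (W w))) ler_pXn2r ?nnegrE// ?ltW//.
    lra.
  have [ZW|ZW] := ltP `|W w - Z w| d2.
    have := Hd1 (W w) (Z w) WK; rewrite (lt_le_trans ZW) ?ge_min ?lexx// => /(_ isT).
    lra.
  rewrite (le_trans big2M)//.
  have : 2 * M <= 2 * M / d2 * U w.
    rewrite -mulrA ler_peMr ?mulr_ge0 ?(ltW M0)// mulrC ler_pdivlMr// mul1r.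
    apply: le_trans UZ; rewrite le_min distrC ZW andbT /d2 ge_min lexx orbT//.
  lra.
rewrite (meanD P1)//; last exact: bmfD.
rewrite (meanD P1)// (mean_cst P1) (meanZ P1) ?(meanZ P1)//; last exact: bmfX.
have h1 : 2 * M / K ^+ 2 * \int[P]_w W w ^+ 2 <= e / 3.
  apply: le_trans KV; rewrite mulrAC ler_wpM2r ?invr_ge0 ?sqr_ge0//.
  by rewrite ler_wpM2l// mulr_ge0// ltW.
have h2 : 2 * M / d2 * \int[P]_w U w <= e / 3.
  apply: (@le_trans _ _ (2 * M / d2 * (e / 3 * d2 / (2 * M)))).
    by rewrite ler_wpM2l// divr_ge0 ?(ltW d20)// mulr_ge0// ltW.
  have -> : 2 * M / d2 * (e / 3 * d2 / (2 * M)) = e / 3 by field; rewrite !gt_eqF.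
  exact: lexx.
by move: h1 h2; lra.
Qed.

(** * Independent trajectories: from the rectangle law to means of products *)

Section IndependentTrajectories.
Context {R : realType} {dA : measure_display} {A : measurableType dA}
  {S : finType} {dO : measure_display} {Omega : measurableType dO}.
Variables (T : nat) (P : probability Omega R) (Ex : @trajfun R dA A S -> R) (K : R)
  (sD : nat -> nat -> Omega -> S) (aD : nat -> nat -> Omega -> A)
  (rD : nat -> nat -> Omega -> R).
Hypothesis ExD : forall f g, comb T f -> comb T g ->
  Ex (fun hs ha hr => f hs ha hr + g hs ha hr) = Ex f + Ex g.
Hypothesis ExZ : forall c f, comb T f ->
  Ex (fun hs ha hr => c * f hs ha hr) = c * Ex f.
Hypothesis ExB : forall f (b : R), comb T f ->
  (forall hs ha hr, `|f hs ha hr| <= b) -> `|Ex f| <= K * b.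
Hypothesis msD : forall i t s, measurable [set w | sD i t w = s].
Hypothesis maD : forall i t, measurable_fun setT (aD i t).
Hypothesis mrD : forall i t, measurable_fun setT (rD i t).
Hypothesis law : forall (n : nat) (BS : nat -> nat -> set S)
    (BA : nat -> nat -> set A) (BR : nat -> nat -> set R),
  (forall i t, measurable (BA i t) /\ measurable (BR i t)) ->
  P [set w | forall i, (i < n)%N -> forall t, (t <= T)%N ->
       BS i t (sD i t w) /\ BA i t (aD i t w) /\ BR i t (rD i t w)]
  = (\prod_(i < n) Ex (rect T (BS i) (BA i) (BR i)))%:E.
Implicit Types u v : @trajfun R dA A S.

Definition at_traj u i w := u (fun t => sD i t w) (fun t => aD i t w) (fun t => rD i t w).

Let P1 : P setT = 1%E. Proof. exact: probability_setT. Qed.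

Lemma bmf_at_traj u i : comb T u -> bmf (at_traj u i).
Proof.
by move=> cu; apply: (@comb_bmf _ _ _ _ _ _ _ (sD i) (aD i) (rD i)) cu.
Qed.

Definition rect_event i (BS : nat -> set S) (BA : nat -> set A) (BR : nat -> set R) :=
  [set w | forall t, (t <= T)%N ->
     BS t (sD i t w) /\ BA t (aD i t w) /\ BR t (rD i t w)].

Lemma at_traj_rect i BS BA BR :
  at_traj (rect T BS BA BR) i = \1_(rect_event i BS BA BR).
Proof.
apply/funext => w; rewrite /at_traj /rect.
have [wE|wE] := pselect (rect_event i BS BA BR w).
  rewrite [RHS]indicE mem_set// big1// => t _.
  have [h1 [h2 h3]] := wE t (ltn_ord t).
  by rewrite !indicE !mem_set// !mulr1.
rewrite [RHS]indicE memNset//.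
have [t tT ne] : exists2 t, (t <= T)%N &
    ~ (BS t (sD i t w) /\ BA t (aD i t w) /\ BR t (rD i t w)).
  apply: contrapT => h; apply: wE => t tT; apply: contrapT => ne.
  by apply: h; exists t.
rewrite (bigD1 (Ordinal (tT : (t < T.+1)%N)))//= !indicE.
have [h1|h1] := boolP (_ \in BS t); last by rewrite !mul0r.
have [h2|h2] := boolP (_ \in BA t); last by rewrite mulr0 !mul0r.
have [h3|h3] := boolP (_ \in BR t); last by rewrite mulr0 !mul0r.
by exfalso; apply: ne; rewrite !inE in h1 h2 h3.
Qed.

Lemma measurable_rect_event i BS BA BR :
  (forall t, measurable (BA t)) -> (forall t, measurable (BR t)) ->
  measurable (rect_event i BS BA BR).
Proof.
move=> mBA mBR.
rewrite (_ : rect_event i BS BA BR = \bigcap_(t in [set t | (t <= T)%N])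
  (\bigcup_(s in BS t) [set w | sD i t w = s] `&` aD i t @^-1` BA t `&`
    rD i t @^-1` BR t)).
  apply: bigcap_measurable => [|t _]; first by exists 0.
  apply: measurableI; last by rewrite -[X in measurable X]setTI; exact: mrD.
  apply: measurableI; last by rewrite -[X in measurable X]setTI; exact: maD.
  by apply: fin_bigcup_measurable => // ; exact: finite_finset.
apply/seteqP; split => w.
  by move=> H t /= tT; have [h1 [h2 h3]] := H t tT; split=> //; split=> //;
    exists (sD i t w).
by move=> H t tT; have [[[s h1 /= ->] h2] h3] := H t tT.
Qed.

Lemma Ex_full : Ex (rect T (fun=> setT) (fun=> setT) (fun=> setT)) = 1.
Proof.
have := @law 1 (fun _ _ => setT) (fun _ _ => setT) (fun _ _ => setT) (fun _ _ => conj measurableT measurableT).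
rewrite big_ord1 (_ : [set w | _] = setT); first by rewrite P1 => -[].
by apply/seteqP; split.
Qed.

Definition others_event n i (BS : nat -> nat -> set S) (BA : nat -> nat -> set A)
    (BR : nat -> nat -> set R) :=
  [set w | forall j, (j < n)%N -> j != i -> rect_event j (BS j) (BA j) (BR j) w].

Lemma prob_rect_others n i BS BA BR BS' BA' BR' : (i < n)%N ->
  (forall t, measurable (BA t)) -> (forall t, measurable (BR t)) ->
  (forall j t, measurable (BA' j t) /\ measurable (BR' j t)) ->
  P (others_event n i BS' BA' BR' `&` rect_event i BS BA BR) =
  ((\prod_(j < n | j != i :> nat) Ex (rect T (BS' j) (BA' j) (BR' j))) *
     Ex (rect T BS BA BR))%:E.
Proof.
move=> iN mBA mBR mB'.
have mU j t : measurable (upd BA' i BA j t) /\ measurable (upd BR' i BR j t).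
  have [->|ji] := eqVneq j i; first by rewrite !updE.
  by rewrite !upd_neq.
have -> : (\prod_(j < n | j != i :> nat) Ex (rect T (BS' j) (BA' j) (BR' j))) *
    Ex (rect T BS BA BR) =
    \prod_(j < n) Ex (rect T (upd BS' i BS j) (upd BA' i BA j) (upd BR' i BR j)).
  rewrite [RHS](bigD1 (Ordinal iN))//= !updE mulrC; congr (_ * _).
  by apply: eq_big => j; [rewrite -val_eqE|move=> ji; rewrite !upd_neq].
rewrite -(law n (upd BS' i BS) mU).
congr (P _); apply/seteqP; split => w.
  move=> [H1 H2] j jn; have [->|ji] := eqVneq j i; first by rewrite !updE.
  by rewrite !upd_neq//; exact: H1.
move=> H; split => [j jn ji|]; last by have := H i iN; rewrite !updE.
by have := H j jn; rewrite !upd_neq.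
Qed.

Let measT : forall j t : nat, measurable (setT : set A) /\ measurable (setT : set R).
Proof. by []. Qed.

Lemma prob_rect i BS BA BR :
  (forall t, measurable (BA t)) -> (forall t, measurable (BR t)) ->
  P (rect_event i BS BA BR) = (Ex (rect T BS BA BR))%:E.
Proof.
move=> mBA mBR; have := @prob_rect_others i.+1 i BS BA BR
  (fun _ _ => setT) (fun _ _ => setT) (fun _ _ => setT) (ltnSn i) mBA mBR measT.
rewrite big1 ?mul1r => [|j _]; last exact: Ex_full.
by rewrite (_ : others_event _ _ _ _ _ = setT) ?setTI//; apply/seteqP; split.
Qed.

Lemma prob_others n i BS BA BR : (i < n)%N ->
  (forall j t, measurable (BA j t) /\ measurable (BR j t)) ->
  P (others_event n i BS BA BR) =
  (\prod_(j < n | j != i :> nat) Ex (rect T (BS j) (BA j) (BR j)))%:E.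
Proof.
move=> iN mB; have := @prob_rect_others n i (fun=> setT) (fun=> setT) (fun=> setT)
  BS BA BR iN (fun=> measurableT) (fun=> measurableT) mB.
rewrite Ex_full mulr1 (_ : rect_event _ _ _ _ = setT) ?setIT//.
by apply/seteqP; split.
Qed.

(** A pi-system generating the events that concern the trajectories below [n] other than [i]. *)
Definition others_system n i : set (set Omega) := [set B | exists BS BA BR,
  (forall j t, measurable (BA j t) /\ measurable (BR j t)) /\
  B = others_event n i BS BA BR].

Lemma others_system_measurable n i : others_system n i `<=` measurable.
Proof.
move=> _ [BS [BA [BR [mB ->]]]].
rewrite (_ : others_event n i BS BA BR =
  \bigcap_(j in [set j | (j < n)%N /\ j != i]) rect_event j (BS j) (BA j) (BR j)).
  have [->|ne] := eqVneq [set j | (j < n)%N /\ j != i] set0.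
    by rewrite bigcap_set0.
  apply: bigcap_measurable => [|j _]; first exact/set0P.
  by apply: measurable_rect_event => t; have [] := mB j t.
by apply/seteqP; split=> w H j; [case=> ? ?; exact: H|move=> ? ?; exact: H].
Qed.

Lemma others_system_setI n i : setI_closed (others_system n i).
Proof.
move=> _ _ [BS [BA [BR [mB ->]]]] [BS' [BA' [BR' [mB' ->]]]].
exists (fun j t => BS j t `&` BS' j t), (fun j t => BA j t `&` BA' j t),
  (fun j t => BR j t `&` BR' j t); split.
  by move=> j t; have [? ?] := mB j t; have [? ?] := mB' j t; split; exact: measurableI.
apply/seteqP; split=> w.
  move=> [H H'] j jn ji t tT; have [? [? ?]] := H j jn ji t tT.
  by have [? [? ?]] := H' j jn ji t tT; do 2?split.
by move=> H; split=> j jn ji t tT; have [[? ?] [[? ?] [? ?]]] := H j jn ji t tT.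
Qed.

Lemma others_system_setT n i : others_system n i setT.
Proof.
exists (fun _ _ => setT), (fun _ _ => setT), (fun _ _ => setT); split=> //.
by apply/seteqP; split.
Qed.

Let sigma_measurable n i : <<s others_system n i >> `<=` measurable.
Proof.
exact: smallest_sub (@sigma_algebra_measurable _ Omega) (@others_system_measurable n i).
Qed.

(** Restricting [P] to the event of trajectory [i], and scaling [P] by its probability, give two
    finite measures that agree on the generating pi-system. *)
Lemma indep_rect n i BS BA BR B : (i < n)%N ->
  (forall t, measurable (BA t)) -> (forall t, measurable (BR t)) ->
  <<s others_system n i >> B ->
  P (B `&` rect_event i BS BA BR) = (P (rect_event i BS BA BR) * P B)%E.
Proof.
move=> iN mBA mBR sB; have mR := @measurable_rect_event i BS BA BR mBA mBR.
have PE : P (rect_event i BS BA BR) = (fine (P (rect_event i BS BA BR)))%:E.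
  by rewrite fineK// fin_num_measure.
have p0 : 0 <= fine (P (rect_event i BS BA BR)) by rewrite fine_ge0.
pose m1 := mrestr P mR; pose m2 := mscale (NngNum p0) P.
rewrite PE.
rewrite -[LHS]/(m1 B) -[RHS]/(m2 B).
apply: (g_sigma_algebra_measure_unique (others_system n i)
  (@others_system_measurable n i) (fun=> setT) _ _ _ _ _) => //.
- by move=> _; exact: others_system_setT.
- by apply/seteqP; split=> // w _; exists 0.
- exact: others_system_setI.
- move=> _ [BS' [BA' [BR' [mB' ->]]]].
  rewrite -[RHS]/((fine (P (rect_event i BS BA BR)))%:E *
    P (others_event n i BS' BA' BR'))%E -PE.
  rewrite -[LHS]/(P (others_event n i BS' BA' BR' `&` rect_event i BS BA BR)).
  rewrite prob_rect_others// prob_others//.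
  by rewrite prob_rect// -EFinM mulrC.
- move=> _; rewrite -[X in (X < _)%E]/(P (setT `&` rect_event i BS BA BR)).
  by rewrite setTI PE ltry.
Qed.

Lemma indic_mean (B : set Omega) : measurable B ->
  (\int[P]_w (\1_B w : R))%:E = P B.
Proof. exact: mean_indic. Qed.

(** Both sides are linear and bounded on [comb], and the law of the data makes them agree on
    rectangles. *)
Lemma mean_at_traj u i : comb T u -> \int[P]_w at_traj u i w = Ex u.
Proof.
move=> cu; apply/eqP; rewrite -subr_eq0; apply/eqP.
apply: (comb_vanish (L := fun u => \int[P]_w at_traj u i w - Ex u)
  (K := 1 + K) _ _ _ _ cu).
- move=> f g cf cg; rewrite ExD//.
  have bf := bmf_at_traj i cf; have bg := bmf_at_traj i cg.
  by rewrite -/(at_traj _ _) (meanD P1 bf bg); ring.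
- move=> c f cf; rewrite ExZ// mulrBr; congr (_ - _).
  exact: (meanZ P1 c (bmf_at_traj i cf)).
- move=> f b cf fb; rewrite (le_trans (ler_normB _ _))// mulrDl mul1r.
  apply: lerD; last exact: ExB.
  by apply: mean_norm_bound => [//||w]; [exact: bmf_at_traj|exact: fb].
- move=> BS BA BR mBA mBR; apply/eqP; rewrite subr_eq0; apply/eqP.
  have := prob_rect i BS mBA mBR; rewrite -indic_mean; last exact: measurable_rect_event.
  by rewrite at_traj_rect => -[].
Qed.

Lemma mean_at_traj_indic n i u B : (i < n)%N -> comb T u ->
  <<s others_system n i >> B ->
  \int[P]_w (at_traj u i w * \1_B w) =
  (\int[P]_w at_traj u i w) * \int[P]_w (\1_B w : R).
Proof.
move=> iN cu sB; have mB := sigma_measurable sB.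
have bB : bmf (\1_B : Omega -> R) := bmf_indic mB.
apply/eqP; rewrite -subr_eq0; apply/eqP.
apply: (comb_vanish (L := fun u => \int[P]_w (at_traj u i w * \1_B w) -
  (\int[P]_w at_traj u i w) * \int[P]_w (\1_B w : R)) (K := 2) _ _ _ _ cu).
- move=> f g cf cg.
  have bf := bmf_at_traj i cf; have bg := bmf_at_traj i cg.
  rewrite (meanD P1 bf bg) (_ : \int[P]_w _ = \int[P]_w (at_traj f i w * \1_B w) +
    \int[P]_w (at_traj g i w * \1_B w)); first by ring.
  rewrite -meanD//; [|exact: bmfM..].
  by apply: eq_Rintegral => w _; rewrite /at_traj mulrDl.
- move=> c f cf; have bf := bmf_at_traj i cf.
  rewrite (meanZ P1 c bf) (_ : \int[P]_w _ = c * \int[P]_w (at_traj f i w * \1_B w)).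
    by ring.
  rewrite -meanZ//; last exact: bmfM.
  by apply: eq_Rintegral => w _; rewrite /at_traj mulrA.
- move=> f b cf fb; have bf := bmf_at_traj i cf.
  have le1 w : `|\1_B w : R| <= 1.
    by rewrite indicE; case: (_ \in _); rewrite ?normr1// normr0.
  rewrite (le_trans (ler_normB _ _))// mulr_natl mulr2n; apply: lerD.
    apply: mean_norm_bound => //; first exact: bmfM.
    by move=> w; rewrite normrM -[leRHS]mulr1 ler_pM// fb.
  rewrite normrM -[leRHS]mulr1 ler_pM//.
    exact: (mean_norm_bound P1 bf (fun w => fb _ _ _)).
  exact: (mean_norm_bound P1 bB le1).
- move=> BS BA BR mBA mBR; apply/eqP; rewrite subr_eq0; apply/eqP.
  have mR := @measurable_rect_event i BS BA BR mBA mBR.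
  apply: EFin_inj; rewrite at_traj_rect EFinM !indic_mean//.
  rewrite -(@indep_rect n i BS BA BR B iN mBA mBR sB) -indic_mean; last exact: measurableI.
  by congr EFin; apply: eq_Rintegral => w _; rewrite indicI/= mulrC.
Qed.

(** Second half of the extension of independence: with [u] already general, events of the other
    trajectories are replaced by bounded functions measurable for the sigma-algebra they
    generate. *)
Lemma mean_at_traj_others n i u (g : Omega -> R) : (i < n)%N -> comb T u ->
  bmf (g : g_sigma_algebraType (others_system n i) -> R) ->
  bmf g /\
  \int[P]_w (at_traj u i w * g w) = Ex u * \int[P]_w g w.
Proof.
move=> iN cu bg.
have bmf_sub (f : g_sigma_algebraType (others_system n i) -> R) :
    bmf f -> bmf (f : Omega -> R).
  move=> [mf Mf]; split=> // mT Y mY; apply: sigma_measurable.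
  exact: mf.
split; first exact: bmf_sub.
have bu := bmf_at_traj i cu.
rewrite -(mean_at_traj i cu).
apply/eqP; rewrite -subr_eq0; apply/eqP; have [M HM] := bu.2.
apply: (linear_bounded_vanish (X := g_sigma_algebraType (others_system n i))
  (L := fun g : Omega -> R => \int[P]_w (at_traj u i w * g w) -
  (\int[P]_w at_traj u i w) * \int[P]_w g w) (K := M + M) _ _ _ _ bg).
- move=> f h bf bh; have {}bf := bmf_sub _ bf; have {}bh := bmf_sub _ bh.
  rewrite (meanD P1 bf bh) (_ : \int[P]_w _ = \int[P]_w (at_traj u i w * f w) +
    \int[P]_w (at_traj u i w * h w)); first by ring.
  rewrite -meanD//; [|exact: bmfM..].
  by apply: eq_Rintegral => w _; rewrite mulrDr.
- move=> c f bf; have {}bf := bmf_sub _ bf.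
  rewrite (meanZ P1 c bf) (_ : \int[P]_w _ = c * \int[P]_w (at_traj u i w * f w)).
    by ring.
  rewrite -meanZ//; last exact: bmfM.
  by apply: eq_Rintegral => w _; rewrite mulrCA.
- move=> f b bf fb; have {}bf := bmf_sub _ bf.
  rewrite (le_trans (ler_normB _ _))// mulrDl; apply: lerD.
    apply: mean_norm_bound => //; first exact: bmfM.
    by move=> w; rewrite normrM ler_pM// fb.
  rewrite normrM ler_pM//; first exact: (mean_norm_bound P1 bu HM).
  exact: (mean_norm_bound P1 bf fb).
- by move=> B sB; rewrite (mean_at_traj_indic iN cu sB) subrr.
Qed.

Lemma bmf_others n i j u : (j < n)%N -> j != i -> comb T u ->
  bmf (at_traj u j : g_sigma_algebraType (others_system n i) -> R).
Proof.
move=> jn ji cu.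
apply: (@comb_bmf _ _ _ _ _ _ (g_sigma_algebraType (others_system n i))
  (sD j) (aD j) (rD j)) cu => t tT.
- move=> s; apply: sub_sigma_algebra.
  exists (upd (fun _ _ => setT) j (upd (fun=> setT) t [set s])), (fun _ _ => setT),
    (fun _ _ => setT); split=> //.
  apply/seteqP; split=> w.
    move=> /= e k kn ki q qT; split=> //.
    have [->|kj] := eqVneq k j; last by rewrite upd_neq.
    by rewrite updE; have [->|qt] := eqVneq q t; rewrite ?updE// upd_neq.
  by move=> /(_ j jn ji t tT)[]; rewrite !updE.
- move=> _ B mB; rewrite setTI; apply: sub_sigma_algebra.
  exists (fun _ _ => setT), (upd (fun _ _ => setT) j (upd (fun=> setT) t B)),
    (fun _ _ => setT); split.
    move=> k q; split=> //; have [->|kj] := eqVneq k j; last by rewrite upd_neq.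
    by rewrite updE; have [->|qt] := eqVneq q t; rewrite ?updE// upd_neq.
  apply/seteqP; split=> w.
    move=> /= e k kn ki q qT; split=> //; split=> //.
    have [->|kj] := eqVneq k j; last by rewrite upd_neq.
    by rewrite updE; have [->|qt] := eqVneq q t; rewrite ?updE// upd_neq.
  by move=> /(_ j jn ji t tT)[_ []]; rewrite !updE.
- move=> _ B mB; rewrite setTI; apply: sub_sigma_algebra.
  exists (fun _ _ => setT), (fun _ _ => setT),
    (upd (fun _ _ => setT) j (upd (fun=> setT) t B)); split.
    move=> k q; split=> //; have [->|kj] := eqVneq k j; last by rewrite upd_neq.
    by rewrite updE; have [->|qt] := eqVneq q t; rewrite ?updE// upd_neq.
  apply/seteqP; split=> w.
    move=> /= e k kn ki q qT; split=> //; split=> //.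
    have [->|kj] := eqVneq k j; last by rewrite upd_neq.
    by rewrite updE; have [->|qt] := eqVneq q t; rewrite ?updE// upd_neq.
  by move=> /(_ j jn ji t tT)[_ []]; rewrite !updE.
Qed.

Lemma mean_at_traj_pair i j u v : j != i -> comb T u -> comb T v ->
  \int[P]_w (at_traj u i w * at_traj v j w) = Ex u * Ex v.
Proof.
move=> ji cu cv.
have im : (i < (maxn i j).+1)%N by rewrite ltnS leq_maxl.
have jm : (j < (maxn i j).+1)%N by rewrite ltnS leq_maxr.
have [_ ->] := mean_at_traj_others im cu (bmf_others jm ji cv).
by rewrite mean_at_traj.
Qed.

Lemma mean_sqr_sum n u : comb T u -> Ex u = 0 ->
  \int[P]_w ((\sum_(i < n) at_traj u i w) ^+ 2) =
  n%:R * Ex (fun hs ha hr => u hs ha hr ^+ 2).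
Proof.
move=> cu u0; have bu i : bmf (at_traj u i) := bmf_at_traj i cu.
transitivity (\int[P]_w \sum_(i < n) \sum_(j < n) (at_traj u i w * at_traj u j w)).
  apply: eq_Rintegral => w _; rewrite expr2 mulr_suml.
  by apply: eq_bigr => i _; rewrite mulr_sumr.
rewrite (mean_sum P1) => [|i]; last by apply: bmf_sum => j; exact: bmfM.
transitivity (\sum_(i < n) Ex (fun hs ha hr => u hs ha hr ^+ 2)); last first.
  by rewrite sumr_const card_ord mulr_natl.
apply: eq_bigr => i _; rewrite (mean_sum P1) => [|j]; last exact: bmfM.
rewrite (bigD1 i)//= big1 ?addr0 => [|j ji]; last first.
  by rewrite mean_at_traj_pair// u0 mul0r.
rewrite -(mean_at_traj i); last by under eq_fun do under eq_fun do under eq_fun do rewrite expr2; exact: combM.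
by apply: eq_Rintegral => w _; rewrite /at_traj expr2.
Qed.

Lemma at_traj_clt u (g : R -> R) (e : R) : comb T u -> Ex u = 0 ->
  0 < Ex (fun hs ha hr => u hs ha hr ^+ 2) ->
  continuous g -> (exists M, forall x, `|g x| <= M) -> 0 < e ->
  exists n0, forall n, (n0 <= n)%N -> (0 < n)%N ->
  `|\int[P]_w g (\sum_(i < n) at_traj u i w / Num.sqrt n%:R) -
    \int[normal_prob 0 (Num.sqrt (Ex (fun hs ha hr => u hs ha hr ^+ 2)))]_x g x| <= e.
Proof.
move=> cu u0; set V := Ex _ => V0 cg bg e0.
have cu2 : comb T (fun hs ha hr => u hs ha hr ^+ 2).
  by apply: comb_ext (combM cu cu) => hs ha hr; rewrite expr2.
have [eta eta0 H] := normal_approximation V0 cg bg e0.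
have [M HM] := comb_bounded cu.
(* Beyond this index every rescaled summand is at most [M / sqrt n <= eta]. *)
exists (Num.trunc ((M / eta) ^+ 2)).+1 => n n0n n0.
have sn0 : 0 < Num.sqrt n%:R :> R by rewrite sqrtr_gt0 ltr0n.
have sn2 : Num.sqrt n%:R ^+ 2 = n%:R :> R by rewrite sqr_sqrtr// ler0n.
have M0 : 0 <= M by exact: le_trans (HM (fun=> sD 0 0 point) (fun=> point) (fun=> 0)).
have Meta : M / Num.sqrt n%:R <= eta.
  rewrite ler_pdivrMr// mulrC -ler_pdivrMr//.
  rewrite -(ler_pXn2r (ltn0Sn 1)) ?nnegrE ?divr_ge0 ?sqrtr_ge0 ?(ltW eta0)//.
  rewrite sn2 ltW// (lt_le_trans (truncnS_gt _))// ler_nat//.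
pose X (i : 'I_n) w := at_traj u i w / Num.sqrt n%:R.
have bu i : bmf (at_traj u i) := bmf_at_traj i cu.
have bX i : bmf (X i) by apply: bmfM => //; exact: bmf_cst.
have others (i : 'I_n) psi : continuous psi -> (exists M, forall x, `|psi x| <= M) ->
    bmf ((fun w => psi (\sum_(j < n) X j w - X i w)) :
      g_sigma_algebraType (others_system n i) -> R).
  move=> cpsi bpsi.
  suff b : bmf ((fun w => \sum_(j < n) X j w - X i w) :
      g_sigma_algebraType (others_system n i) -> R).
    exact: (bmf_comp_cont b.1 cpsi bpsi).
  rewrite (_ : (fun w => _) = fun w => \sum_(j < n) (if j != i then X j w else 0)).
    apply: bmf_sum => j; have [ji|_] := boolP (j != i); last exact: bmf_cst.
    by apply: bmfM; [exact: (@bmf_others n i j u)|exact: bmf_cst].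
  by apply/funext => w; rewrite -big_mkcond/= [in LHS](bigD1 i)//= addrC addrK.
apply: (H _ _ P n X (V / n%:R)) => //.
- move=> i w; rewrite /X normrM [ `|_^-1|]gtr0_norm ?invr_gt0//.
  by apply: le_trans Meta; rewrite ler_wpM2r ?invr_ge0 ?(ltW sn0)//; exact: HM.
- by rewrite mulrCA divff ?mulr1// pnatr_eq0 -lt0n.
- rewrite (_ : \int[P]_w _ = (n%:R)^-1 * \int[P]_w ((\sum_(i < n) at_traj u i w) ^+ 2)).
    by rewrite mean_sqr_sum// mulrA mulVf ?mul1r// pnatr_eq0 -lt0n.
  rewrite -(meanZ P1); last by apply: bmfX; exact: bmf_sum.
  by apply: eq_Rintegral => w _; rewrite -mulr_suml exprMn exprVn sn2 mulrC.
- move=> i psi cpsi bpsi.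
  have [b E] := mean_at_traj_others (ltn_ord i) cu (others i psi cpsi bpsi).
  transitivity ((Num.sqrt n%:R)^-1 * \int[P]_w
    (at_traj u i w * psi (\sum_(j < n) X j w - X i w))); last by rewrite E u0 mul0r mulr0.
  rewrite -(meanZ P1); last exact: bmfM.
  by apply: eq_Rintegral => w _; rewrite /X mulrAC mulrC.
- move=> i psi cpsi bpsi.
  have [b E] := mean_at_traj_others (ltn_ord i) cu2 (others i psi cpsi bpsi).
  transitivity ((n%:R)^-1 * \int[P]_w
    (at_traj u i w ^+ 2 * psi (\sum_(j < n) X j w - X i w))); last first.
    by rewrite E mulrA [_^-1 * _]mulrC.
  rewrite -(meanZ P1); last by apply: bmfM => //; exact: bmfX.
  by apply: eq_Rintegral => w _; rewrite /X exprMn exprVn sn2 mulrAC mulrC.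
Qed.

(** * Expansion of the estimator and control of the remainder *)

Section MarginalizedEstimator.
Variables (eta : nat -> S -> A -> R) (y : R -> R) (wgt q : nat -> S -> R) (rho : R).
Hypothesis beta : forall t, (t <= T)%N -> forall s, bmf (eta t s).
Hypothesis bmfy : bmf y.

Let I t s : @trajfun R dA A S := fun hs _ _ => (hs t == s)%:R.
Let lam t : @trajfun R dA A S := fun hs ha _ => \prod_(k < t) eta k (hs k) (ha k).
Let er t : @trajfun R dA A S := fun hs ha hr => eta t (hs t) (ha t) * y (hr t).

Definition dev_num t s : @trajfun R dA A S := fun hs ha hr =>
  I t s hs ha hr * (lam t hs ha hr - wgt t s).

Definition dev_reward t s : @trajfun R dA A S := fun hs ha hr =>
  I t s hs ha hr * (er t hs ha hr - q t s).

Definition influence : @trajfun R dA A S := fun hs ha hr =>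
  \sum_(t < T.+1) (wgt t (hs t) * er t hs ha hr +
    (lam t hs ha hr - wgt t (hs t)) * q t (hs t)) - rho.

Let cI t s : (t <= T)%N -> comb T (I t s).
Proof. by move=> tT; apply: (@comb_s _ _ _ _ _ t (fun s' => (s' == s)%:R)). Qed.

Let clam t : (t <= T)%N -> comb T (lam t).
Proof.
move=> tT; apply: (@comb_prod _ _ _ _ _ t (fun k hs ha _ => eta k (hs k) (ha k))).
move=> k kt; have kT : (k <= T)%N by exact: leq_trans (ltnW kt) tT.
by apply: comb_sa => //; exact: beta.
Qed.

Let cer t : (t <= T)%N -> comb T (er t).
Proof. by move=> tT; apply: comb_factor => //; exact: beta. Qed.

Lemma comb_dev_num t s : (t <= T)%N -> comb T (dev_num t s).
Proof.
by move=> tT; apply: combM; [exact: cI|apply: combB; [exact: clam|exact: comb_cst]].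
Qed.

Lemma comb_dev_reward t s : (t <= T)%N -> comb T (dev_reward t s).
Proof.
by move=> tT; apply: combM; [exact: cI|apply: combB; [exact: cer|exact: comb_cst]].
Qed.

Lemma comb_influence : comb T influence.
Proof.
apply: combB; last exact: comb_cst.
rewrite (_ : (fun hs ha hr => _) = fun hs ha hr => \sum_(t <- map val (enum 'I_T.+1))
  (if (t <= T)%N then wgt t (hs t) * er t hs ha hr +
    (lam t hs ha hr - wgt t (hs t)) * q t (hs t) else 0)); last first.
  apply/funext => hs; apply/funext => ha; apply/funext => hr.
  rewrite big_map big_enum/=; apply: eq_bigr => t _.
  by rewrite -ltnS ltn_ord.
apply: comb_sum => t; have [tT|_] := boolP (t <= T)%N; last exact: comb_cst.
apply: combD; first by apply: combM; [exact: comb_s|exact: cer].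
by apply: combM; [apply: combB; [exact: clam|exact: comb_s]|exact: comb_s].
Qed.

Definition avg n u w := n%:R^-1 * \sum_(i < n) at_traj u i w.

Definition weight_hat n t s w :=
  (\sum_(i < n) at_traj (fun hs ha hr => I t s hs ha hr * lam t hs ha hr) i w) /
  (\sum_(i < n) at_traj (I t s) i w).

Definition estimate n w := n%:R^-1 * \sum_(i < n) \sum_(t < T.+1)
  (weight_hat n t (sD i t w) w * at_traj (er t) i w).

Lemma avgD n u v w :
  avg n (fun hs ha hr => u hs ha hr + v hs ha hr) w = avg n u w + avg n v w.
Proof. by rewrite /avg -mulrDr -big_split. Qed.

Lemma avgZ n c u w : avg n (fun hs ha hr => c * u hs ha hr) w = c * avg n u w.
Proof. by rewrite /avg [RHS]mulrCA; congr (_ * _); rewrite mulr_sumr. Qed.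

Lemma avg_sum n (J : Type) (r : seq J) (F : J -> @trajfun R dA A S) w :
  avg n (fun hs ha hr => \sum_(j <- r) F j hs ha hr) w = \sum_(j <- r) avg n (F j) w.
Proof.
by rewrite /avg -mulr_sumr; congr (_ * _); rewrite exchange_big.
Qed.

Lemma sum_indicator (t : nat) (hs : nat -> S) (F : S -> R) :
  F (hs t) = \sum_s (hs t == s)%:R * F s.
Proof.
rewrite (bigD1 (hs t))//= eqxx mul1r big1 ?addr0// => s.
by rewrite eq_sym => /negbTE ->; rewrite mul0r.
Qed.

(* The delta-method remainder of [L M / N] is an exact product. *)
Lemma estimate_expansion n w : (0 < n)%N ->
  estimate n w - rho = avg n influence w + \sum_(t < T.+1) \sum_s
    avg n (dev_num t s) w * avg n (dev_reward t s) w / avg n (I t s) w.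
Proof.
move=> n0; have nN : n%:R != 0 :> R by rewrite pnatr_eq0 -lt0n.
pose L t s := avg n (fun hs ha hr => I t s hs ha hr * lam t hs ha hr) w.
pose M t s := avg n (fun hs ha hr => I t s hs ha hr * er t hs ha hr) w.
pose N t s := avg n (I t s) w.
have EE : estimate n w = \sum_(t < T.+1) \sum_s L t s / N t s * M t s.
  rewrite /estimate exchange_big mulr_sumr; apply: eq_bigr => t _.
  transitivity (n%:R^-1 * \sum_(i < n) \sum_s (weight_hat n t s w *
      at_traj (fun hs ha hr => I t s hs ha hr * er t hs ha hr) i w)).
    congr (_ * _); apply: eq_bigr => i _.
    rewrite (sum_indicator t (fun t => sD i t w)
      (fun s => weight_hat n t s w * at_traj (er t) i w)).
    by apply: eq_bigr => s _; rewrite /at_traj /I mulrCA.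
  rewrite exchange_big mulr_sumr; apply: eq_bigr => s _.
  rewrite -mulr_sumr mulrCA; congr (_ * _).
  by rewrite /L /N /avg /weight_hat invfM invrK mulrACA mulVf// mul1r.
have EI : avg n influence w = \sum_(t < T.+1) \sum_s
    (wgt t s * M t s + q t s * L t s - wgt t s * q t s * N t s) - rho.
  rewrite /influence avgD; congr (_ + _); last first.
    by rewrite /avg /at_traj sumr_const card_ord -[X in _ * X]mulr_natl mulKf.
  rewrite avg_sum; apply: eq_bigr => t _.
  transitivity (avg n (fun hs ha hr => \sum_s
      (wgt t s * (I t s hs ha hr * er t hs ha hr) +
       (q t s * (I t s hs ha hr * lam t hs ha hr) +
        - (wgt t s * q t s) * I t s hs ha hr))) w).
    congr (avg n _ w); apply/funext => hs; apply/funext => ha; apply/funext => hr.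
    rewrite (sum_indicator t hs (fun s => wgt t s * er t hs ha hr +
      (lam t hs ha hr - wgt t s) * q t s)).
    by apply: eq_bigr => s _; rewrite /I; ring.
  rewrite avg_sum; apply: eq_bigr => s _.
  by rewrite !avgD !avgZ mulNr addrA.
rewrite EE EI addrAC; congr (_ - _); rewrite -big_split /=; apply: eq_bigr => t _.
rewrite -big_split /=; apply: eq_bigr => s _.
have -> : avg n (dev_num t s) w = L t s - wgt t s * N t s.
  rewrite -mulNr -avgZ -avgD; congr (avg n _ w).
  by apply/funext => hs; apply/funext => ha; apply/funext => hr; rewrite /dev_num; ring.
have -> : avg n (dev_reward t s) w = M t s - q t s * N t s.
  rewrite -mulNr -avgZ -avgD; congr (avg n _ w).
  by apply/funext => hs; apply/funext => ha; apply/funext => hr; rewrite /dev_reward; ring.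
(* If no trajectory visits [s] at time [t], then [L] and [M] vanish together with [N], and the
   convention [x / 0 = 0] makes both sides agree. *)
rewrite -/(N t s); have [N0|N0] := eqVneq (N t s) 0; last by field.
have I0 (i : 'I_n) : at_traj (I t s) i w = 0.
  move/eqP: N0; rewrite /N /avg mulf_eq0 invr_eq0 (negbTE nN) /= => /eqP N0.
  by apply: (psumr_eq0P _ N0) => // j _; rewrite /at_traj /I ler0n.
have L0 : L t s = 0.
  rewrite /L /avg big1 ?mulr0// => i _; have := I0 i.
  by rewrite /at_traj => ->; rewrite mul0r.
have M0 : M t s = 0.
  rewrite /M /avg big1 ?mulr0// => i _; have := I0 i.
  by rewrite /at_traj => ->; rewrite mul0r.
by rewrite N0 L0 M0 invr0; ring.
Qed.

(** The factor [z] is left general to cover both the clipped and the observed rewards. The weight at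
    a random state is measurable as a finite sum over states. *)
Lemma measurable_weighted n (z : nat -> nat -> Omega -> R) :
  (forall i t, (t <= T)%N -> measurable_fun setT (z i t)) ->
  measurable_fun setT (fun w => n%:R^-1 * \sum_(i < n) \sum_(t < T.+1)
    (weight_hat n t (sD i t w) w * z i t w)).
Proof.
move=> mz.
have mW t s : (t <= T)%N -> measurable_fun setT (weight_hat n t s).
  move=> tT; apply: measurable_funM.
    apply: bmf_measurable; apply: bmf_sum => i.
    exact: (bmf_at_traj i (combM (cI s tT) (clam tT))).
  apply: measurable_inv_ge0; last first.
    by move=> w; apply: sumr_ge0 => i _; rewrite /at_traj /I ler0n.
  by apply: bmf_measurable; apply: bmf_sum => i; exact: (bmf_at_traj i (cI s tT)).
rewrite (_ : (fun w => _) = fun w => n%:R^-1 * \sum_(i < n)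
  \sum_(t <- map val (enum 'I_T.+1)) (if (t <= T)%N then
     \sum_s at_traj (I t s) i w * weight_hat n t s w * z i t w else 0)).
  apply: measurable_funM => //; apply: measurable_sum => i; apply: measurable_sum => t.
  have [tT|_] := boolP (t <= T)%N; last exact: measurable_cst.
  apply: measurable_sum => s; apply: measurable_funM; last exact: mz.
  by apply: measurable_funM; [exact: (bmf_at_traj i (cI s tT)).1|exact: mW].
apply/funext => w; congr (_ * _); apply: eq_bigr => i _.
rewrite big_map big_enum/=; apply: eq_bigr => t _; rewrite -ltnS ltn_ord.
rewrite -mulr_suml; congr (_ * _).
exact: (sum_indicator t (fun t => sD i t w) (fun s => weight_hat n t s w)).
Qed.

Lemma measurable_estimate n : measurable_fun setT (estimate n).
Proof.
apply: (@measurable_weighted n (fun i t w => at_traj (er t) i w)) => i t tT.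
exact: (bmf_at_traj i (cer tT)).1.
Qed.

Lemma bmf_avg n u : comb T u -> bmf (avg n u).
Proof.
by move=> cu; apply: bmfZ; apply: bmf_sum => i; exact: bmf_at_traj.
Qed.

Lemma mean_avg_sqr n u : comb T u -> Ex u = 0 -> (0 < n)%N ->
  \int[P]_w (avg n u w ^+ 2) = Ex (fun hs ha hr => u hs ha hr ^+ 2) / n%:R.
Proof.
move=> cu u0 n0; have nN : n%:R != 0 :> R by rewrite pnatr_eq0 -lt0n.
transitivity ((n%:R ^+ 2)^-1 * \int[P]_w ((\sum_(i < n) at_traj u i w) ^+ 2)).
  rewrite -(meanZ P1); last by apply: bmfX; apply: bmf_sum => i; exact: bmf_at_traj.
  by apply: eq_Rintegral => w _; rewrite /avg exprMn exprVn.
by rewrite mean_sqr_sum//; field.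
Qed.

Hypothesis Ex_dev_num : forall t s, (t <= T)%N -> Ex (I t s) != 0 -> Ex (dev_num t s) = 0.
Hypothesis Ex_dev_reward : forall t s, (t <= T)%N -> Ex (dev_reward t s) = 0.

Let sq u : @trajfun R dA A S := fun hs ha hr => u hs ha hr ^+ 2.
Let csq u : comb T u -> comb T (sq u).
Proof. by move=> cu; apply: comb_ext (combM cu cu) => hs ha hr; rewrite /sq expr2. Qed.

Let sqE u : comb T u -> 0 <= Ex (sq u).
Proof.
move=> cu; rewrite -(mean_at_traj 0 (csq cu)); apply: mean_ge0 => w.
exact: sqr_ge0.
Qed.

Let null_state t s : (t <= T)%N -> Ex (I t s) = 0 ->
  P.-negligible [set w | exists i, sD i t w = s].
Proof.
move=> tT I0; rewrite (_ : [set w | _] = \bigcup_i [set w | sD i t w = s]); last first.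
  by apply/seteqP; split=> w [i H]; [exists i|exists i].
apply: negligible_bigcup => i; exists [set w | sD i t w = s]; split=> //.
transitivity (P [set w | sD i t w = s]) => //.
rewrite -(indic_mean (msD i t s)) -[RHS]/(0%:E) -I0 -(mean_at_traj i (cI s tT)).
congr EFin; apply: eq_Rintegral => w _; rewrite /at_traj /I indicE.
congr ((nat_of_bool _)%:R).
by apply/idP/eqP => [/set_mem|?]; [|exact: mem_set].
Qed.

(** If the visit frequency is at least half its mean [m], the quotient is at most [(a^2 + b^2) / m],
    because [2 |a b| <= a^2 + b^2]. Otherwise the frequency deviates by more than [m / 2], and the
    truncation level 1 is at most [4 dd^2 / m^2]. All three averages are centred, with mean squares
    of order [1 / n]. *)
Lemma remainder_term t s : (t <= T)%N ->
  exists2 C : R, 0 <= C & forall n, (0 < n)%N -> exists U : Omega -> R,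
    [/\ bmf U, forall w, 0 <= U w, \int[P]_w U w <= C / Num.sqrt n%:R &
     P.-negligible [set w | ~ (Num.min 1 `|Num.sqrt n%:R *
       (avg n (dev_num t s) w * avg n (dev_reward t s) w / avg n (I t s) w)| <= U w)]].
Proof.
(* A state of probability zero is almost surely never visited. Its term is discarded as a null
   event, since the centring of [dev_num] is only available at reachable states. *)
move=> tT; have [I0|I0] := eqVneq (Ex (I t s)) 0.
  exists 0 => // n n0; exists (fun=> 0); split=> //; first exact: bmf_cst.
    by rewrite mean_cst// mul0r.
  apply: negligibleS (null_state tT I0) => w /= H; apply: contrapT => ne; apply: H.
  rewrite (_ : avg n (I t s) w = 0) ?invr0 ?mulr0 ?normr0 ?ge_min ?lexx ?orbT//.
  rewrite /avg big1 ?mulr0// => i _; rewrite /at_traj /I.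
  by case: eqP => // e; exfalso; apply: ne; exists (val i).
set m := Ex (I t s).
have m0 : 0 < m.
  rewrite lt_def I0 /m -(mean_at_traj 0 (cI s tT)); apply: mean_ge0 => w.
  by rewrite /at_traj /I ler0n.
pose dI : @trajfun R dA A S := fun hs ha hr => I t s hs ha hr - m.
have ca := comb_dev_num s tT; have cb := comb_dev_reward s tT.
have cd : comb T dI by apply: combB; [exact: cI|exact: comb_cst].
have Ex_cst c : Ex (fun _ _ _ => c) = c.
  by rewrite -(mean_at_traj 0 (comb_cst T c)) mean_cst.
have d0 : Ex dI = 0.
  have := ExD (cI s tT) (comb_cst T (- m)).
  by rewrite Ex_cst -/m subrr.
pose C := (Ex (sq (dev_num t s)) + Ex (sq (dev_reward t s))) / m + 4 * Ex (sq dI) / m ^+ 2.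
have C1 : 0 <= (Ex (sq (dev_num t s)) + Ex (sq (dev_reward t s))) / m.
  by rewrite divr_ge0 ?(ltW m0)// addr_ge0// sqE.
have C2 : 0 <= 4 * Ex (sq dI) / m ^+ 2.
  by rewrite divr_ge0 ?sqr_ge0// mulr_ge0// sqE.
exists C => [|n n0]; first exact: addr_ge0.
have nN : n%:R != 0 :> R by rewrite pnatr_eq0 -lt0n.
have sn0 : 0 < Num.sqrt n%:R :> R by rewrite sqrtr_gt0 ltr0n.
have sn2 : Num.sqrt n%:R ^+ 2 = n%:R :> R by rewrite sqr_sqrtr// ler0n.
have sn1 : 1 <= Num.sqrt n%:R :> R.
  by rewrite -[leLHS]sqrtr1 ler_sqrt ?ltr0n// ler1n.
pose a := avg n (dev_num t s); pose b := avg n (dev_reward t s); pose dd := avg n dI.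
have ba : bmf a := bmf_avg n ca; have bb : bmf b := bmf_avg n cb.
have bd : bmf dd := bmf_avg n cd.
exists (fun w => Num.sqrt n%:R / m * (a w ^+ 2 + b w ^+ 2) + 4 / m ^+ 2 * dd w ^+ 2).
have b1 : bmf (fun w => Num.sqrt n%:R / m * (a w ^+ 2 + b w ^+ 2)).
  by apply: bmfZ; apply: bmfD; exact: bmfX.
have b2 : bmf (fun w => 4 / m ^+ 2 * dd w ^+ 2) by apply: bmfZ; exact: bmfX.
have t1 w : 0 <= Num.sqrt n%:R / m * (a w ^+ 2 + b w ^+ 2).
  by rewrite mulr_ge0 ?addr_ge0 ?sqr_ge0// divr_ge0// ltW.
have t2 w : 0 <= 4 / m ^+ 2 * dd w ^+ 2.
  by rewrite mulr_ge0 ?sqr_ge0// divr_ge0 ?sqr_ge0.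
split.
- exact: bmfD.
- by move=> w; exact: addr_ge0.
- rewrite (meanD P1)// (meanZ P1); last by apply: bmfD; exact: bmfX.
  rewrite (meanD P1); [|exact: bmfX..]; rewrite (meanZ P1); last exact: bmfX.
  rewrite (mean_avg_sqr ca (Ex_dev_num tT I0) n0).
  rewrite (mean_avg_sqr cb (Ex_dev_reward s tT) n0) (mean_avg_sqr cd d0 n0).
  rewrite /C [leRHS]mulrDl; apply: lerD.
    rewrite le_eqVlt; apply/orP; left; apply/eqP.
    rewrite /sq; move: sn0 sn2; move: (Num.sqrt _) => z z0 <-.
    by field; rewrite !gt_eqF.
  rewrite -/(sq dI).
  have -> : 4 / m ^+ 2 * (Ex (sq dI) / n%:R) = 4 * Ex (sq dI) / m ^+ 2 * n%:R^-1 by ring.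
  rewrite ler_wpM2l// lef_pV2 ?posrE ?ltr0n//.
  by move: sn0 sn1 sn2; move: (Num.sqrt _) => z z0 z1 <-; rewrite expr2 ler_peMr// ltW.
apply: negligibleS (negligible_set0 P) => w /= H; apply: H.
rewrite -/(a w) -/(b w).
have NE : avg n (I t s) w = m + dd w.
  rewrite /dd /dI avgD; rewrite [avg n (fun _ _ _ => - m) w](_ : _ = - m).
    by rewrite addrC subrK.
  by rewrite /avg /at_traj sumr_const card_ord -[X in _ * X]mulr_natl mulKf.
rewrite NE; have [Nm|Nm] := leP (m / 2) (m + dd w); last first.
  rewrite ge_min; apply/orP; left; apply: ler_wpDl => //.
  have : (m / 2) ^+ 2 <= dd w ^+ 2.
    rewrite -[leRHS]sqrrN; apply: lerXn2r; rewrite ?nnegrE; lra.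
  rewrite -(ler_pM2l (x := 4 / m ^+ 2)); last by rewrite divr_gt0// exprn_gt0.
  by have -> : 4 / m ^+ 2 * (m / 2) ^+ 2 = 1 by field; rewrite gt_eqF.
rewrite ge_min; apply/orP; right; apply: ler_wpDr => //.
have m20 : 0 < m / 2 by rewrite divr_gt0.
have N0 : 0 < m + dd w by exact: lt_le_trans Nm.
rewrite normrM gtr0_norm// -[leRHS]mulrA ler_pM2l// normrM [ `|_^-1|]gtr0_norm ?invr_gt0//.
rewrite normrM; apply: (@le_trans _ _ (`|a w| * `|b w| * (m / 2)^-1)).
  by rewrite ler_wpM2l ?mulr_ge0// lef_pV2.
rewrite invf_div mulrA [X in _ <= X]mulrC ler_wpM2r ?invr_ge0 ?(ltW m0)//.
rewrite -(real_normK (num_real (a w))) -(real_normK (num_real (b w))).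
by have := sqr_ge0 (`|a w| - `|b w|); rewrite sqrrB; lra.
Qed.

Lemma remainder_bound : exists2 C : R, 0 <= C & forall n, (0 < n)%N ->
  exists U : Omega -> R,
    [/\ bmf U, forall w, 0 <= U w, \int[P]_w U w <= C / Num.sqrt n%:R &
     P.-negligible [set w | ~ (Num.min 1 `|Num.sqrt n%:R * (estimate n w - rho) -
       \sum_(i < n) at_traj influence i w / Num.sqrt n%:R| <= U w)]].
Proof.
have ex (j : 'I_T.+1 * S) : exists C : R, 0 <= C /\ forall n, (0 < n)%N ->
    exists U : Omega -> R,
    [/\ bmf U, forall w, 0 <= U w, \int[P]_w U w <= C / Num.sqrt n%:R &
     P.-negligible [set w | ~ (Num.min 1 `|Num.sqrt n%:R *
       (avg n (dev_num j.1 j.2) w * avg n (dev_reward j.1 j.2) w /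
        avg n (I j.1 j.2) w)| <= U w)]].
  by have [C C0 H] := remainder_term j.2 (ltn_ord j.1); exists C.
have [C HC] := choice ex.
exists (\sum_j C j) => [|n n0]; first by apply: sumr_ge0 => j _; have [] := HC j.
have [U HU] := choice (fun j => (HC j).2 n n0).
have bU j : bmf (U j) by have [] := HU j.
exists (fun w => \sum_j U j w); split.
- exact: bmf_sum.
- by move=> w; apply: sumr_ge0 => j _; have [_ + _ _] := HU j; exact.
- rewrite (mean_sum P1)// mulr_suml; apply: ler_sum => j _.
  by have [] := HU j.
have nN : n%:R != 0 :> R by rewrite pnatr_eq0 -lt0n.
have sn0 : 0 < Num.sqrt n%:R :> R by rewrite sqrtr_gt0 ltr0n.
have sn2 : Num.sqrt n%:R ^+ 2 = n%:R :> R by rewrite sqr_sqrtr// ler0n.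
pose bad (j : 'I_T.+1 * S) := [set w | ~ (Num.min 1 `|Num.sqrt n%:R *
       (avg n (dev_num j.1 j.2) w * avg n (dev_reward j.1 j.2) w /
        avg n (I j.1 j.2) w)| <= U j w)].
have : P.-negligible (\big[setU/set0]_(j : 'I_T.+1 * S) bad j).
  apply: (big_ind (fun B => P.-negligible B)); first exact: negligible_set0.
    by move=> B B'; exact: negligibleU.
  by move=> j _; have [] := HU j.
apply: negligibleS => w /= H; rewrite -bigcup_seq; apply: contrapT => good; apply: H.
have {}good (j : 'I_T.+1 * S) : Num.min 1 `|Num.sqrt n%:R *
       (avg n (dev_num j.1 j.2) w * avg n (dev_reward j.1 j.2) w /
        avg n (I j.1 j.2) w)| <= U j w.
  by apply: contrapT => nj; apply: good; exists j; rewrite //= mem_index_enum.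
apply: le_trans (truncated_sum _ good).
rewrite estimate_expansion// mulrDr.
have -> : Num.sqrt n%:R * avg n influence w =
    \sum_(i < n) at_traj influence i w / Num.sqrt n%:R.
  rewrite -mulr_suml /avg; move: sn0 sn2; move: (Num.sqrt _) => z z0 <-.
  by field; rewrite gt_eqF.
rewrite addrAC subrr add0r mulr_sumr.
under eq_bigr do rewrite mulr_sumr.
by rewrite pair_big.
Qed.

Hypothesis Ex_influence : Ex influence = 0.

Let V := Ex (sq influence).
Let Wn n w := \sum_(i < n) at_traj influence i w / Num.sqrt n%:R.

Let bWn n : bmf (Wn n).
Proof.
apply: bmf_sum => i; apply: bmfM; last exact: bmf_cst.
exact: (bmf_at_traj i comb_influence).
Qed.

Let Wn2 n : (0 < n)%N -> \int[P]_w (Wn n w ^+ 2) = V.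
Proof.
move=> n0; have nN : n%:R != 0 :> R by rewrite pnatr_eq0 -lt0n.
have sn2 : Num.sqrt n%:R ^+ 2 = n%:R :> R by rewrite sqr_sqrtr// ler0n.
transitivity (n%:R^-1 * \int[P]_w ((\sum_(i < n) at_traj influence i w) ^+ 2)).
  rewrite -(meanZ P1); last first.
    by apply: bmfX; apply: bmf_sum => i; exact: (bmf_at_traj i comb_influence).
  by apply: eq_Rintegral => w _; rewrite /Wn -mulr_suml exprMn exprVn sn2 mulrC.
by rewrite (mean_sqr_sum n comb_influence Ex_influence) mulKf.
Qed.

Let V_ge0 : 0 <= V. Proof. exact: (sqE comb_influence). Qed.

Let small_root (C dl : R) : 0 <= C -> 0 < dl ->
  exists n0, forall n, (n0 <= n)%N -> (0 < n)%N /\ C / Num.sqrt n%:R <= dl.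
Proof.
move=> C0 dl0; exists (Num.trunc ((C / dl) ^+ 2)).+1 => n n0n.
have n0 : (0 < n)%N by exact: leq_trans n0n.
have sn0 : 0 < Num.sqrt n%:R :> R by rewrite sqrtr_gt0 ltr0n.
split=> //; rewrite ler_pdivrMr// mulrC -ler_pdivrMr//.
rewrite -(ler_pXn2r (ltn0Sn 1)) ?nnegrE ?divr_ge0 ?sqrtr_ge0 ?(ltW dl0)//.
rewrite sqr_sqrtr ?ler0n// ltW// (lt_le_trans (truncnS_gt _))// ler_nat//.
Qed.

Let mZ n : measurable_fun setT (fun w => Num.sqrt n%:R * (estimate n w - rho)).
Proof.
apply: measurable_funM => //; apply: measurable_funB => //.
exact: measurable_estimate.
Qed.

Lemma estimate_normal (g : R -> R) (e : R) :
  continuous g -> (exists M, forall x, `|g x| <= M) -> 0 < e ->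
  exists n0, forall n, (n0 <= n)%N ->
  `|\int[P]_w g (Num.sqrt n%:R * (estimate n w - rho)) -
    (if V == 0 then g 0 else \int[normal_prob 0 (Num.sqrt V)]_x g x)| <= e.
Proof.
move=> cg bg e0; have e2 : 0 < e / 2 by rewrite divr_gt0.
have [dl dl0 Hsl] := slutsky P cg bg V_ge0 e2.
have [C C0 HC] := remainder_bound.
have [n1 Hn1] := small_root C0 dl0.
have ZW n : (n1 <= n)%N ->
    `|\int[P]_w g (Num.sqrt n%:R * (estimate n w - rho)) -
      \int[P]_w g (Wn n w)| <= e / 2.
  move=> n1n; have [n0 Cdl] := Hn1 n n1n.
  have [U [bU U0 EU negl]] := HC n n0.
  apply: (Hsl _ _ U (mZ n) (bWn n) bU U0) => //; first by rewrite Wn2.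
  exact: le_trans EU Cdl.
have [Vz|Vnz] := eqVneq V 0.
  exists n1 => n n1n; have [n0 _] := Hn1 n n1n.
  have W0 : `|\int[P]_w g (Wn n w) - g 0| <= e / 2.
    rewrite -(mean_cst P1 (g 0)).
    (* For [V = 0] the limit is the point mass at 0, so [Wn] is compared with the constant 0. The
       bound is [|x| <= dl / 2 + x^2 / (2 dl)], and the quadratic part has mean zero because [Wn]
       has second moment [V]. *)
    pose U w := dl / 2 + (2 * dl)^-1 * Wn n w ^+ 2.
    have bW2 : bmf (fun w => Wn n w ^+ 2) by exact: bmfX.
    apply: (Hsl _ (fun=> 0) U) => //.
    - exact: (bWn n).1.
    - exact: bmf_cst.
    - by apply: bmfD; [exact: bmf_cst|exact: bmfZ].
    - move=> w; apply: addr_ge0; first by rewrite divr_ge0// ltW.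
      by apply: mulr_ge0; [rewrite invr_ge0 mulr_ge0// ltW|exact: sqr_ge0].
    - by under eq_Rintegral do rewrite expr0n /=; rewrite (mean_cst P1).
    - rewrite (meanD P1); [|exact: bmf_cst|exact: bmfZ].
      rewrite (mean_cst P1) (meanZ P1)//.
      by rewrite Wn2// Vz mulr0 addr0 ler_pdivrMr// ler_peMr ?ler1n// ltW.
    - apply: negligibleS (negligible_set0 P) => w /= H; apply: H.
      rewrite subr0 ge_min; apply/orP; right; rewrite /U.
      have -> : dl / 2 + (2 * dl)^-1 * Wn n w ^+ 2 =
          `|Wn n w| + (`|Wn n w| - dl) ^+ 2 / (2 * dl).
        rewrite -(real_normK (num_real (Wn n w))); field; by rewrite gt_eqF.
      by rewrite lerDl divr_ge0 ?sqr_ge0// mulr_ge0// ltW.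
  rewrite -(subrKA (\int[P]_w g (Wn n w))) (le_trans (ler_normD _ _))//.
  by rewrite [leRHS]splitr lerD// ZW.
have V0 : 0 < V by rewrite lt_def Vnz V_ge0.
have [n2 Hn2] := at_traj_clt comb_influence Ex_influence V0 cg bg e2.
exists (maxn n1 n2) => n; rewrite geq_max => /andP[n1n n2n].
have [n0 _] := Hn1 n n1n.
rewrite -(subrKA (\int[P]_w g (Wn n w))) (le_trans (ler_normD _ _))//.
by rewrite [leRHS]splitr lerD ?ZW//; exact: Hn2.
Qed.

(** An error above [eps] forces, after scaling by [sqrt n], either [|Wn| >= sqrt n eps / 2], which
    Chebyshev's inequality makes unlikely, or a remainder above [sqrt n eps / 2 >= 1], hence
    [U >= 1]. The third threshold secures [sqrt n eps >= 2]. *)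
Lemma estimate_consistent (eps e : R) : 0 < eps -> 0 < e ->
  exists n0, forall n, (n0 <= n)%N ->
    (P [set w | (eps < `|estimate n w - rho|)%R] <= e%:E)%E.
Proof.
move=> eps0 e0; have [C C0 HC] := remainder_bound.
have e2 : 0 < e / 2 by rewrite divr_gt0.
have [n1 Hn1] := small_root C0 e2.
have c0 : 0 <= 4 * V / eps ^+ 2 by rewrite divr_ge0 ?sqr_ge0// mulr_ge0.
have [n2 Hn2] := small_root c0 e2.
have [n3 Hn3] := small_root (ltW (ltr0Sn R 1)) eps0.
exists (maxn n1 (maxn n2 n3)) => n; rewrite !geq_max => /and3P[n1n n2n n3n].
have [n0 Cn] := Hn1 n n1n; have [_ Vn] := Hn2 n n2n; have [_ en] := Hn3 n n3n.
have sn0 : 0 < Num.sqrt n%:R :> R by rewrite sqrtr_gt0 ltr0n.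
have sn2 : Num.sqrt n%:R ^+ 2 = n%:R :> R by rewrite sqr_sqrtr// ler0n.
have sn1 : 1 <= Num.sqrt n%:R :> R by rewrite -[leLHS]sqrtr1 ler_sqrt ?ltr0n// ler1n.
have se2 : 2 <= Num.sqrt n%:R * eps by move: en; rewrite ler_pdivrMr// mulrC.
have [U [bU U0 EU [N [mN N0 subN]]]] := HC n n0.
set B := [set w | _].
have mB : measurable B.
  rewrite (_ : B = (fun w => `|estimate n w - rho|) @^-1` `]eps, +oo[%classic).
    rewrite -[X in measurable X]setTI.
    apply: (measurableT_comp (f := fun x : R => `|x|)) => //.
    by apply: measurable_funB => //; exact: measurable_estimate.
  by apply/seteqP; split=> w; rewrite /B/= in_itv/= andbT.
rewrite -(indic_mean mB) lee_fin.
have mBN : measurable (B `\` N) by exact: measurableD.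
have -> : \int[P]_w (\1_B w : R) = \int[P]_w (\1_(B `\` N) w : R).
  apply: (Rintegral_eq_off_null mN N0) => w nNw; rewrite !indicE.
  congr ((nat_of_bool _)%:R); apply/idP/idP => /set_mem H; apply: mem_set; first by split.
  by case: H.
have b2 : bmf (fun w => 4 / (n%:R * eps ^+ 2) * Wn n w ^+ 2) by apply: bmfZ; exact: bmfX.
have t2 w : 0 <= 4 / (n%:R * eps ^+ 2) * Wn n w ^+ 2.
  by rewrite mulr_ge0 ?sqr_ge0// divr_ge0// mulr_ge0 ?sqr_ge0.
apply: (@le_trans _ _ (\int[P]_w (4 / (n%:R * eps ^+ 2) * Wn n w ^+ 2 + U w))).
  apply: (mean_le P1); [exact: bmf_indic|exact: bmfD|move=> w].
  rewrite indicE; have [|_] := boolP (w \in _); last by rewrite addr_ge0.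
  move=> /set_mem [Bw nNw].
  have UZ : Num.min 1 `|Num.sqrt n%:R * (estimate n w - rho) - Wn n w| <= U w.
    by apply: contrapT => nU; apply: nNw; exact: subN.
  have [Wl|Wl] := leP (Num.sqrt n%:R * eps / 2) `|Wn n w|.
    apply: ler_wpDr => //.
    have : (Num.sqrt n%:R * eps / 2) ^+ 2 <= Wn n w ^+ 2.
      rewrite -[leRHS](real_normK (num_real _)); apply: lerXn2r => //; rewrite nnegrE.
      by rewrite divr_ge0// mulr_ge0// ltW.
    have k0 : 0 <= 4 / (n%:R * eps ^+ 2) by rewrite divr_ge0// mulr_ge0 ?sqr_ge0.
    move=> /(ler_wpM2l k0); apply: le_trans.
    have -> : 4 / (n%:R * eps ^+ 2) * (Num.sqrt n%:R * eps / 2) ^+ 2 = 1 :> R.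
      move: sn0 sn2; move: (Num.sqrt _) => z z0 <-.
      by field; rewrite !gt_eqF.
    by [].
  apply: ler_wpDl => //; apply: le_trans UZ; rewrite le_min lexx /=.
  have : Num.sqrt n%:R * eps < `|Num.sqrt n%:R * (estimate n w - rho)|.
    by rewrite normrM gtr0_norm// ltr_pM2l.
  have := ler_normD (Num.sqrt n%:R * (estimate n w - rho) - Wn n w) (Wn n w).
  by rewrite subrK; lra.
rewrite (meanD P1)// (meanZ P1); last exact: bmfX.
rewrite Wn2// [leRHS]splitr; apply: lerD; last exact: le_trans EU Cn.
apply: le_trans Vn.
have -> : 4 / (n%:R * eps ^+ 2) * V = 4 * V / eps ^+ 2 * n%:R^-1.
  by field; rewrite !gt_eqF// ltr0n.
rewrite ler_wpM2l// lef_pV2 ?posrE ?ltr0n//.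
by move: sn0 sn1 sn2; move: (Num.sqrt _) => z z0 z1 <-; rewrite expr2 ler_peMr// ltW.
Qed.

End MarginalizedEstimator.

End IndependentTrajectories.

(** Rewards become bounded everywhere, and their values in range are kept. *)
Definition clip {R : realType} (m r : R) : R := Num.max 0 (Num.min r m).

Lemma clip_id {R : realType} (m r : R) : 0 <= r <= m -> clip m r = r.
Proof. by move=> /andP[r0 rm]; rewrite /clip (min_l rm) max_r. Qed.

Lemma bmf_clip {R : realType} (m : R) : bmf (clip m).
Proof.
split.
  by apply: measurable_maxr => //; exact: measurable_minr.
exists `|m| => r; rewrite ger0_norm /clip ?le_max ?lexx// ge_max normr_ge0 /=.
by rewrite ge_min (le_trans (ler_norm m))// orbT.
Qed.

(** * Population identities for the measurable kernel and clipped rewards *)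

Section Population.
Context {R : realType} {dA : measure_display} {A : measurableType dA}
  {S : finType}.
Variables (nu : {measure set A -> \bar R}) (P0 : S -> R)
  (Ps Ps' : nat -> S -> A -> S -> R) (Pr : nat -> S -> R.-pker A ~> R) (T : nat)
  (pib pie : nat -> S -> A -> R) (C Rmax : R).
Hypothesis P0_ge0 : forall s, 0 <= P0 s.
Hypothesis P01 : \sum_(s : S) P0 s = 1.
Hypothesis Ps1 : kernel_sum1 T Ps.
Hypothesis mpib : forall t, (t <= T)%N -> forall s, measurable_fun setT (pib t s).
Hypothesis pib0 : forall t, (t <= T)%N -> forall s a, 0 <= pib t s a.
Hypothesis pib1 : policy_sum1 nu T pib.
Hypothesis mpie : forall t, (t <= T)%N -> forall s, measurable_fun setT (pie t s).
Hypothesis pie0 : forall t, (t <= T)%N -> forall s a, 0 <= pie t s a.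
Hypothesis pie1 : policy_sum1 nu T pie.
Hypothesis dom : forall t, (t <= T)%N -> forall s a, pib t s a = 0 -> pie t s a = 0.
Hypothesis etaC : forall t, (t <= T)%N -> forall s a, 0 <= eta_r pib pie t s a <= C.
Hypothesis mPs' : forall t s s', measurable_fun setT (fun a => Ps' t s a s').
Hypothesis Ps'_01 : forall t s a s', 0 <= Ps' t s a s' <= 1.
Hypothesis version : forall pi,
  (forall t, (t <= T)%N -> forall s a, pib t s a = 0 -> pi t s a = 0) ->
  forall f f' : @trajfun R dA A S,
    (forall hs ha hr, (forall k, (k <= T)%N -> 0 <= hr k <= Rmax) ->
      f hs ha hr = f' hs ha hr) ->
    Expect nu P0 Ps Pr T pi f = Expect nu P0 Ps' Pr T pi f'.

Let Ex := Expect nu P0 Ps' Pr T pib.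
Let Ee := Expect nu P0 Ps' Pr T pie.
Let eta := eta_r pib pie.
Let y := clip Rmax.
Let w := wt nu P0 Ps Pr T pib pie.
Let q := qe nu Pr pie.
Let rho := rho_e nu P0 Ps Pr T pie.
Let sb := stateProb nu P0 Ps Pr T pib.
Let se := stateProb nu P0 Ps Pr T pie.
Implicit Types f g : @trajfun R dA A S.

Lemma Expect_pib f f' :
  (forall hs ha hr, (forall k, (k <= T)%N -> 0 <= hr k <= Rmax) ->
    f hs ha hr = f' hs ha hr) -> Expect nu P0 Ps Pr T pib f = Ex f'.
Proof. by apply: version => t tT s a. Qed.

Lemma Expect_pie f f' :
  (forall hs ha hr, (forall k, (k <= T)%N -> 0 <= hr k <= Rmax) ->
    f hs ha hr = f' hs ha hr) -> Expect nu P0 Ps Pr T pie f = Ee f'.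
Proof. exact: version. Qed.

Lemma P0_01 s : 0 <= P0 s <= 1.
Proof. by rewrite P0_ge0/= -P01 (bigD1 s)//= lerDl sumr_ge0. Qed.

Lemma ExD f g : comb T f -> comb T g ->
  Ex (fun hs ha hr => f hs ha hr + g hs ha hr) = Ex f + Ex g.
Proof. exact: ExpectD. Qed.

Lemma EeD f g : comb T f -> comb T g ->
  Ee (fun hs ha hr => f hs ha hr + g hs ha hr) = Ee f + Ee g.
Proof. exact: ExpectD. Qed.

Lemma ExZ c f : Ex (fun hs ha hr => c * f hs ha hr) = c * Ex f.
Proof. exact: ExpectZ. Qed.

Lemma EeZ c f : Ee (fun hs ha hr => c * f hs ha hr) = c * Ee f.
Proof. exact: ExpectZ. Qed.

Lemma comb_functional_sum (L : @trajfun R dA A S -> R) :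
  (forall f g, comb T f -> comb T g ->
    L (fun hs ha hr => f hs ha hr + g hs ha hr) = L f + L g) ->
  (forall c f, L (fun hs ha hr => c * f hs ha hr) = c * L f) ->
  forall (J : eqType) (r : seq J) (F : J -> @trajfun R dA A S),
  (forall j, j \in r -> comb T (F j)) ->
  comb T (fun hs ha hr => \sum_(j <- r) F j hs ha hr) /\
  L (fun hs ha hr => \sum_(j <- r) F j hs ha hr) = \sum_(j <- r) L (F j).
Proof.
move=> LD LZ J r F; elim: r => [|j r ih] cF.
  have -> : (fun hs ha hr => \sum_(j <- [::]) F j hs ha hr) =
      (fun _ _ _ => 0 * 1) :> @trajfun R dA A S.
    by apply/funext => hs; apply/funext => ha; apply/funext => hr; rewrite big_nil mul0r.
  by split; [apply: combZ; exact: comb_cst|rewrite (LZ 0 (fun _ _ _ => 1)) mul0r big_nil].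
have cj : comb T (F j) by apply: cF; rewrite mem_head.
have [cr Lr] := ih (fun k kr => cF k (mem_behead (s := j :: r) kr)).
have -> : (fun hs ha hr => \sum_(k <- j :: r) F k hs ha hr) =
    (fun hs ha hr => F j hs ha hr + \sum_(k <- r) F k hs ha hr) :> @trajfun R dA A S.
  by apply/funext => hs; apply/funext => ha; apply/funext => hr; rewrite big_cons.
by split; [exact: combD|rewrite LD// Lr big_cons].
Qed.

Lemma bmf_eta t : (t <= T)%N -> forall s, bmf (eta t s).
Proof.
move=> tT s; split; last first.
  by exists C => a; have /andP[e0 eC] := etaC tT s a; rewrite ger0_norm.
apply: measurable_funM; first exact: mpie.
by apply: measurable_inv_ge0; [exact: mpib|exact: pib0].
Qed.

Lemma pib_eta t s a : (t <= T)%N -> pib t s a * eta t s a = pie t s a.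
Proof.
move=> tT; rewrite /eta /eta_r; have [p0|p0] := eqVneq (pib t s a) 0.
  by rewrite p0 mul0r dom.
by rewrite mulrC divfK.
Qed.

(** The weight turns [pib] into the policy that follows [pie] before [t] and [pib] from [t] on; the
    law of the state at [t] sees only the earlier part. *)
Lemma mean_lamprev t s : (t <= T)%N ->
  Expect nu P0 Ps Pr T pib (fun hs ha _ => (hs t == s)%:R * lamprev pib pie t hs ha) =
  se t s.
Proof.
move=> tT.
pose ratio k (u : S) (a : A) := if (k < t)%N then eta k u a else 1.
pose pi k u a := pib k u a * ratio k u a.
have piE k u a : (k <= T)%N -> pi k u a = if (k < t)%N then pie k u a else pib k u a.
  by move=> kT; rewrite /pi /ratio; case: ifP => _; rewrite ?mulr1// pib_eta.
have pi1 : policy_sum1 nu T pi.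
  move=> k kT u; under eq_integral do rewrite piE//.
  by case: (k < t)%N; [exact: pie1|exact: pib1].
transitivity (stateProb nu P0 Ps Pr T pi t s); last first.
  apply: stateProb_policy_eq => // j jt u a.
  by rewrite piE ?jt// (leq_trans (ltnW jt)).
rewrite /stateProb (@Expect_change _ _ _ _ nu P0 Pr T Ps pib pi ratio _
  (fun _ _ _ _ => erefl)).
congr (Expect _ _ _ _ _ _ _); apply/funext => hs; apply/funext => ha; apply/funext => hr.
rewrite mulrC; congr (_ * _); rewrite /lamprev.
rewrite (big_ord_widen_cond T.+1 xpredT (fun k => eta k (hs k) (ha k))) ?leqW//.
rewrite [LHS]big_mkcond; apply: eq_bigr => k _; rewrite /ratio//.
Qed.

(** Here the auxiliary policy follows [pie] at time [t] alone: the state at [t] keeps its behavior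
    law, while its reward is averaged under [pie]. *)
Lemma mean_eta_reward t s : (t <= T)%N ->
  Expect nu P0 Ps Pr T pib
    (fun hs ha hr => (hs t == s)%:R * (eta t (hs t) (ha t) * hr t)) = q t s * sb t s.
Proof.
move=> tT.
pose ratio k (u : S) (a : A) := if k == t then eta k u a else 1.
pose pi k u a := pib k u a * ratio k u a.
have piE k u a : (k <= T)%N -> pi k u a = if k == t then pie k u a else pib k u a.
  by move=> kT; rewrite /pi /ratio; case: ifP => _; rewrite ?mulr1// pib_eta.
have pi1 : policy_sum1 nu T pi.
  move=> k kT u; under eq_integral do rewrite piE//.
  by case: (k == t); [exact: pie1|exact: pib1].
have -> : q t s = \int[nu]_a (pi t s a * \int[Pr t s a]_r r).
  by apply: eq_Rintegral => a _; rewrite piE ?eqxx.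
have -> : sb t s = stateProb nu P0 Ps Pr T pi t s.
  apply: stateProb_policy_eq => // j jt u a.
  by rewrite piE ?(leq_trans (ltnW jt))// ltn_eqF.
rewrite -(@Expect_reward _ _ _ _ nu P0 Pr T Ps pi t s id P01 Ps1 pi1 tT).
rewrite (@Expect_change _ _ _ _ nu P0 Pr T Ps pib pi ratio _ (fun _ _ _ _ => erefl)).
congr (Expect _ _ _ _ _ _ _); apply/funext => hs; apply/funext => ha; apply/funext => hr.
rewrite (bigD1 (Ordinal (tT : (t < T.+1)%N)))//= {1}/ratio eqxx big1 ?mulr1 /=.
  by rewrite mulrCA.
by move=> k; rewrite -val_eqE /ratio => /negbTE /= ->.
Qed.

Lemma rho_eE : rho = \sum_(t < T.+1) \sum_s q t s * se t s.
Proof.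
have cterm t s : (t <= T)%N ->
    comb T (fun (hs : nat -> S) (ha : nat -> A) hr => (hs t == s)%:R * y (hr t)).
  move=> tT; apply: (@comb_factor _ _ _ _ _ t (fun u _ => (u == s)%:R)) => //.
    by move=> u; exact: bmf_cst.
  exact: bmf_clip.
rewrite /rho /rho_e (@Expect_pie _ (fun hs ha hr => \sum_(t < T.+1) \sum_s
  (hs t == s)%:R * y (hr t))); last first.
  move=> hs ha hr hrR; apply: eq_bigr => t _.
  rewrite -(sum_indicator (R := R) t hs (fun=> y (hr t))).
  by rewrite /y clip_id// hrR// -ltnS.
have cs t : (t <= T)%N -> comb T (fun (hs : nat -> S) (ha : nat -> A) hr =>
    \sum_s (hs t == s)%:R * y (hr t)) /\
    Ee (fun hs ha hr => \sum_s (hs t == s)%:R * y (hr t)) =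
    \sum_s Ee (fun hs ha hr => (hs t == s)%:R * y (hr t)).
  move=> tT.
  exact: (comb_functional_sum EeD EeZ (r := index_enum S)
    (F := fun s hs ha hr => (hs t == s)%:R * y (hr t)) (fun s _ => cterm t s tT)).
have [_ ->] := comb_functional_sum EeD EeZ
  (r := index_enum 'I_T.+1) (fun t _ => (cs t (ltn_ord t)).1).
apply: eq_bigr => t _; have tT : (t <= T)%N := ltn_ord t.
rewrite (cs t tT).2; apply: eq_bigr => s _.
rewrite -(@Expect_reward _ _ _ _ nu P0 Pr T Ps pie t s id P01 Ps1 pie1 tT).
by apply/esym; apply: Expect_pie => hs ha hr hrR; rewrite /y clip_id// hrR.
Qed.

Lemma Ex_state t s : Ex (fun hs _ _ => (hs t == s)%:R) = sb t s.
Proof. by apply/esym; apply: Expect_pib. Qed.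

Let cI t s : (t <= T)%N -> comb T (fun (hs : nat -> S) (ha : nat -> A) hr => (hs t == s)%:R : R).
Proof. by move=> tT; apply: (@comb_s _ _ _ _ _ t (fun s' => (s' == s)%:R)). Qed.

Let clam t : (t <= T)%N -> comb T (fun hs ha hr => lamprev pib pie t hs ha).
Proof.
move=> tT; apply: (@comb_prod _ _ _ _ _ t (fun k hs ha _ => eta k (hs k) (ha k))).
move=> k kt; have kT : (k <= T)%N by exact: leq_trans (ltnW kt) tT.
by apply: comb_sa => //; exact: bmf_eta.
Qed.

Let cer t : (t <= T)%N -> comb T (fun hs ha hr => eta t (hs t) (ha t) * y (hr t)).
Proof.
by move=> tT; apply: comb_factor => //; [exact: bmf_eta|exact: bmf_clip].
Qed.

Let Ex_lam t s : (t <= T)%N ->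
  Ex (fun hs ha hr => (hs t == s)%:R * lamprev pib pie t hs ha) = se t s.
Proof. by move=> tT; rewrite -(mean_lamprev s tT); apply/esym; exact: Expect_pib. Qed.

Let Ex_er t s : (t <= T)%N ->
  Ex (fun hs ha hr => (hs t == s)%:R * (eta t (hs t) (ha t) * y (hr t))) = q t s * sb t s.
Proof.
move=> tT; rewrite -(mean_eta_reward s tT); apply/esym; apply: Expect_pib => hs ha hr hrR.
by rewrite /y clip_id// hrR.
Qed.

Lemma wt_ratio t s : (t <= T)%N -> w t s = se t s / sb t s.
Proof. by move=> tT; rewrite /w /wt mean_lamprev. Qed.

(** At unreachable states both sides are zero under the convention [x / 0 = 0]. *)
Lemma mu_eta t s a : (t <= T)%N -> mu_r nu P0 Ps Pr T pib pie t s a = w t s * eta t s a.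
Proof.
by move=> tT; rewrite wt_ratio// /mu_r /eta /eta_r -/(se t s) -/(sb t s) invfM mulrACA.
Qed.

Lemma Ex_dev_num t s : (t <= T)%N -> Ex (fun hs _ _ => (hs t == s)%:R) != 0 ->
  Ex (dev_num eta w t s) = 0.
Proof.
move=> tT; rewrite Ex_state => sb0.
rewrite (_ : dev_num eta w t s = fun hs ha hr => (hs t == s)%:R * lamprev pib pie t hs ha +
  (- w t s) * (hs t == s)%:R); last first.
  by apply/funext => hs; apply/funext => ha; apply/funext => hr;
    rewrite /dev_num /lamprev /eta; ring.
rewrite ExD; [|apply: combM; [exact: cI|exact: clam]|apply: combZ; exact: cI].
by rewrite ExZ Ex_lam// Ex_state wt_ratio// mulNr divfK// subrr.
Qed.

Lemma Ex_dev_reward t s : (t <= T)%N -> Ex (dev_reward eta y q t s) = 0.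
Proof.
move=> tT.
rewrite (_ : dev_reward eta y q t s = fun hs ha hr =>
  (hs t == s)%:R * (eta t (hs t) (ha t) * y (hr t)) + (- q t s) * (hs t == s)%:R);
  last first.
  by apply/funext => hs; apply/funext => ha; apply/funext => hr;
    rewrite /dev_reward; ring.
rewrite ExD; [|apply: combM; [exact: cI|exact: cer]|apply: combZ; exact: cI].
by rewrite ExZ Ex_er// Ex_state mulNr subrr.
Qed.

Let gradient : @trajfun R dA A S := fun hs ha hr =>
  \sum_(t < T.+1) (w t (hs t) * (eta t (hs t) (ha t) * y (hr t)) +
    (lamprev pib pie t hs ha - w t (hs t)) * q t (hs t)).

Let Ex_cst c : Ex (fun _ _ _ => c) = c.
Proof.
rewrite -(@Expect_pib (fun _ _ _ => c))//; rewrite /Expect.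
case: pickP => [sd _|nS].
  exact: (@evalE_const _ _ _ _ nu P0 Pr T Ps pib T.+1 0 _ _ _ _ c P01 Ps1 pib1).
by exfalso; have /eqP := P01; rewrite big1 => [|s]; [rewrite eq_sym oner_eq0|have := nS s].
Qed.

(** State by state, the means of [w M] and [w q N] are both [w q sb] and cancel; there remains
    [q se], whose sum over times and states is [rho]. *)
Lemma Ex_gradient : comb T gradient /\ Ex gradient = rho.
Proof.
pose term t s : @trajfun R dA A S := fun hs ha hr =>
  w t s * ((hs t == s)%:R * (eta t (hs t) (ha t) * y (hr t))) +
  (q t s * ((hs t == s)%:R * lamprev pib pie t hs ha) +
   (- (w t s * q t s)) * (hs t == s)%:R).
have cterm t s : (t <= T)%N -> comb T (term t s).
  move=> tT; apply: combD; first by apply/combZ/combM; [exact: cI|exact: cer].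
  by apply: combD; [apply/combZ/combM; [exact: cI|exact: clam]|apply/combZ; exact: cI].
have Eterm t s : (t <= T)%N -> Ex (term t s) = q t s * se t s.
  move=> tT; rewrite /term ExD; [|by apply/combZ/combM; [exact: cI|exact: cer]|].
    rewrite ExD; [|by apply/combZ/combM; [exact: cI|exact: clam]|by apply/combZ; exact: cI].
    by rewrite !ExZ Ex_er// Ex_lam// Ex_state; ring.
  by apply: combD; [apply/combZ/combM; [exact: cI|exact: clam]|apply/combZ; exact: cI].
have cs (t : nat) : (t <= T)%N ->
    comb T (fun (hs : nat -> S) (ha : nat -> A) hr => \sum_s term t s hs ha hr) /\
    Ex (fun hs ha hr => \sum_s term t s hs ha hr) = \sum_s Ex (term t s).
  move=> tT.
  exact: (comb_functional_sum ExD ExZ (r := index_enum S)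
    (F := term t) (fun s _ => cterm t s tT)).
have -> : gradient = fun hs ha hr => \sum_(t < T.+1) \sum_s term t s hs ha hr.
  apply/funext => hs; apply/funext => ha; apply/funext => hr; apply: eq_bigr => t _.
  rewrite (sum_indicator t hs (fun s => w t s * (eta t (hs t) (ha t) * y (hr t)) +
    (lamprev pib pie t hs ha - w t s) * q t s)).
  by apply: eq_bigr => s _; rewrite /term; ring.
have [c ->] := comb_functional_sum ExD ExZ
  (r := index_enum 'I_T.+1) (fun t _ => (cs t (ltn_ord t)).1).
split=> //; rewrite rho_eE; apply: eq_bigr => t _; have tT : (t <= T)%N := ltn_ord t.
by rewrite (cs t tT).2; apply: eq_bigr => s _; rewrite Eterm.
Qed.

Let inf := influence T eta y w q rho.

Let infE : inf = fun hs ha hr => gradient hs ha hr + (- rho).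
Proof. by []. Qed.

Lemma Ex_influence : Ex inf = 0.
Proof.
have [cg Eg] := Ex_gradient.
by rewrite infE (ExD cg (comb_cst T (- rho))) Ex_cst Eg subrr.
Qed.

Lemma asym_varE : asym_var nu P0 Ps Pr T pib pie = Ex (fun hs ha hr => inf hs ha hr ^+ 2).
Proof.
have [cg Eg] := Ex_gradient.
rewrite /asym_var /Var (@Expect_pib _ (fun hs ha hr => gradient hs ha hr ^+ 2)); last first.
  move=> hs ha hr hrR; congr (_ ^+ 2); apply: eq_bigr => t _; have tT : (t <= T)%N := ltn_ord t.
  by rewrite (mu_eta _ _ tT) /y (clip_id (hrR t tT)) -mulrA.
rewrite (@Expect_pib _ gradient); last first.
  move=> hs ha hr hrR; apply: eq_bigr => t _; have tT : (t <= T)%N := ltn_ord t.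
  by rewrite (mu_eta _ _ tT) /y (clip_id (hrR t tT)) -mulrA.
have cg2 : comb T (fun hs ha hr => gradient hs ha hr ^+ 2).
  by apply: comb_ext (combM cg cg) => hs ha hr; rewrite expr2.
have -> : (fun hs ha hr => inf hs ha hr ^+ 2) = fun hs ha hr =>
    gradient hs ha hr ^+ 2 + ((- (2 * rho)) * gradient hs ha hr + rho ^+ 2).
  by apply/funext => hs; apply/funext => ha; apply/funext => hr; rewrite infE; ring.
have cZ := combZ (- (2 * rho)) cg; have cc := comb_cst (A := A) (S := S) T (rho ^+ 2).
rewrite (ExD cg2 (combD cZ cc)) (ExD cZ cc).
by rewrite ExZ Eg Ex_cst; ring.
Qed.

End Population.

(** * State probabilities read off from the observed data *)

Section ObservedStates.
Context {R : realType} {dA : measure_display} {A : measurableType dA}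
  {S : finType} {dO : measure_display} {Omega : measurableType dO}.
Variables (T : nat) (P : probability Omega R) (E : @trajfun R dA A S -> R)
  (sD : nat -> nat -> Omega -> S) (aD : nat -> nat -> Omega -> A)
  (rD : nat -> nat -> Omega -> R).
Hypothesis msD : forall i t s, measurable [set w | sD i t w = s].
Hypothesis law : forall (n : nat) (BS : nat -> nat -> set S)
    (BA : nat -> nat -> set A) (BR : nat -> nat -> set R),
  (forall i t, measurable (BA i t) /\ measurable (BR i t)) ->
  P [set w | forall i, (i < n)%N -> forall t, (t <= T)%N ->
       BS i t (sD i t w) /\ BA i t (aD i t w) /\ BR i t (rD i t w)]
  = (\prod_(i < n) E (rect T (BS i) (BA i) (BR i)))%:E.

Let P1 : P setT = 1%E. Proof. exact: probability_setT. Qed.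

Let st t s := [set w | sD 0 t w = s].

Let mst t s : measurable (st t s). Proof. exact: msD. Qed.

Let mst2 t s s' : measurable (st t s `&` st t.+1 s').
Proof. exact: measurableI. Qed.

(** With transitions not known to be measurable, the nested integral has no evident positivity,
    additivity or monotonicity. On events of the states it equals a probability under [P], which
    supplies these properties. *)
Lemma state_law (BS : nat -> set S) :
  P [set w | forall t, (t <= T)%N -> BS t (sD 0 t w)] =
  (E (fun hs _ _ => \prod_(t < T.+1) \1_(BS t) (hs t)))%:E.
Proof.
have -> : (fun hs _ _ => \prod_(t < T.+1) \1_(BS t) (hs t)) =
    rect T BS (fun=> setT) (fun=> setT) :> @trajfun R dA A S.
  apply/funext => hs; apply/funext => ha; apply/funext => hr; apply: eq_bigr => t _.
  by rewrite !indicT !mulr1.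
have := @law 1 (fun=> BS) (fun _ _ => setT) (fun _ _ => setT)
  (fun _ _ => conj measurableT measurableT).
rewrite big_ord1 => <-; congr (P _); apply/seteqP; split => w.
  by move=> H [|i]// _ t tT; split=> //; exact: H.
by move=> H t tT; have [] := H 0 isT t tT.
Qed.

Let indic1 (s u : S) : \1_[set s] u = (u == s)%:R :> R.
Proof.
rewrite indicE; congr ((nat_of_bool _)%:R).
by apply/idP/eqP => [/set_mem|->]; [|exact: mem_set].
Qed.

Lemma mean_state t s : (t <= T)%N ->
  E (fun hs _ _ => (hs t == s)%:R) = \int[P]_w (\1_(st t s) w : R).
Proof.
move=> tT; apply: EFin_inj; rewrite (mean_indic P1); last exact: msD.
pose BS := upd (fun=> setT) t [set s].
have := state_law BS.
have -> : (fun hs _ _ => \prod_(k < T.+1) \1_(BS k) (hs k)) =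
    (fun hs _ _ => (hs t == s)%:R) :> @trajfun R dA A S.
  apply/funext => hs; apply/funext => ha; apply/funext => hr.
  rewrite (bigD1 (Ordinal (tT : (t < T.+1)%N)))//= {1}/BS updE big1 ?mulr1 ?indic1//.
  by move=> k; rewrite -val_eqE /BS /= => kt; rewrite upd_neq// indicT.
move=> <-; congr (P _); apply/seteqP; split => w.
  by move=> /(_ t tT); rewrite /BS updE.
move=> H k kT; rewrite /BS; have [->|kt] := eqVneq k t; first by rewrite updE.
by rewrite upd_neq.
Qed.

Lemma mean_state_pair t s s' : (t < T)%N ->
  E (fun hs _ _ => (hs t == s)%:R * (hs t.+1 == s')%:R) =
  \int[P]_w (\1_(st t s `&` st t.+1 s') w : R).
Proof.
move=> tT; apply: EFin_inj; rewrite (mean_indic P1); last exact: mst2.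
pose BS := upd (upd (fun=> setT) t [set s]) t.+1 [set s'].
have tt1 : t != t.+1 by rewrite neq_ltn ltnSn.
have := state_law BS.
have -> : (fun hs _ _ => \prod_(k < T.+1) \1_(BS k) (hs k)) =
    (fun hs _ _ => (hs t == s)%:R * (hs t.+1 == s')%:R) :> @trajfun R dA A S.
  apply/funext => hs; apply/funext => ha; apply/funext => hr.
  rewrite (bigD1 (Ordinal (ltnW tT : (t < T.+1)%N)))//=.
  rewrite (bigD1 (Ordinal (tT : (t.+1 < T.+1)%N)))//=; last first.
    by rewrite -val_eqE /= eq_sym.
  rewrite {1}/BS upd_neq// updE {1}/BS updE big1 ?mulr1 ?indic1//.
  move=> k; rewrite -!val_eqE /BS /= => /andP[kt kt1].
  by rewrite !upd_neq// indicT.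
move=> <-; congr (P _); apply/seteqP; split => w.
  move=> H; split.
    by have := H t (ltnW tT); rewrite /BS upd_neq// updE.
  by have := H t.+1 tT; rewrite /BS updE.
move=> [H1 H2] k kT; rewrite /BS; have [->|kt1] := eqVneq k t.+1; first by rewrite updE.
rewrite upd_neq//; have [->|kt] := eqVneq k t; first by rewrite updE.
by rewrite upd_neq.
Qed.

Lemma mean_state_ge0 t s : (t <= T)%N -> 0 <= E (fun hs _ _ => (hs t == s)%:R).
Proof.
by move=> tT; rewrite mean_state//; apply: mean_ge0 => w; rewrite indicE ler0n.
Qed.

Lemma mean_state_pair_sum t s : (t < T)%N ->
  \sum_(s' : S) E (fun hs _ _ => (hs t == s)%:R * (hs t.+1 == s')%:R) =
  E (fun hs _ _ => (hs t == s)%:R).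
Proof.
move=> tT; under eq_bigr do rewrite (mean_state_pair _ _ tT).
rewrite (mean_state s (ltnW tT)) -(mean_sum P1); last first.
  by move=> s'; apply: bmf_indic; exact: mst2.
apply: eq_Rintegral => w _; rewrite (bigD1 (sD 0 t.+1 w))//= big1 ?addr0 => [|s' ne].
  rewrite !indicE; congr ((nat_of_bool _)%:R).
  by apply/idP/idP => /set_mem H; apply: mem_set; [case: H|split].
rewrite indicE memNset// => -[_ /= e]; move: ne; by rewrite -e eqxx.
Qed.

Lemma mean_state_pair_null t s s' : (t < T)%N ->
  E (fun hs _ _ => (hs t.+1 == s')%:R) = 0 ->
  E (fun hs _ _ => (hs t == s)%:R * (hs t.+1 == s')%:R) = 0.
Proof.
move=> tT; rewrite mean_state// mean_state_pair// => s0.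
have bi B : measurable B -> bmf (\1_B : Omega -> R) by exact: bmf_indic.
apply/eqP; rewrite eq_le; apply/andP; split; last first.
  by apply: mean_ge0 => w; rewrite indicE ler0n.
rewrite -s0; apply: (mean_le P1); [by apply: bi; exact: mst2|by apply: bi; exact: mst|].
move=> w; rewrite !indicE ler_nat.
by case: (boolP (w \in _ `&` _)) => // /set_mem[_ H]; rewrite mem_set.
Qed.

End ObservedStates.

(** * Convergence statements from explicit bounds, and the theorem *)

Lemma conv_prob_of_le {R : realType} {d} {Omega : measurableType d}
    (P : probability Omega R) (X : nat -> Omega -> R) (c : R) :
  (forall n eps, measurable [set w | eps < `|X n w - c|]) ->
  (forall eps e : R, 0 < eps -> 0 < e -> exists n0, forall n, (n0 <= n)%N ->
    (P [set w | (eps < `|X n w - c|)%R] <= e%:E)%E) ->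
  conv_prob P X c.
Proof.
move=> mX H eps eps0; apply/fine_cvgP; split.
  by apply: nearW => n; exact: fin_num_measure.
apply/cvgrPdist_le => e e0; have [n0 Hn0] := H eps e eps0 e0.
exists n0 => // n /= n0n; rewrite sub0r normrN ger0_norm ?fine_ge0//.
by rewrite -lee_fin fineK ?Hn0// fin_num_measure.
Qed.

Lemma gaussE_EFin {R : realType} (V : R) (g : R -> R) : continuous g ->
  (exists M, forall x, `|g x| <= M) ->
  gaussE V g =
  (if V == 0 then g 0 else \int[normal_prob 0 (Num.sqrt V)]_x g x)%:E.
Proof.
move=> cg bg; rewrite /gaussE; case: ifP => // _.
have N1 : normal_prob 0 (Num.sqrt V) setT = 1%E :> \bar R by exact: probability_setT.
have b : bmf (g : measurableTypeR R -> R) by split => //; exact: continuous_measurable_fun.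
by rewrite /Rintegral fineK//; apply: integrable_fin_num => //; exact: bmf_integrable N1 _ b.
Qed.

(** The null set is common to all [n], so that the estimator with observed rewards can be exchanged
    for the clipped one along the whole sequence. *)
Lemma conv_dist_normal_of_le {R : realType} {d} {Omega : measurableType d}
    (P : probability Omega R) (X Y : nat -> Omega -> R) (V : R) (N : set Omega) :
  measurable N -> P N = 0%E ->
  (forall n w, ~ N w -> X n w = Y n w) ->
  (forall n, measurable_fun setT (Y n)) ->
  (forall (g : R -> R) (e : R), continuous g -> (exists M, forall x, `|g x| <= M) ->
    0 < e -> exists n0, forall n, (n0 <= n)%N ->
    `|\int[P]_w g (Y n w) -
      (if V == 0 then g 0 else \int[normal_prob 0 (Num.sqrt V)]_x g x)| <= e) ->
  conv_dist_normal P X V.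
Proof.
move=> mN N0 XY mY H g cg bg; rewrite gaussE_EFin//.
have P1 : P setT = 1%E by exact: probability_setT.
have bgY n : bmf (fun w => g (Y n w)) := bmf_comp_cont (mY n) cg bg.
rewrite (_ : (fun n => _) = fun n => (\int[P]_w g (Y n w))%:E); last first.
  apply/funext => n; rewrite /Rintegral fineK; last first.
    by apply: integrable_fin_num => //; exact: (bmf_integrable P1 (bgY n)).
  by apply: (integral_eq_off_null mN N0) => w nNw; rewrite XY.
apply: cvg_EFin; first exact: nearW.
apply/cvgrPdist_le => e e0; have [n0 Hn0] := H g e cg bg e0.
by exists n0 => // n /= n0n; rewrite distrC; exact: Hn0.
Qed.

Theorem theorem13 (R : realType) (T : nat) (S : finType)
  (dA : measure_display) (A : measurableType dA)
  (nu : {measure set A -> \bar R}) (P0 : S -> R)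
  (Ps : nat -> S -> A -> S -> R) (Pr : nat -> S -> R.-pker A ~> R)
  (pib pie : nat -> S -> A -> R) (C C' Rmax : R)
  (dO : measure_display) (Omega : measurableType dO) (P : probability Omega R)
  (sD : nat -> nat -> Omega -> S) (aD : nat -> nat -> Omega -> A)
  (rD : nat -> nat -> Omega -> R) :
  (* MDP kernels *)
  (forall s, 0 <= P0 s) -> \sum_(s : S) P0 s = 1 ->
  (forall t, (1 <= t <= T)%N -> forall s a,
      (forall s', 0 <= Ps t s a s') /\ \sum_(s' : S) Ps t s a s' = 1) ->
  (* bounded rewards: 0 <= r_t <= Rmax *)
  (forall t, (t <= T)%N -> forall s a, Pr t s a `[0, Rmax]%classic = 1%E) ->
  (* Markov policies given by densities w.r.t. nu *)
  (forall t, (t <= T)%N -> forall s,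
      measurable_fun setT (pib t s) /\ (forall a, 0 <= pib t s a) /\
      (\int[nu]_a (pib t s a)%:E = 1)%E) ->
  (forall t, (t <= T)%N -> forall s,
      measurable_fun setT (pie t s) /\ (forall a, 0 <= pie t s a) /\
      (\int[nu]_a (pie t s a)%:E = 1)%E) ->
  (* eta_t is a well-defined ratio, 0 <= eta_t <= C *)
  (forall t, (t <= T)%N -> forall s a, pib t s a = 0 -> pie t s a = 0) ->
  (forall t, (t <= T)%N -> forall s a, 0 <= eta_r pib pie t s a <= C) ->
  (* 0 <= mu_t <= C' *)
  (forall t, (t <= T)%N -> forall s a,
      0 <= mu_r nu P0 Ps Pr T pib pie t s a <= C') ->
  (* the data are random variables on (Omega, P) ... *)
  (forall i t s, measurable [set w | sD i t w = s]) ->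
  (forall i t, measurable_fun setT (aD i t)) ->
  (forall i t, measurable_fun setT (rD i t)) ->
  (* ... and the trajectories H^(1), H^(2), ... are i.i.d. with law P_{pi^b}
     (joint law of H^(0..n-1) on measurable rectangles) *)
  (forall (n : nat) (BS : nat -> nat -> set S) (BA : nat -> nat -> set A)
          (BR : nat -> nat -> set R),
      (forall i t, measurable (BA i t) /\ measurable (BR i t)) ->
      P [set w | forall i, (i < n)%N -> forall t, (t <= T)%N ->
                   BS i t (sD i t w) /\ BA i t (aD i t w) /\ BR i t (rD i t w)]
      = (\prod_(i < n) Expect nu P0 Ps Pr T pib (fun hs ha hr =>
           \prod_(t < T.+1) (\1_(BS i t) (hs t) * \1_(BA i t) (ha t)
                              * \1_(BR i t) (hr t))))%:E) ->
  (* consistency *)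
  conv_prob P (rho_MIS T pib pie sD aD rD) (rho_e nu P0 Ps Pr T pie)
  /\
  (* asymptotic normality with asymptotic MSE asym_var *)
  conv_dist_normal P
    (fun n w => Num.sqrt n%:R *
       (rho_MIS T pib pie sD aD rD n w - rho_e nu P0 Ps Pr T pie))
    (asym_var nu P0 Ps Pr T pib pie).
Proof.
move=> P0_ge0 P01 Ps_ker Pr_supp pib_pol pie_pol dom etaC _ msD maD mrD hlaw.
have Ps1 : kernel_sum1 T Ps by move=> t tT s a; exact: (Ps_ker t tT s a).2.
have Ps0 t : (1 <= t <= T)%N -> forall s a s', 0 <= Ps t s a s'.
  by move=> tT s a; exact: (Ps_ker t tT s a).1.
have mpib t : (t <= T)%N -> forall s, measurable_fun setT (pib t s).
  by move=> tT s; have [] := pib_pol t tT s.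
have pib0 t : (t <= T)%N -> forall s a, 0 <= pib t s a.
  by move=> tT s; have [_ []] := pib_pol t tT s.
have pib1 : policy_sum1 nu T pib by move=> t tT s; have [_ []] := pib_pol t tT s.
have mpie t : (t <= T)%N -> forall s, measurable_fun setT (pie t s).
  by move=> tT s; have [] := pie_pol t tT s.
have pie0 t : (t <= T)%N -> forall s a, 0 <= pie t s a.
  by move=> tT s; have [_ []] := pie_pol t tT s.
have pie1 : policy_sum1 nu T pie by move=> t tT s; have [_ []] := pie_pol t tT s.
have sP0 t : (t <= T)%N -> forall s, 0 <= stateProb nu P0 Ps Pr T pib t s.
  by move=> tT s; exact: (mean_state_ge0 msD hlaw s tT).
have pair_sum t : (t < T)%N -> forall s, _ :=
  fun tT s => mean_state_pair_sum msD hlaw s tT.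
have pair_null t : (t < T)%N -> forall s s', _ :=
  fun tT s s' => @mean_state_pair_null _ _ _ _ _ _ _ _ _ _ _ _ msD hlaw t s s' tT.
have [Ps' [mPs' Ps'_01 version]] := measurable_version P01 Ps0 Ps1 Pr_supp
  mpib pib0 pib1 sP0 pair_sum pair_null.
(* The uniform bound on [Ex] asks for a state; one exists because [P0] sums to 1. *)
have [s0] : exists s0 : S, True.
  apply: contrapT => nS; have /eqP := P01; rewrite big1 => [|s _].
    by rewrite eq_sym oner_eq0.
  by exfalso; apply: nS; exists s.
move=> _.
pose Ex := Expect nu P0 Ps' Pr T pib.
have rangeP pi : pi = pib -> forall f f' : @trajfun R dA A S,
    (forall hs ha hr, (forall k, (k <= T)%N -> 0 <= hr k <= Rmax) ->
      f hs ha hr = f' hs ha hr) ->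
    Expect nu P0 Ps Pr T pi f = Expect nu P0 Ps' Pr T pi f'.
  by move=> ->; apply: version.
have ExD f g : comb T f -> comb T g ->
    Ex (fun hs ha hr => f hs ha hr + g hs ha hr) = Ex f + Ex g.
  exact: ExpectD.
have ExZ c f : comb T f -> Ex (fun hs ha hr => c * f hs ha hr) = c * Ex f.
  by move=> _; exact: ExpectZ.
have ExB f (b : R) : comb T f -> (forall hs ha hr, `|f hs ha hr| <= b) ->
    `|Ex f| <= #|S|%:R ^+ T.+1 * b.
  exact: (Expect_bound Pr (P0_01 P0_ge0 P01) mPs' Ps'_01 mpib pib0 pib1 s0).
have law n (BS : nat -> nat -> set S) (BA : nat -> nat -> set A)
    (BR : nat -> nat -> set R) :
    (forall i t, measurable (BA i t) /\ measurable (BR i t)) ->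
    P [set w | forall i, (i < n)%N -> forall t, (t <= T)%N ->
       BS i t (sD i t w) /\ BA i t (aD i t w) /\ BR i t (rD i t w)]
    = (\prod_(i < n) Ex (rect T (BS i) (BA i) (BR i)))%:E.
  move=> mB; apply: (etrans (hlaw n BS BA BR mB)); congr EFin; apply: eq_bigr => i _.
  exact: (rangeP pib erefl).
set rho := rho_e nu P0 Ps Pr T pie.
pose eta := eta_r pib pie.
have beta : forall t, (t <= T)%N -> forall s, bmf (eta t s).
  by move=> t tT s; exact: (bmf_eta mpib pib0 mpie etaC tT s).
pose y := clip Rmax; have by_ : bmf y := bmf_clip Rmax.
pose wgt := wt nu P0 Ps Pr T pib pie; pose q := qe nu Pr pie.
have dev_num0 t s (tT : (t <= T)%N) := @Ex_dev_num _ _ _ _ nu P0 Ps Ps' Pr T pib pie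
  C Rmax P01 Ps1 mpib pib0 pib1 mpie pie1 dom etaC mPs' Ps'_01 version t s tT.
have dev_reward0 t s (tT : (t <= T)%N) := @Ex_dev_reward _ _ _ _ nu P0 Ps Ps' Pr T pib pie
  C Rmax P01 Ps1 mpib pib0 pib1 mpie pie1 dom etaC mPs' Ps'_01 version t s tT.
have inf0 := Ex_influence P01 Ps1 mpib pib0 pib1 mpie pie0 pie1 dom etaC mPs' Ps'_01 version.
have varE := asym_varE P01 Ps1 mpib pib0 pib1 mpie pie0 pie1 dom etaC mPs' Ps'_01 version.
pose est := estimate T sD aD rD eta y.
have mest n : measurable_fun setT (est n) := measurable_estimate msD maD mrD beta by_ n.
(* The estimator with the observed rewards. It can differ from [est] only if some reward leaves
   [[0, Rmax]], which is excluded by a countable union of null sets. *)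
pose raw n w := n%:R^-1 * \sum_(i < n) \sum_(t < T.+1)
  (weight_hat sD aD rD eta n t (sD i t w) w * (eta t (sD i t w) (aD i t w) * rD i t w)).
have rawE : rho_MIS T pib pie sD aD rD = raw.
  apply/funext => n; apply/funext => w; congr (_ * _); apply: eq_bigr => i _.
  by apply: eq_bigr => t _; rewrite -mulrA.
have mraw n : measurable_fun setT (raw n).
  apply: (measurable_weighted msD maD mrD beta n
    (z := fun i t w => eta t (sD i t w) (aD i t w) * rD i t w)) => i t tT.
  have b := bmf_at_traj msD maD mrD i (comb_sa tT (beta t tT)).
  exact: measurable_funM b.1 (mrD i t).
have Ex1 : Ex (fun _ _ _ => 1) = 1.
  rewrite -[RHS](Ex_full law); congr Ex; apply/funext => hs; apply/funext => ha.
  by apply/funext => hr; rewrite /rect big1// => t _; rewrite !indicT !mulr1.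
have bad_null i t : (t <= T)%N ->
    P.-negligible [set w | ~ (0 <= rD i t w <= Rmax)].
  move=> tT; pose BR := upd (fun=> setT) t `[0, Rmax]%classic.
  have mBR k : measurable (BR k : set R).
    rewrite /BR; have [->|kt] := eqVneq k t; first by rewrite updE; exact: measurable_itv.
    by rewrite upd_neq.
  pose B := rD i t @^-1` `[0, Rmax]%classic.
  have mB : measurable B by rewrite -[B]setTI; apply: mrD => //; exact: measurable_itv.
  exists (~` B); split; [exact: measurableC| |].
    apply: (@null_setC _ _ _ P) => //; first exact: probability_setT.
    have PB : P B = (Ex (rect T (fun=> setT) (fun=> setT) BR))%:E.
      rewrite -(prob_rect law i (fun=> setT) (fun=> measurableT) mBR).
      congr (P _); apply/seteqP; split => w.
        move=> H k kT; split=> //; split=> //; rewrite /BR.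
        by have [->|kt] := eqVneq k t; [rewrite updE|rewrite upd_neq].
      by move=> /(_ t tT)[_ [_]]; rewrite /BR updE.
    apply: (etrans PB); congr EFin; rewrite -[RHS]Ex1.
    (* The passage through the original kernel [Ps] allows the two functions to be compared on
       rewards in range only, where both equal 1. *)
    apply: (etrans (esym (rangeP pib erefl _ _ (fun _ _ _ _ => erefl)))).
    apply: (rangeP pib erefl) => hs ha hr hrR.
    rewrite /rect big1// => k _; rewrite !indicT !mul1r.
    rewrite indicE mem_set// /BR; have [->|kt] := eqVneq (k : nat) t.
      by rewrite updE /= in_itv/= hrR.
    by rewrite upd_neq.
  by move=> w /= H; rewrite /B /= in_itv /=.
have [N [mN N0 subN]] : P.-negligible
    (\bigcup_i \bigcup_t [set w | (t <= T)%N /\ ~ (0 <= rD i t w <= Rmax)]).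
  apply: negligible_bigcup => i; apply: negligible_bigcup => t.
  have [tT|tT] := boolP (t <= T)%N.
    by apply: negligibleS (bad_null i t tT) => w [].
  by apply: negligibleS (negligible_set0 P) => w /= [] tT'.
have raw_est n w : ~ N w -> raw n w = est n w.
  move=> nNw; congr (_ * _); apply: eq_bigr => i _; apply: eq_bigr => t _.
  congr (_ * _); rewrite /at_traj; congr (_ * _); rewrite /y clip_id//.
  apply: contrapT => bad; apply: nNw; apply: subN; exists (i : nat) => //.
  by exists (t : nat) => //; split=> //; rewrite -ltnS ltn_ord.
have mdev (X : Omega -> R) (eps : R) : measurable_fun setT X ->
    measurable [set w | eps < `|X w - rho|].
  move=> mX.
  rewrite (_ : [set w | _] = (fun w => `|X w - rho|) @^-1` `]eps, +oo[%classic).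
    rewrite -[X in measurable X]setTI.
    apply: (measurableT_comp (f := fun x : R => `|x|)) => //.
    exact: measurable_funB.
  by apply/seteqP; split=> w; rewrite /= in_itv/= andbT.
rewrite rawE; split.
  apply: conv_prob_of_le => [n eps|eps e eps0 e0]; first exact: mdev.
  have [n0 Hn0] := estimate_consistent ExD ExZ ExB msD maD mrD law beta by_
    dev_num0 dev_reward0 inf0 eps0 e0.
  exists n0 => n n0n; apply: le_trans (Hn0 n n0n).
  have P1 : P setT = 1%E by exact: probability_setT.
  rewrite -(mean_indic P1 (mdev (raw n) eps (mraw n))).
  rewrite -(mean_indic P1 (mdev (est n) eps (mest n))).
  rewrite le_eqVlt; apply/orP; left; apply/eqP; congr EFin.
  apply: (Rintegral_eq_off_null mN N0) => w nNw; rewrite !indicE.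
  congr ((nat_of_bool _)%:R).
  by apply/idP/idP => /set_mem H; apply: mem_set; move: H => /=; rewrite raw_est.
apply: (@conv_dist_normal_of_le _ _ _ P _
  (fun n w => Num.sqrt n%:R * (est n w - rho)) _ N mN N0).
- by move=> n w nNw; rewrite raw_est.
- by move=> n; apply: measurable_funM => //; apply: measurable_funB.
- move=> g e cg bg e0; rewrite varE.
  exact: (estimate_normal ExD ExZ ExB msD maD mrD law beta by_ dev_num0 dev_reward0 inf0).
Qed.
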